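(* Let $D\subset\mathbb{C}$ be a domain, let $\mathcal{F}$ be a family of meromorphic functions on $D$, let $m\ge 0$ be an integer, and let $\psi\not\equiv 0$ be a holomorphic function on $D$ all of whose zeros have multiplicity at most $m$. Suppose that one of the following two alternatives holds: (A) for every $f\in\mathcal{F}$, all poles of $f$ have multiplicity at least $3(m+1)$ and all zeros of $f$ have multiplicity at least $2(m+1)$; or (B) for every $f\in\mathcal{F}$, all poles of $f$ have multiplicity at least $2(m+1)$ and all zeros of $f$ have multiplicity at least $3(m+1)$. Suppose moreover that every pair $f,g\in\mathcal{F}$ shares $\psi$ IM in $D$. Then $\mathcal{F}$ is normal in $D$.
   Context: A domain is a nonempty connected open subset of $\mathbb{C}$. Two functions $f,g$ share a function $h$ IM in $D$ if $\{z\in D: f(z)=h(z)\}=\{z\in D: g(z)=h(z)\}$. A family of meromorphic functions on $D$ is normal in $D$ if every sequence in the family has a subsequence which converges uniformly on compact subsets of $D$, with respect to the spherical metric, to a meromorphic function on $D$ or to the constant $\infty$. *)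

(* Defs.v *)
From HB Require Import structures.
From mathcomp Require Import all_boot all_order all_algebra.
From mathcomp Require Import all_classical all_reals all_analysis.
From mathcomp Require Import complex.

Set Implicit Arguments.
Unset Strict Implicit.
Unset Printing Implicit Defensive.

Import Order.TTheory GRing.Theory Num.Theory.
Import numFieldNormedType.Exports.

Local Open Scope classical_set_scope.
Local Open Scope ring_scope.

(* R[i] packaged as a numClosedFieldType, so that the norm topology and the
   structure of normed module over itself are inferred. *)
Definition Cplane (R : realType) : numClosedFieldType := R[i].

(* The Riemann sphere; None is the point at infinity. *)
Definition sphere (R : realType) := option (Cplane R).

Section MeromorphicFunctions.
Variable R : realType.
Local Notation C := (Cplane R).
Local Notation S := (sphere R).

Definition domain (D : set C) : Prop :=
  [/\ D !=set0, open D & connected D].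

(* derivable is taken over the field C: this is complex differentiability. *)
Definition holomorphic_on (D : set C) (h : C -> C) : Prop :=
  forall z, D z -> derivable h z 1.

Definition holomorphic_near (z0 : C) (h : C -> C) : Prop :=
  \forall z \near z0, derivable h z 1.

(* Values of f outside the open set under consideration are irrelevant in all
   that follows. A function vanishing identically near z0 has no zero of finite
   multiplicity at z0. *)
Definition zero_of_mult (f : C -> S) (z0 : C) (k : nat) : Prop :=
  (0 < k)%N /\
  exists h : C -> C, [/\ holomorphic_near z0 h, h z0 != 0 &
    \forall z \near z0, f z = Some ((z - z0) ^+ k * h z)].

Definition pole_of_mult (f : C -> S) (z0 : C) (k : nat) : Prop :=
  (0 < k)%N /\
  exists h : C -> C, [/\ holomorphic_near z0 h, h z0 != 0, f z0 = None &
    \forall z \near z0^', f z = Some (h z / (z - z0) ^+ k)].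

Definition meromorphic_on (D : set C) (f : C -> S) : Prop :=
  forall z0, D z0 ->
    (exists2 h : C -> C, holomorphic_near z0 h &
       \forall z \near z0, f z = Some (h z)) \/
    (exists k, pole_of_mult f z0 k).

Definition zeros_mult_ge (D : set C) (f : C -> S) (k : nat) : Prop :=
  forall z n, D z -> zero_of_mult f z n -> (k <= n)%N.

Definition poles_mult_ge (D : set C) (f : C -> S) (k : nat) : Prop :=
  forall z n, D z -> pole_of_mult f z n -> (k <= n)%N.

Definition zeros_mult_le (D : set C) (f : C -> S) (k : nat) : Prop :=
  forall z n, D z -> zero_of_mult f z n -> (n <= k)%N.

Definition share_IM (D : set C) (f g h : C -> S) : Prop :=
  [set z | D z /\ f z = h z] = [set z | D z /\ g z = h z].

(* The real-valued modulus; `|z| itself lives in C. *)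
Definition modulus (z : C) : R := complex.Re (`|z| : R[i]).

(* Euclidean distance in R^3 between the points of the unit sphere that
   correspond to p and q by stereographic projection. *)
Definition chordal_dist (p q : S) : R :=
  match p, q with
  | Some z, Some w => 2 * modulus (z - w) /
      (Num.sqrt (1 + modulus z ^+ 2) * Num.sqrt (1 + modulus w ^+ 2))
  | Some z, None | None, Some z => 2 / Num.sqrt (1 + modulus z ^+ 2)
  | None, None => 0
  end.

(* Length of the arc of great circle subtended by the chord. *)
Definition spherical_dist (p q : S) : R := 2 * asin (chordal_dist p q / 2).

Definition spherical_locally_uniform_cvg (D : set C) (f : nat -> C -> S)
    (g : C -> S) : Prop :=
  forall K, compactly_in D K -> forall e : R, 0 < e ->
    exists N, forall n, (N <= n)%N ->
      forall z, K z -> spherical_dist (f n z) (g z) < e.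

Definition normal_family (D : set C) (F : set (C -> S)) : Prop :=
  forall f : nat -> C -> S, (forall n, F (f n)) ->
    exists2 phi : nat -> nat, {homo phi : i j / (i < j)%N} &
    exists2 g : C -> S, meromorphic_on D g \/ (forall z, D z -> g z = None) &
      spherical_locally_uniform_cvg D (f \o phi) g.

End MeromorphicFunctions.

(* Main.v *)
(* Near z0, either every member of the family coincides with psi, or every F
   satisfies F <> psi off z0.  In the second case Q = F / psi omits the value 1 off
   z0 and takes 0 and infinity there with orders at least 2 and 3 (or 3 and 2), so
   that w |-> Q (z0 + w ^ 31) takes 0, infinity and 1 with orders at least 2, 3 and
   31 everywhere (after z |-> 1/z, if necessary).  Since 1/2 + 1/3 + 1/31 < 1, an
   explicit conformal metric on C \ {0, 1} of curvature bounded above by a negative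
   constant pulls back to a continuous density, and the Ahlfors-Schwarz argument
   bounds it: these maps are Lipschitz into the sphere, uniformly in F.  Hence the
   quotients are equicontinuous at z0, and so are the F: multiplying by psi is
   harmless unless psi z0 = 0 and Q z0 = infinity, where the maximum principle
   controls 1 / F.  Normality follows by the Arzela-Ascoli argument and the
   identity theorem.
   No integral of 1/z is ever evaluated: the maximum principle comes from Goursat's
   lemma for the difference quotient on a square, and Taylor bounds, removable
   singularities and limits of holomorphic functions come from the maximum
   principle. *)
Require Import Defs.
From HB Require Import structures.
From mathcomp Require Import all_boot all_order all_algebra.
From mathcomp Require Import all_classical all_reals all_analysis.
From mathcomp Require Import complex ring lra zify.

Set Implicit Arguments.
Unset Strict Implicit.
Unset Printing Implicit Defensive.

Import Order.TTheory GRing.Theory Num.Theory.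
Import numFieldNormedType.Exports.

Local Open Scope classical_set_scope.
Local Open Scope ring_scope.

(** * Complex numbers in real coordinates, and complex differentiability with real radii *)

Section ComplexPlane.
Variable R : realType.
Local Notation C := (Cplane R).

(** Sharing is what makes the local estimates uniform: if a single member differs from psi on a
    punctured disc around z0, then every member does, on the same disc. The factor m + 1 in the
    multiplicities makes the zeros of F outweigh a zero of psi, so that F / psi vanishes wherever F
    does. The value 1 is omitted off z0, so the order prescribed there is free, and it is chosen to
    suit an elementary metric. A metric of negative curvature on the sphere with singularities |u| ^
    (-a) at three points needs exponents a whose sum exceeds 2 (Gauss-Bonnet), while a map of order
    p pulls such a singularity back to 0 if a < 1 - 1/p. The exponents 14/30, 19/30 and 29/30 add up
    to 62/30, and 31 is the least p with 29/30 < 1 - 1/p. All the curvature comes from ln (1 + |w| ^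
    (1/30)) and ln (1 + |w - 1| ^ (1/30)), every other term of the logarithm of the metric being
    harmonic. *)

Definition re (z : C) : R := complex.Re (z : R[i]).
Definition im (z : C) : R := complex.Im (z : R[i]).
Definition mkC (a b : R) : C := Complex a b.

Lemma mkC_eta z : mkC (re z) (im z) = z. Proof. by case: z. Qed.
Lemma eqC z w : re z = re w -> im z = im w -> z = w.
Proof. by case: z => a b; case: w => c d; rewrite /re /im /= => -> ->. Qed.
Lemma re_mkC a b : re (mkC a b) = a. Proof. by []. Qed.
Lemma im_mkC a b : im (mkC a b) = b. Proof. by []. Qed.
Lemma reD z w : re (z + w) = re z + re w. Proof. by case: z; case: w. Qed.
Lemma imD z w : im (z + w) = im z + im w. Proof. by case: z; case: w. Qed.
Lemma reN z : re (- z) = - re z. Proof. by case: z. Qed.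
Lemma imN z : im (- z) = - im z. Proof. by case: z. Qed.
Lemma reM z w : re (z * w) = re z * re w - im z * im w.
Proof. by case: z; case: w. Qed.
Lemma imM z w : im (z * w) = re z * im w + im z * re w.
Proof. by case: z; case: w. Qed.
Lemma re0 : re 0 = 0. Proof. by []. Qed.
Lemma im0 : im 0 = 0. Proof. by []. Qed.
Lemma re1 : re 1 = 1. Proof. by []. Qed.
Lemma im1 : im 1 = 0. Proof. by []. Qed.
Definition reimE := (reD, imD, reN, imN, reM, imM, re0, im0, re1, im1, re_mkC, im_mkC).

Local Notation md := (@modulus R).

Lemma normCmd (z : C) : `|z| = mkC (md z) 0.
Proof. by rewrite /modulus /mkC; case: z => a b. Qed.

Lemma mdE z : md z = Num.sqrt (re z ^+ 2 + im z ^+ 2).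
Proof. by case: z => a b. Qed.

Lemma md_ge0 z : 0 <= md z. Proof. by rewrite mdE sqrtr_ge0. Qed.
Lemma md_sq z : md z ^+ 2 = re z ^+ 2 + im z ^+ 2.
Proof. by rewrite mdE sqr_sqrtr// addr_ge0// sqr_ge0. Qed.
Lemma mdM z w : md (z * w) = md z * md w.
Proof.
rewrite !mdE -sqrtrM ?addr_ge0 ?sqr_ge0//; congr Num.sqrt; rewrite !reimE; ring.
Qed.
Lemma mdD z w : md (z + w) <= md z + md w.
Proof.
by have := ler_normD z w; rewrite !normCmd [X in (_ <= X)%R]/GRing.add /= /mkC lecE /= => /andP[].
Qed.
Lemma md0 : md 0 = 0.
Proof. by rewrite mdE !reimE expr0n /= addr0 sqrtr0. Qed.
Lemma md1 : md 1 = 1.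
Proof. by rewrite mdE !reimE expr0n /= addr0 expr1n sqrtr1. Qed.
Lemma mdN z : md (- z) = md z.
Proof. by rewrite !mdE !reimE !sqrrN. Qed.
Lemma mdBC z w : md (z - w) = md (w - z).
Proof. by rewrite -mdN opprB. Qed.
Lemma md_eq0 z : (md z == 0) = (z == 0).
Proof.
apply/eqP/eqP => [h|->]; last exact: md0.
have := md_sq z; rewrite h expr0n /= => /esym/eqP.
rewrite paddr_eq0 ?sqr_ge0// !sqrf_eq0 => /andP[/eqP a /eqP b].
exact: eqC.
Qed.
Lemma md_gt0 z : (0 < md z) = (z != 0).
Proof. by rewrite lt_def md_ge0 andbT md_eq0. Qed.
Lemma mdX z n : md (z ^+ n) = md z ^+ n.
Proof. by elim: n => [|n ih]; rewrite ?expr0 ?md1// !exprS mdM ih. Qed.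
Lemma mdV z : md z^-1 = (md z)^-1.
Proof.
have [->|z0] := eqVneq z 0; first by rewrite !invr0 md0 invr0.
have mz : md z != 0 by rewrite md_eq0.
by apply: (mulfI mz); rewrite -mdM !divff// md1.
Qed.
Lemma mdDr z w : md z - md w <= md (z + w).
Proof. by rewrite lerBlDr -(mdN w); apply: le_trans (mdD _ _); rewrite addrK. Qed.
Lemma mdB z w : md z - md w <= md (z - w).
Proof. by rewrite -(mdN w); exact: mdDr. Qed.
Lemma mdB_le z w : md (z - w) <= md z + md w.
Proof. by rewrite -(mdN w); exact: mdD. Qed.
Lemma md_mkC0 (a : R) : md (mkC a 0) = `|a|.
Proof. by rewrite mdE !reimE expr0n /= addr0 sqrtr_sqr. Qed.
Lemma md_mk0C (a : R) : md (mkC 0 a) = `|a|.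
Proof. by rewrite mdE !reimE expr0n /= add0r sqrtr_sqr. Qed.
Lemma re_le_md z : `|re z| <= md z.
Proof. by rewrite mdE -sqrtr_sqr ler_wsqrtr// lerDl sqr_ge0. Qed.
Lemma im_le_md z : `|im z| <= md z.
Proof. by rewrite mdE -sqrtr_sqr ler_wsqrtr// lerDr sqr_ge0. Qed.
Lemma md_le_reim z : md z <= `|re z| + `|im z|.
Proof.
rewrite -{1}(mkC_eta z).
have -> : mkC (re z) (im z) = mkC (re z) 0 + mkC 0 (im z) :> C.
  by apply: eqC; rewrite !reimE ?addr0 ?add0r.
by apply: le_trans (mdD _ _) _; rewrite md_mkC0 md_mk0C.
Qed.
Lemma md_triangle (a b c : C) : md (a - c) <= md (a - b) + md (b - c).
Proof. by apply: le_trans (mdD _ _); rewrite addrA subrK. Qed.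

(** Radii of balls in C are themselves elements of C, and a positive element of C has zero imaginary
    part. This lets neighbourhoods be described from here on by real radii and [modulus]. *)
Lemma ball_md (z w : C) (d : R) : ball z (mkC d 0) w <-> md (w - z) < d.
Proof.
rewrite -ball_normE /ball_ /= normCmd mdBC /mkC ltcE /= eqxx /=; split => //.
Qed.

Lemma nbhs_md (z0 : C) (P : set C) : nbhs z0 P <->
  exists2 d : R, 0 < d & forall z, md (z - z0) < d -> P z.
Proof.
split.
  move=> /nbhs_ballP[e /= e0 eP].
  have ee : e = mkC (re e) 0.
    by apply: eqC => //=; move: e0; rewrite ltcE => /andP[/eqP].
  exists (re e); first by move: e0; rewrite ltcE => /andP[].
  by move=> z zd; apply: eP; rewrite ee; apply/ball_md.
move=> [d d0 dP]; apply/nbhs_ballP; exists (mkC d 0) => /=.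
  by rewrite ltcE /= eqxx.
by move=> z /ball_md; exact: dP.
Qed.

Lemma dnbhs_md (z0 : C) (P : set C) : nbhs z0^' P <->
  exists2 d : R, 0 < d & forall z, z != z0 -> md (z - z0) < d -> P z.
Proof.
rewrite /dnbhs /within /=; split.
  by move/nbhs_md => [d d0 dP]; exists d => // z zz0 zd; exact: dP.
by move=> [d d0 dP]; apply/nbhs_md; exists d => // z zd zz0; exact: dP.
Qed.

Lemma open_md (D : set C) : open D <->
  forall z, D z -> exists2 d : R, 0 < d & forall w, md (w - z) < d -> D w.
Proof.
rewrite openE; split => h z Dz; first by apply/nbhs_md; exact: h.
by rewrite /interior; apply/nbhs_md; exact: h.
Qed.

Definition contat (f : C -> C) (z : C) := forall e : R, 0 < e ->
  exists2 d : R, 0 < d & forall w, md (w - z) < d -> md (f w - f z) < e.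

(** The derivative in Frechet form: without a quotient, the point [z] itself needs no exclusion. *)
Definition hasd (f : C -> C) (z l : C) := forall e : R, 0 < e ->
  exists2 d : R, 0 < d & forall w, md (w - z) < d ->
    md (f w - f z - l * (w - z)) <= e * md (w - z).

Lemma contatE f z : contat f z <-> {for z, continuous f}.
Proof.
rewrite /continuous_at; split.
  move=> cf; have := (@cvgrPdist_lt _ _ _ (nbhs z) _ f (f z)).2; apply => e e0.
  apply: (nbhs_md z _).2.
  have ee : e = mkC (re e) 0.
    by apply: eqC => //=; move: e0; rewrite ltcE => /andP[/eqP].
  have [|d d0 h] := cf (re e); first by move: e0; rewrite ltcE => /andP[].
  by exists d => // w /h wd; rewrite distrC normCmd ee /mkC ltcE /= eqxx.
have := (@cvgrPdist_lt _ _ _ (nbhs z) _ f (f z)).1 => /[apply] cf e e0.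
have /cf/nbhs_md[d d0 h] : 0 < mkC e 0 by rewrite ltcE /= eqxx.
by exists d => // w /h; rewrite distrC normCmd /mkC ltcE /= eqxx.
Qed.

Lemma hasdE f z l : hasd f z l <-> is_derive z 1 f l.
Proof.
pose q (h : C) := h^-1 *: ((f \o shift z) (h *: (1 : C)) - f z).
suff E : hasd f z l <-> q @ 0^' --> l.
  split.
    move=> /E h; split; first by apply/cvg_ex; exists l; exact: h.
    by apply/cvg_lim => //; exact: h.
  by case=> d dl; apply/E; rewrite -dl; exact: d.
split.
  move=> hf; have := (@cvgrPdist_le _ _ _ (0^') _ q l).2; apply => e e0.
  have ee : e = mkC (re e) 0.
    by apply: eqC => //=; move: e0; rewrite ltcE => /andP[/eqP].
  have [|d d0 H] := hf (re e); first by move: e0; rewrite ltcE => /andP[].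
  apply: (dnbhs_md 0 _).2; exists d => // h h0; rewrite subr0 => hd.
  rewrite /q /= distrC normCmd ee /mkC lecE /= eqxx /=.
  have := H (h + z); rewrite addrK => /(_ hd) h1.
  rewrite -(ler_pM2r (x := md h)) ?md_gt0// -mdM mulrBl /=.
  suff -> : h^-1 *: (f (h *: (1 : C) + z) - f z) * h = f (h + z) - f z by [].
  by rewrite /GRing.scale /= mulr1 mulrAC mulVf// mul1r.
have := (@cvgrPdist_le _ _ _ (0^') _ q l).1 => /[apply] H e e0.
have /H/dnbhs_md[d d0 {}H] : 0 < mkC e 0 by rewrite ltcE /= eqxx.
exists d => // w wd.
have [->|wz] := eqVneq w z; first by rewrite !subrr mulr0 subr0 md0 mulr0.
have wz0 : w - z != 0 by rewrite subr_eq0.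
have := H (w - z); rewrite subr0 => /(_ wz0 wd).
rewrite /q /= distrC normCmd /mkC lecE /= eqxx /=.
rewrite -(ler_pM2r (x := md (w - z))) ?md_gt0// -mdM mulrBl /=.
suff -> : (w - z)^-1 *: (f ((w - z) *: (1 : C) + z) - f z) * (w - z) = f w - f z by [].
by rewrite /GRing.scale /= mulr1 mulrAC mulVf// mul1r subrK.
Qed.

Lemma derivable_hasd (f : C -> C) (z : C) : derivable f z 1 -> exists l, hasd f z l.
Proof. by move=> df; exists ('D_1 f z); apply/hasdE; exact: derivableP. Qed.

Lemma hasd_derivable f z l : hasd f z l -> derivable f z 1.
Proof. by move/hasdE => -[]. Qed.

Lemma hasd_uniq f z l l' : hasd f z l -> hasd f z l' -> l = l'.
Proof. by move=> /hasdE[_ <-] /hasdE[_ <-]. Qed.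

Lemma hasd_cont f z l : hasd f z l -> contat f z.
Proof.
move=> /hasd_derivable/derivable1_diffP/differentiable_continuous ?.
exact/contatE.
Qed.

Lemma hasd_near f g z l : (\forall w \near z, f w = g w) -> hasd f z l -> hasd g z l.
Proof.
move=> /nbhs_md[d d0 H] hf e e0; have [d' d'0 H'] := hf e e0.
exists (Num.min d d'); first by rewrite lt_min d0.
move=> w; rewrite lt_min => /andP[/H <- /H'].
by rewrite -(H z)// subrr md0.
Qed.

Lemma hasd_cst c z : hasd (fun=> c) z 0.
Proof. by apply/hasdE; exact: is_derive_cst. Qed.
Lemma hasd_id z : hasd (fun w => w) z 1.
Proof. by apply/hasdE; exact: is_derive_id. Qed.
Lemma hasdD f g z l m : hasd f z l -> hasd g z m -> hasd (fun w => f w + g w) z (l + m).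
Proof. by move=> /hasdE ? /hasdE ?; apply/hasdE; exact: is_deriveD. Qed.
Lemma hasdB f g z l m : hasd f z l -> hasd g z m -> hasd (fun w => f w - g w) z (l - m).
Proof. by move=> /hasdE ? /hasdE ?; apply/hasdE; exact: is_deriveB. Qed.
Lemma hasdM f g z l m : hasd f z l -> hasd g z m ->
  hasd (fun w => f w * g w) z (f z * m + g z * l).
Proof. by move=> /hasdE ? /hasdE ?; apply/hasdE; exact: is_deriveM. Qed.
Lemma hasdV f z l : f z != 0 -> hasd f z l ->
  hasd (fun w => (f w)^-1) z (- (f z)^-2 * l).
Proof.
move=> fz /hasdE[df <-]; apply/hasdE; split; first exact: derivableV.
by rewrite deriveV.
Qed.
(** The remainder is that of [g] at [f z] plus [m] times that of [f]; each receives half of [e], and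
    [K] is a Lipschitz constant of [f] at [z]. *)
Lemma hasd_comp f g z l m : hasd f z l -> hasd g (f z) m ->
  hasd (fun w => g (f w)) z (m * l).
Proof.
move=> hf hg e e0.
pose K := md l + 1.
have K0 : 0 < K by rewrite ltr_pwDr// md_ge0.
have M0 : 0 < md m + 1 by rewrite ltr_pwDr// md_ge0.
have [|d1 d10 H1] := hg (e / (2 * K)); first by rewrite divr_gt0// mulr_gt0.
have [|d2 d20 H2] := hf (Num.min 1 (e / (2 * (md m + 1)))).
  by rewrite lt_min ltr01 divr_gt0// mulr_gt0.
exists (Num.min d2 (d1 / K)); first by rewrite lt_min d20 divr_gt0.
move=> w; rewrite lt_min => /andP[/H2 h2 wd].
have h2a : md (f w - f z) <= K * md (w - z).
  have -> : f w - f z = (f w - f z - l * (w - z)) + l * (w - z) by rewrite subrK.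
  apply: le_trans (mdD _ _) _; rewrite mdM /K mulrDl mul1r addrC lerD2l.
  apply: le_trans h2 _; rewrite -[leRHS]mul1r ler_wpM2r ?md_ge0//.
  by rewrite ge_min lexx.
have h1 : md (g (f w) - g (f z) - m * (f w - f z)) <= e / 2 * md (w - z).
  apply: le_trans (H1 _ _) _.
    by apply: le_lt_trans h2a _; rewrite mulrC -ltr_pdivlMr.
  apply: le_trans (ler_wpM2l _ h2a) _; first by rewrite divr_ge0// ?mulr_ge0// ltW.
  rewrite mulrA ler_wpM2r ?md_ge0//.
  by have -> : e / (2 * K) * K = e / 2 by field; rewrite gt_eqF.
have h3 : md (m * (f w - f z - l * (w - z))) <= e / 2 * md (w - z).
  rewrite mdM; apply: le_trans (ler_wpM2l (md_ge0 _) h2) _.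
  rewrite mulrA ler_wpM2r ?md_ge0//.
  apply: (@le_trans _ _ ((md m + 1) * (e / (2 * (md m + 1))))).
    apply: ler_pM; rewrite ?md_ge0 ?lerDl// ?ge_min ?lexx ?orbT//.
    by rewrite le_min ler01 divr_ge0// ?mulr_ge0// ltW.
  by have -> : (md m + 1) * (e / (2 * (md m + 1))) = e / 2 by field; rewrite gt_eqF.
have -> : g (f w) - g (f z) - m * l * (w - z) =
  (g (f w) - g (f z) - m * (f w - f z)) + m * (f w - f z - l * (w - z)) by ring.
apply: le_trans (mdD _ _) _.
by rewrite [e in leRHS]splitr mulrDl lerD.
Qed.
Lemma hasdX f z l n : hasd f z l ->
  hasd (fun w => f w ^+ n) z (n%:R * f z ^+ n.-1 * l).
Proof.
move=> hf; elim: n => [|n ih].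
  by rewrite !mul0r; exact: hasd_cst.
have := hasdM hf ih; congr hasd.
  by apply/funext => w /=; rewrite exprS.
case: n {ih} => [|n] /=; rewrite ?expr0; first by ring.
by rewrite -[n.+2]addn1 natrD exprS; ring.
Qed.

End ComplexPlane.

#[local] Hint Extern 0 (is_true (_ <= modulus _)) => exact: md_ge0 : core.

(** * Integrals of continuous real functions over segments *)

Section RealIntegral.
Variable R : realType.
Notation mu := (@lebesgue_measure R).

Definition rint (u : R -> R) (a b : R) : R := \int[mu]_(x in `[a, b]) u x.

Lemma rint_integrable (u : R -> R) a b : continuous u ->
  mu.-integrable `[a, b] (EFin \o u).
Proof.
move=> cu; apply: continuous_compact_integrable; first exact: segment_compact.
exact: continuous_subspaceT.
Qed.

Lemma rint_split (u : R -> R) (a b c : R) : continuous u -> a <= c -> c <= b ->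
  rint u a b = rint u a c + rint u c b.
Proof.
move=> cu ac cb; apply/eqP; rewrite addrC -subr_eq; apply/eqP.
rewrite /rint Rintegral_itvB ?bnd_simp//; last exact: rint_integrable.
rewrite Rintegral_itv_obnd_cbnd//.
apply: integrableS (rint_integrable c b cu) => //.
exact: subset_itv_oc_cc.
Qed.

Lemma rintB (u v : R -> R) (a b : R) : continuous u -> continuous v ->
  rint (fun x => u x - v x) a b = rint u a b - rint v a b.
Proof. by move=> cu cv; rewrite /rint RintegralB//; exact: rint_integrable. Qed.

Lemma rint_cst c a b : a <= b -> rint (fun=> c) a b = c * (b - a).
Proof.
move=> ab; rewrite /rint Rintegral_cst//.
have /= -> := lebesgue_measure_itv `[a, b]%R.
rewrite lte_fin; case: ltP => // ba; congr *%R.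
by have -> : a = b by [apply/le_anti; rewrite ab ba]; rewrite subrr.
Qed.

Lemma le_rint (u v : R -> R) (a b : R) : continuous u -> continuous v ->
  (forall x, a <= x -> x <= b -> u x <= v x) -> rint u a b <= rint v a b.
Proof.
move=> cu cv uv; apply: le_Rintegral => //; try exact: rint_integrable.
by move=> x; rewrite /= in_itv /= => /andP[]; exact: uv.
Qed.

Lemma rint_near_cst (u : R -> R) (a b c e : R) : continuous u -> a <= b ->
  (forall x, a <= x -> x <= b -> `|u x - c| <= e) ->
  `|rint u a b - c * (b - a)| <= e * (b - a).
Proof.
move=> cu ab uc; rewrite ler_norml lerBlDr -mulrDl lerBrDr -mulNr -mulrDl -!rint_cst//.
apply/andP; split; apply: le_rint => //; try (by move=> x; exact: cvg_cst);
  by move=> x ax xb; have := uc x ax xb; rewrite ler_norml; lra.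
Qed.

Lemma continuous_realP (u : R -> R) : (forall x e, 0 < e ->
  exists2 d, 0 < d & forall y, `|y - x| < d -> `|u y - u x| < e) -> continuous u.
Proof.
move=> H x; apply/cvgrPdist_lt => e /(H x)[d d0 dP].
apply/nbhs_ballP; exists d => //= y; rewrite /ball /= distrC => /dP.
by rewrite distrC.
Qed.
End RealIntegral.

(** * Goursat's lemma on rectangles *)

Section Goursat.
Variable R : realType.
Local Notation C := (Cplane R).
Local Notation md := (@modulus R).
Implicit Types (f g : C -> C).

Definition cint (u : R -> C) a b : C :=
  mkC (rint (fun x => re (u x)) a b) (rint (fun x => im (u x)) a b).

Definition ccont (u : R -> C) :=
  continuous (fun x => re (u x)) /\ continuous (fun x => im (u x)).

Lemma ccontB u v : ccont u -> ccont v -> ccont (fun x => u x - v x).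
Proof.
move=> [u1 u2] [v1 v2]; split => x.
  have -> : (fun y => re (u y - v y)) = (fun y => re (u y) - re (v y)).
    by apply/funext => y; rewrite !reimE.
  by apply: cvgB; [exact: u1|exact: v1].
have -> : (fun y => im (u y - v y)) = (fun y => im (u y) - im (v y)).
  by apply/funext => y; rewrite !reimE.
by apply: cvgB; [exact: u2|exact: v2].
Qed.

Lemma cint_split u a b c : ccont u -> a <= c -> c <= b ->
  cint u a b = cint u a c + cint u c b.
Proof.
by move=> [u1 u2] ac cb; apply: eqC; rewrite !reimE; apply: rint_split.
Qed.

Lemma cintB u v a b : ccont u -> ccont v ->
  cint (fun x => u x - v x) a b = cint u a b - cint v a b.
Proof.
move=> [u1 u2] [v1 v2]; apply: eqC; rewrite !reimE -rintB//.
  by congr rint; apply/funext => x; rewrite !reimE.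
by congr rint; apply/funext => x; rewrite !reimE.
Qed.

(** The factor 2 is the price of estimating real and imaginary parts separately. *)
Lemma cint_near_cst u a b c e : ccont u -> a <= b ->
  (forall x, a <= x -> x <= b -> md (u x - c) <= e) ->
  md (cint u a b - c * mkC (b - a) 0) <= 2 * e * (b - a).
Proof.
move=> [u1 u2] ab H; apply: le_trans (md_le_reim _) _.
rewrite !reimE !(mulr0, subr0, add0r, addr0).
have -> : 2 * e * (b - a) = e * (b - a) + e * (b - a) by ring.
apply: lerD; apply: rint_near_cst => // x ax xb; apply: le_trans (H x ax xb);
  have := re_le_md (u x - c); have := im_le_md (u x - c); by rewrite !reimE.
Qed.

Definition hline f y (x : R) : C := f (mkC x y).
Definition vline f x (y : R) : C := f (mkC x y).

(** Continuity on the whole plane, so that every segment integral exists without side conditions; a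
    function given on a rectangle is first composed with the retraction [clampC]. *)
Definition ccts f := forall z, contat f z.

Lemma hline_cont f y : ccts f -> ccont (hline f y).
Proof.
move=> cf; split; apply: continuous_realP => x e /(cf (mkC x y))[d d0 H];
  exists d => // x' xd; have := H (mkC x' y);
  have -> : mkC x' y - mkC x y = mkC (x' - x) 0 by [apply: eqC; rewrite !reimE ?subrr];
  rewrite md_mkC0 => /(_ xd) h; apply: le_lt_trans h; rewrite -?reN -?reD -?imN -?imD.
  exact: re_le_md.
exact: im_le_md.
Qed.

Lemma vline_cont f y : ccts f -> ccont (vline f y).
Proof.
move=> cf; split; apply: continuous_realP => x e /(cf (mkC y x))[d d0 H];
  exists d => // x' xd; have := H (mkC y x');
  have -> : mkC y x' - mkC y x = mkC 0 (x' - x) by [apply: eqC; rewrite !reimE ?subrr];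
  rewrite md_mk0C => /(_ xd) h; apply: le_lt_trans h; rewrite -?reN -?reD -?imN -?imD.
  exact: re_le_md.
exact: im_le_md.
Qed.

(* The integral of f along the boundary of a rectangle, opposite sides being
   grouped so that affine integrands become constants. *)
Definition rect_int f x0 x1 y0 y1 : C :=
  cint (fun x => hline f y0 x - hline f y1 x) x0 x1 +
  mkC 0 1 * cint (fun y => vline f x1 y - vline f x0 y) y0 y1.

Lemma rect_int_splitx f x0 x x1 y0 y1 : ccts f -> x0 <= x -> x <= x1 ->
  rect_int f x0 x1 y0 y1 = rect_int f x0 x y0 y1 + rect_int f x x1 y0 y1.
Proof.
move=> cf xx0 xx1; rewrite /rect_int (@cint_split _ x0 x1 x)//; last first.
  by apply: ccontB; exact: hline_cont.
rewrite !(@cintB (vline f _))//; try exact: vline_cont.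
by ring.
Qed.

Lemma rect_int_splity f x0 x1 y0 y y1 : ccts f -> y0 <= y -> y <= y1 ->
  rect_int f x0 x1 y0 y1 = rect_int f x0 x1 y0 y + rect_int f x0 x1 y y1.
Proof.
move=> cf xx0 xx1; rewrite /rect_int (@cint_split _ y0 y1 y)//; last first.
  by apply: ccontB; exact: vline_cont.
rewrite !(@cintB (hline f _))//; try exact: hline_cont.
by ring.
Qed.

Definition inrect (x0 x1 y0 y1 : R) (z : C) :=
  [/\ x0 <= re z, re z <= x1, y0 <= im z & im z <= y1].

Lemma rect_int_bound f x0 x1 y0 y1 c l z e : ccts f -> x0 <= x1 -> y0 <= y1 ->
  (forall w, inrect x0 x1 y0 y1 w -> md (f w - c - l * (w - z)) <= e) ->
  md (rect_int f x0 x1 y0 y1) <= 4 * e * ((x1 - x0) + (y1 - y0)).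
Proof.
move=> cf x01 y01 H.
pose c1 := l * mkC 0 (y0 - y1).
pose c2 := l * mkC (x1 - x0) 0.
have h1 : md (cint (fun x => hline f y0 x - hline f y1 x) x0 x1
    - c1 * mkC (x1 - x0) 0) <= 2 * (2 * e) * (x1 - x0).
  apply: cint_near_cst => //; first by apply: ccontB; exact: hline_cont.
  move=> x xx0 xx1; rewrite /hline.
  have -> : f (mkC x y0) - f (mkC x y1) - c1 =
    (f (mkC x y0) - c - l * (mkC x y0 - z)) - (f (mkC x y1) - c - l * (mkC x y1 - z)).
    have -> : c1 = l * (mkC x y0 - mkC x y1).
      by congr (_ * _); apply: eqC; rewrite !reimE ?subrr.
    by ring.
  apply: le_trans (mdB_le _ _) _; rewrite mulr_natl mulr2n.
  by apply: lerD; apply: H; split => //=.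
have h2 : md (cint (fun y => vline f x1 y - vline f x0 y) y0 y1
    - c2 * mkC (y1 - y0) 0) <= 2 * (2 * e) * (y1 - y0).
  apply: cint_near_cst => //; first by apply: ccontB; exact: vline_cont.
  move=> y yy0 yy1; rewrite /vline.
  have -> : f (mkC x1 y) - f (mkC x0 y) - c2 =
    (f (mkC x1 y) - c - l * (mkC x1 y - z)) - (f (mkC x0 y) - c - l * (mkC x0 y - z)).
    have -> : c2 = l * (mkC x1 y - mkC x0 y).
      by congr (_ * _); apply: eqC; rewrite !reimE ?subrr.
    by ring.
  apply: le_trans (mdB_le _ _) _; rewrite mulr_natl mulr2n.
  by apply: lerD; apply: H; split => //=.
rewrite /rect_int.
set A := cint _ _ _ in h1 *; set B := cint _ _ _ in h2 *.
have -> : A + mkC 0 1 * B = (A - c1 * mkC (x1 - x0) 0) +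
    mkC 0 1 * (B - c2 * mkC (y1 - y0) 0).
  have -> : c1 * mkC (x1 - x0) 0 = - (mkC 0 1 * (c2 * mkC (y1 - y0) 0)).
    by apply: eqC; rewrite /c1 /c2 !reimE; ring.
  by ring.
apply: le_trans (mdD _ _) _; rewrite mdM md_mk0C normr1 mul1r.
by apply: le_trans (lerD h1 h2) _; rewrite le_eqVlt; apply/orP; left; apply/eqP; ring.
Qed.

(** The left ends never decrease and the right ends [X n + w / 2 ^+ n] never increase, so the
    supremum of the left ends lies in all the intervals. *)
Lemma bisect_limit (X : nat -> R) (w : R) : 0 <= w ->
  (forall n, X n <= X n.+1 /\ X n.+1 <= X n + w / 2 ^+ n.+1) ->
  exists x, forall n, X n <= x <= X n + w / 2 ^+ n.
Proof.
move=> w0 H.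
have H1 n k : X n <= X (n + k)%N.
  elim: k => [|k ih]; first by rewrite addn0.
  by rewrite addnS (le_trans ih)//; have [] := H (n + k)%N.
have H2 n k : X (n + k)%N + w / 2 ^+ (n + k) <= X n + w / 2 ^+ n.
  elim: k => [|k ih]; first by rewrite addn0.
  apply: le_trans ih; rewrite addnS; have [_] := H (n + k)%N.
  have -> : w / 2 ^+ (n + k) = w / 2 ^+ (n + k).+1 + w / 2 ^+ (n + k).+1.
    by rewrite exprS invfM; field; rewrite expf_neq0.
  by lra.
have Wp n : 0 <= w / 2 ^+ n by rewrite divr_ge0// exprn_ge0.
have H3 n m : X m <= X n + w / 2 ^+ n.
  have [nm|mn] := leqP n m.
    have := H2 n (m - n)%N; rewrite subnKC// => h; have := Wp m; lra.
  by have := H1 m (n - m)%N; rewrite subnKC ?(ltnW mn)// => h; have := Wp n; lra.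
have hs : has_sup (range X).
  split; first by exists (X 0%N); exists 0%N.
  by exists (X 0%N + w / 2 ^+ 0) => _ [m _ <-]; exact: H3.
exists (sup (range X)) => n; apply/andP; split.
  by apply: sup_upper_bound => //; exists n.
by apply: ge_sup; [exact: hs.1|move=> _ [m _ <-]; exact: H3].
Qed.

Lemma quarter_pigeonhole (c a b a' b' p : R) : c <= (a + b + (a' + b')) * p ->
  [\/ c <= a * (4 * p), c <= b * (4 * p), c <= a' * (4 * p) | c <= b' * (4 * p)].
Proof.
move=> H; have [|h1] := leP c (a * (4 * p)); first by constructor 1.
have [|h2] := leP c (b * (4 * p)); first by constructor 2.
have [|h3] := leP c (a' * (4 * p)); first by constructor 3.
by constructor 4; lra.
Qed.

(** Differentiability relative to the rectangle: a function extended by clamping is in general not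
    complex differentiable across the boundary, yet the bisection may converge to a boundary
    point. *)
Definition cdiff_in f x0 x1 y0 y1 z := exists l : C, forall e, 0 < e ->
  exists2 d : R, 0 < d & forall w, inrect x0 x1 y0 y1 w -> md (w - z) < d ->
    md (f w - f z - l * (w - z)) <= e * md (w - z).

Lemma goursat f x0 x1 y0 y1 : ccts f -> x0 <= x1 -> y0 <= y1 ->
  (forall z, inrect x0 x1 y0 y1 z -> cdiff_in f x0 x1 y0 y1 z) ->
  rect_int f x0 x1 y0 y1 = 0.
Proof.
move=> cf x01 y01 df; apply/eqP; rewrite -md_eq0; apply/negP => /negP N0.
set c := md _ in N0; have c0 : 0 < c by rewrite lt_def N0 md_ge0.
pose w := x1 - x0; pose h := y1 - y0.
have w0 : 0 <= w by rewrite subr_ge0.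
have h0 : 0 <= h by rewrite subr_ge0.
(* [p] is the lower left corner of a rectangle of generation [n] whose integral retains at least the
   share [4 ^- n] of [c]. *)
pose bad n (p : R * R) := [/\ x0 <= p.1, p.1 + w / 2 ^+ n <= x1, y0 <= p.2,
  p.2 + h / 2 ^+ n <= y1 &
  c <= md (rect_int f p.1 (p.1 + w / 2 ^+ n) p.2 (p.2 + h / 2 ^+ n)) * 4 ^+ n].
pose rel n (p q : R * R) := [/\ p.1 <= q.1, q.1 <= p.1 + w / 2 ^+ n.+1,
   p.2 <= q.2 & q.2 <= p.2 + h / 2 ^+ n.+1].
have halve (t : R) n : t / 2 ^+ n = t / 2 ^+ n.+1 + t / 2 ^+ n.+1.
  by rewrite exprS invfM; field; rewrite expf_neq0.
have step (np : nat * (R * R)) : exists q, bad np.1 np.2 ->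
    rel np.1 np.2 q /\ bad np.1.+1 q.
  case: np => n [x y] /=.
  have [[a1 a2 a3 a4 a5]|nb] := pselect (bad n (x, y)); last by exists (x, y).
  move: a1 a2 a3 a4 a5; rewrite /= !(halve _ n); set wn := w / _; set hn := h / _.
  have wn0 : 0 <= wn by rewrite divr_ge0// exprn_ge0.
  have hn0 : 0 <= hn by rewrite divr_ge0// exprn_ge0.
  move=> a1 a2 a3 a4.
  rewrite (@rect_int_splitx f x (x + wn))//; try lra.
  rewrite (@rect_int_splity f x (x + wn) y (y + hn) (y + (hn + hn)))//; try lra.
  rewrite (@rect_int_splity f (x + wn) (x + (wn + wn)) y (y + hn) (y + (hn + hn)))//; try lra.
  set A := rect_int _ _ _ _ _; set B := rect_int _ _ _ _ _.
  set A' := rect_int _ _ _ _ _; set B' := rect_int _ _ _ _ _ => Hc.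
  have E4 : exists q : R * R, [/\ (q.1 = x \/ q.1 = x + wn), (q.2 = y \/ q.2 = y + hn) &
     c <= md (rect_int f q.1 (q.1 + wn) q.2 (q.2 + hn)) * 4 ^+ n.+1].
    have : c <= (md A + md B + (md A' + md B')) * 4 ^+ n.
      apply: le_trans Hc _; rewrite ler_wpM2r ?exprn_ge0//.
      by apply: le_trans (mdD _ _) _; apply: lerD; exact: mdD.
    rewrite exprS => /quarter_pigeonhole[] H; [exists (x, y)|exists (x, y + hn)|
      exists (x + wn, y)|exists (x + wn, y + hn)]; split; rewrite /= -?addrA;
      by [left|right|].
  case: E4 => -[q1 q2] /= [b1 b2 b3]; exists (q1, q2) => _; rewrite /rel /bad /= -/wn -/hn.
  clear - a1 a2 a3 a4 wn0 hn0 b1 b2 b3.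
  by case: b1 => ?; case: b2 => ?; subst q1 q2; split; split => //; clear b3; lra.
have [F HF] := choice step.
pose s := fix s n := if n is k.+1 then F (k, s k) else (x0, y0).
have sbad n : bad n (s n).
  elim: n => [|n ih]; last by have [] := HF (n, s n) ih.
  rewrite /bad /= !expr0 !divr1 mulr1 /w /h !lexx.
  by split; rewrite ?(addrC _ (_ - _)) ?subrK.
have srel n : rel n (s n) (s n.+1) by have [] := HF (n, s n) (sbad n).
have [|x Hx] := @bisect_limit (fun n => (s n).1) w w0.
  by move=> n; have [] := srel n.
have [|y Hy] := @bisect_limit (fun n => (s n).2) h h0.
  by move=> n; have [] := srel n.
pose z := mkC x y.
have zin : inrect x0 x1 y0 y1 z.
  have /andP[hx1 hx2] := Hx 0%N; have /andP[hy1 hy2] := Hy 0%N.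
  move: hx1 hx2 hy1 hy2; rewrite /= expr0 !divr1 /w /h => *; split => /=; lra.
have [l Hl] := df z zin.
(* Chosen so that [4 * e * (w + h) ^+ 2 < c]; the added 1 covers a rectangle reduced to a point. *)
pose e := c / (8 * (w + h + 1) ^+ 2).
have wh1 : 0 < w + h + 1 by lra.
have e0 : 0 < e by rewrite divr_gt0// mulr_gt0// exprn_gt0.
have [d d0 Hd] := Hl e e0.
have [n Hn] : exists n, (w + h) / 2 ^+ n < d.
  have : (1 / 2 : R) ^+ n @[n --> \oo] --> 0.
    by apply: cvg_expr; rewrite ger0_norm; lra.
  move=> /cvgrPdist_lt/(_ (d / (w + h + 1))) [|n _ /(_ n (leqnn _))].
    by rewrite divr_gt0.
  rewrite sub0r normrN ger0_norm ?exprn_ge0// => hn; exists n.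
  have := hn; rewrite ltr_pdivlMr// expr_div_n expr1n.
  apply: le_lt_trans; rewrite mulrAC mul1r ler_pM2r ?invr_gt0 ?exprn_gt0//.
  by rewrite lerDl.
have [b1 b2 b3 b4 b5] := sbad n.
set wn := w / 2 ^+ n in b2 b5; set hn := h / 2 ^+ n in b4 b5.
have wn0 : 0 <= wn by rewrite divr_ge0// exprn_ge0.
have hn0 : 0 <= hn by rewrite divr_ge0// exprn_ge0.
have whn : wn + hn < d by rewrite -mulrDl.
have : md (rect_int f (s n).1 ((s n).1 + wn) (s n).2 ((s n).2 + hn)) <=
    4 * (e * (wn + hn)) * (((s n).1 + wn - (s n).1) + ((s n).2 + hn - (s n).2)).
  apply: (@rect_int_bound _ _ _ _ _ (f z) l z) => //; rewrite ?lerDl//.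
  move=> v [v1 v2 v3 v4].
  have vz : md (v - z) <= wn + hn.
    apply: le_trans (md_le_reim _) _; rewrite !reimE.
    have /andP[] := Hx n; have /andP[] := Hy n; rewrite -/wn -/hn => y2 y3 x2 x3.
    clear - y3 y2 x3 x2 v1 v2 v3 v4.
    by apply: lerD; rewrite ler_norml; apply/andP; split; lra.
  apply: le_trans (Hd v _ _) _; last by rewrite ler_pM2l.
    by clear - v1 v2 v3 v4 b1 b2 b3 b4; split; lra.
  exact: le_lt_trans whn.
have -> : (s n).1 + wn - (s n).1 + ((s n).2 + hn - (s n).2) = wn + hn by ring.
have -> : 4 * (e * (wn + hn)) * (wn + hn) = 4 * e * (w + h) ^+ 2 / 4 ^+ n.
  have -> : (4 : R) ^+ n = 2 ^+ n * 2 ^+ n by rewrite -exprMn; congr (_ ^+ _); ring.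
  by rewrite /wn /hn; field; rewrite expf_neq0.
move: b5; rewrite -ler_pdivrMr ?exprn_gt0// => b5 b6.
have := le_trans b5 b6; rewrite ler_pM2r ?invr_gt0 ?exprn_gt0//.
apply/negP; rewrite -ltNge /e.
have -> : 4 * (c / (8 * (w + h + 1) ^+ 2)) * (w + h) ^+ 2 =
   c * ((w + h) ^+ 2 / (2 * (w + h + 1) ^+ 2)).
  by field; rewrite gt_eqF.
rewrite gtr_pMr// ltr_pdivrMr ?mulr_gt0 ?exprn_gt0// mul1r.
by nra.
Qed.

End Goursat.

(** * Maximum principle, Taylor bounds, limits and local factorisation of holomorphic functions *)

Section MaximumPrinciple.
Variable R : realType.
Local Notation C := (Cplane R).
Local Notation md := (@modulus R).
Implicit Types (f g : C -> C).

(** Closed squares replace discs, because the integral theorem at hand concerns rectangles. *)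
Definition sq (c : C) (r : R) (z : C) := `|re (z - c)| <= r /\ `|im (z - c)| <= r.

Definition sqb c r z := sq c r z /\ (`|re (z - c)| = r \/ `|im (z - c)| = r).

Lemma sqb_sq c r z : sqb c r z -> sq c r z. Proof. by case. Qed.

Lemma sq_center c r : 0 <= r -> sq c r c.
Proof. by move=> r0; split; rewrite subrr ?re0 ?im0 normr0. Qed.

Lemma sq_le c r r' z : r <= r' -> sq c r z -> sq c r' z.
Proof. by move=> rr [a b]; split; apply: le_trans rr. Qed.

Lemma sq_md c r z : md (z - c) <= r -> sq c r z.
Proof. by move=> h; split; apply: le_trans h; [exact: re_le_md|exact: im_le_md]. Qed.

Lemma md_sq_le c r z : sq c r z -> md (z - c) <= 2 * r.
Proof.
by move=> [a b]; apply: le_trans (md_le_reim _) _; rewrite mulr_natl mulr2n lerD.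
Qed.

Lemma sqb_md c r z : sqb c r z -> r <= md (z - c).
Proof. by case=> _ [<-|<-]; [exact: re_le_md|exact: im_le_md]. Qed.

Lemma sq_trans a b r s z : sq a r b -> sq b s z -> sq a (r + s) z.
Proof.
move=> [h1 h2] [h3 h4]; have -> : z = (z - b) + b by rewrite subrK.
rewrite /sq -addrA; split.
  by rewrite reD [leRHS]addrC (le_trans (ler_normD _ _))// lerD.
by rewrite imD [leRHS]addrC (le_trans (ler_normD _ _))// lerD.
Qed.

Lemma sqb_far a b r s z : sq a s b -> sqb a r z -> r - s <= md (z - b).
Proof.
move=> [h1 h2] [_ [] hz].
  have -> : z - b = (z - a) - (b - a) by ring.
  apply: le_trans (re_le_md _); rewrite reD reN.
  by apply: le_trans (lerB_dist _ _); rewrite hz lerB.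
have -> : z - b = (z - a) - (b - a) by ring.
apply: le_trans (im_le_md _); rewrite imD imN.
by apply: le_trans (lerB_dist _ _); rewrite hz lerB.
Qed.

Lemma sq_rect c r z : sq c r z <->
  inrect (re c - r) (re c + r) (im c - r) (im c + r) z.
Proof.
rewrite /sq /inrect !reimE !ler_norml; split.
  by move=> [/andP[a b] /andP[d e]]; split; lra.
by move=> [a b d e]; split; apply/andP; split; lra.
Qed.

Definition clamp (a b x : R) := Num.max a (Num.min b x).

Lemma clamp_in a b x : a <= b -> a <= clamp a b x <= b.
Proof.
by move=> ab; rewrite /clamp le_max lexx /= ge_max ab ge_min lexx.
Qed.
Lemma clamp_id a b x : a <= x -> x <= b -> clamp a b x = x.
Proof. by move=> ax xb; rewrite /clamp min_r// max_r. Qed.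
Lemma clamp_lip a b x y : a <= b -> `|clamp a b x - clamp a b y| <= `|x - y|.
Proof.
move=> ab; rewrite /clamp /Num.max /Num.min.
have := ler_norm (x - y); have := ler_norm (y - x); rewrite (distrC y).
by case: (ltP b x) => h1; case: (ltP b y) => h2; case: ltP => h3; case: ltP => h4;
  rewrite ler_norml => k1 k2; apply/andP; split; lra.
Qed.

(** A 1-Lipschitz retraction of the plane onto the rectangle: composition with it extends a function
    continuously and leaves its boundary integral unchanged. *)
Definition clampC x0 x1 y0 y1 (z : C) : C :=
  mkC (clamp x0 x1 (re z)) (clamp y0 y1 (im z)).

Lemma clampC_in x0 x1 y0 y1 z : x0 <= x1 -> y0 <= y1 ->
  inrect x0 x1 y0 y1 (clampC x0 x1 y0 y1 z).
Proof.
move=> h1 h2; have /andP[a b] := clamp_in (re z) h1.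
by have /andP[c d] := clamp_in (im z) h2; split.
Qed.

Lemma clampC_id x0 x1 y0 y1 z : inrect x0 x1 y0 y1 z -> clampC x0 x1 y0 y1 z = z.
Proof. by move=> [a b c d]; apply: eqC; rewrite /clampC !reimE clamp_id. Qed.

Lemma clampC_lip x0 x1 y0 y1 z w : x0 <= x1 -> y0 <= y1 ->
  md (clampC x0 x1 y0 y1 z - clampC x0 x1 y0 y1 w) <= md (z - w).
Proof.
move=> h1 h2; rewrite !mdE ler_wsqrtr// !reimE.
apply: lerD; rewrite -[leLHS]real_normK ?num_real// -[leRHS]real_normK ?num_real//;
  by rewrite ler_sqr ?nnegrE// clamp_lip.
Qed.

Lemma clampC_cts f x0 x1 y0 y1 : x0 <= x1 -> y0 <= y1 ->
  (forall z, inrect x0 x1 y0 y1 z -> contat f z) ->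
  ccts (f \o clampC x0 x1 y0 y1).
Proof.
move=> h1 h2 cf z e e0.
have [d d0 H] := cf _ (clampC_in z h1 h2) e e0.
by exists d => // w wz; apply: H; apply: le_lt_trans wz; exact: clampC_lip.
Qed.

(** Cut out a square of half-side [s] around [a]. The four rectangles around it contribute 0 by
    Goursat's lemma; on the square [f] is within 1 of [f a], so its integral is at most
    [16 * s <= e]. *)
Lemma rect_int_except f x0 x1 y0 y1 a : ccts f ->
  x0 < re a -> re a < x1 -> y0 < im a -> im a < y1 ->
  (forall z, inrect x0 x1 y0 y1 z -> z != a -> cdiff_in f x0 x1 y0 y1 z) ->
  rect_int f x0 x1 y0 y1 = 0.
Proof.
move=> cf ax0 ax1 ay0 ay1 df.
have sub u0 u1 v0 v1 : x0 <= u0 -> u0 <= u1 -> u1 <= x1 ->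
   y0 <= v0 -> v0 <= v1 -> v1 <= y1 -> ~ inrect u0 u1 v0 v1 a ->
   rect_int f u0 u1 v0 v1 = 0.
  move=> h1 h2 h3 h4 h5 h6 na; apply: goursat => // z zin.
  have z1 w : inrect u0 u1 v0 v1 w -> inrect x0 x1 y0 y1 w.
    by clear - h1 h2 h3 h4 h5 h6; move=> [k1 k2 k3 k4]; split; lra.
  have za : z != a by apply/eqP => e; apply: na; rewrite -e.
  have [l Hl] := df z (z1 _ zin) za; exists l => e /Hl[d d0 Hd].
  by exists d => // w /z1; exact: Hd.
apply/eqP; rewrite -md_eq0; apply/eqP/le_anti/andP; split; last exact: md_ge0.
apply/ler_addgt0Pr => e e0; rewrite add0r.
have [d d0 Hd] := cf a 1 ltr01.
pose s := Num.min (Num.min (e / 16) (d / 4))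
  (Num.min (Num.min (re a - x0) (x1 - re a)) (Num.min (im a - y0) (y1 - im a))).
have s0 : 0 < s by rewrite /s !lt_min !subr_gt0 ax0 ax1 ay0 ay1 !divr_gt0.
have : s <= s by [].
rewrite {2}/s !le_min => /andP[/andP[s1 s2] /andP[/andP[s3 s4] /andP[s5 s6]]].
clearbody s.
have S1 : rect_int f x0 (re a - s) y0 y1 = 0.
  by apply: sub; try (by case=> ? ? ? ?; lra); clear Hd; lra.
have S2 : rect_int f (re a + s) x1 y0 y1 = 0.
  by apply: sub; try (by case=> ? ? ? ?; lra); clear Hd; lra.
have S3 : rect_int f (re a - s) (re a + s) y0 (im a - s) = 0.
  by apply: sub; try (by case=> ? ? ? ?; lra); clear Hd; lra.
have S4 : rect_int f (re a - s) (re a + s) (im a + s) y1 = 0.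
  by apply: sub; try (by case=> ? ? ? ?; lra); clear Hd; lra.
clear sub df.
rewrite (@rect_int_splitx _ f x0 (re a - s) x1 y0 y1)//; try by clear Hd; lra.
rewrite S1 add0r.
rewrite (@rect_int_splitx _ f (re a - s) (re a + s) x1 y0 y1)//; try by clear Hd; lra.
rewrite S2 addr0.
rewrite (@rect_int_splity _ f _ (re a + s) y0 (im a - s) y1)//; try by clear Hd; lra.
rewrite S3 add0r.
rewrite (@rect_int_splity _ f _ (re a + s) (im a - s) (im a + s) y1)//; try by clear Hd; lra.
rewrite S4 addr0 {S1 S2 S3 S4}.
apply: le_trans (@rect_int_bound _ f _ _ _ _ (f a) 0 a 1 cf _ _ _) _; try by clear Hd; lra.
move=> w win; rewrite mul0r subr0; apply/ltW/Hd.
have /md_sq_le h : sq a s w by apply/sq_rect.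
by apply: le_lt_trans h _; clear - s2 s0 d0; lra.
Qed.

(** [re z^-1 = re z / md z ^+ 2] is at least [d / (8 * r ^+ 2)], and the perturbation [t / z] costs
    at most half of that. A sign along each side of a square thus replaces the value of the integral
    of 1/z. *)
Lemma re_kernel (r d : R) (t z : C) : 0 < d -> 0 < r -> md z ^+ 2 <= 8 * r ^+ 2 -> d <= re z ->
  md t <= d ^+ 2 / (16 * r ^+ 2) -> d / (16 * r ^+ 2) <= re ((1 - t) / z).
Proof.
move=> d0 r0 zr dz ht.
have z0 : 0 < md z by apply: lt_le_trans d0 (le_trans dz _); apply: le_trans (re_le_md _); exact: ler_norm.
have dm : d <= md z by apply: le_trans dz _; apply: le_trans (re_le_md _); exact: ler_norm.
have r2 : 0 < r ^+ 2 by rewrite exprn_gt0.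
have h1 : d / (8 * r ^+ 2) <= re z^-1.
  have -> : re z^-1 = re z / md z ^+ 2.
    by rewrite md_sq; case: (z).
  apply: ler_pM => //; first exact: ltW.
    by rewrite invr_ge0 mulr_ge0// ltW.
  by rewrite lef_pV2// posrE ?mulr_gt0// exprn_gt0.
have h2 : md (t / z) <= d / (16 * r ^+ 2).
  rewrite mdM mdV ler_pdivrMr//; apply: le_trans ht _.
  rewrite expr2 -mulrA mulrC [leRHS]mulrC mulrC; apply: ler_pM => //; try exact: ltW.
  by rewrite divr_ge0// ?mulr_ge0// ltW.
have h3 := le_trans (ler_norm _) (le_trans (re_le_md _) h2).
rewrite mulrBl mul1r reD reN.
have : d / (8 * r ^+ 2) = d / (16 * r ^+ 2) + d / (16 * r ^+ 2).
  by field; rewrite gt_eqF.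
by lra.
Qed.


Definition dif (f : C -> C) (z : C) := exists l, hasd f z l.

Lemma dif_contat f z : dif f z -> contat f z.
Proof. by case=> l; exact: hasd_cont. Qed.

Lemma dif_near f g z d : 0 < d -> (forall w, md (w - z) < d -> f w = g w) ->
  dif f z -> dif g z.
Proof. by move=> d0 H [l hl]; exists l; apply: hasd_near hl; apply/nbhs_md; exists d. Qed.

Lemma dif_eq f g z : f =1 g -> dif f z -> dif g z.
Proof. by move=> /funext ->. Qed.
Lemma difD f g z : dif f z -> dif g z -> dif (fun w => f w + g w) z.
Proof. by move=> [l hl] [m hm]; eexists; exact: hasdD hl hm. Qed.
Lemma difB f g z : dif f z -> dif g z -> dif (fun w => f w - g w) z.
Proof. by move=> [l hl] [m hm]; eexists; exact: hasdB hl hm. Qed.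
Lemma difM f g z : dif f z -> dif g z -> dif (fun w => f w * g w) z.
Proof. by move=> [l hl] [m hm]; eexists; exact: hasdM hl hm. Qed.
Lemma difV f z : f z != 0 -> dif f z -> dif (fun w => (f w)^-1) z.
Proof. by move=> fz [l hl]; eexists; exact: hasdV fz hl. Qed.
Lemma difX f z n : dif f z -> dif (fun w => f w ^+ n) z.
Proof. by move=> [l hl]; eexists; exact: hasdX hl. Qed.
Lemma dif_cst c z : dif (fun=> c) z.
Proof. by exists 0; exact: hasd_cst. Qed.
Lemma dif_id z : dif (fun w => w) z.
Proof. by exists 1; exact: hasd_id. Qed.
Lemma dif_comp f g z : dif f z -> dif g (f z) -> dif (fun w => g (f w)) z.
Proof. by move=> [l hl] [m hm]; eexists; exact: hasd_comp hl hm. Qed.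

Lemma hasd_slope f a l : hasd f a l ->
  contat (fun z => if z == a then l else (f z - f a) / (z - a)) a.
Proof.
move=> hf e e0; have [|d d0 H] := hf (e / 2); first by rewrite divr_gt0.
exists d => // w /H; rewrite eqxx; case: eqVneq => [_ _|wa h].
  by rewrite subrr md0.
have wa0 : w - a != 0 by rewrite subr_eq0.
have -> : (f w - f a) / (w - a) - l = (f w - f a - l * (w - a)) / (w - a) by field.
rewrite mdM mdV; apply: (@le_lt_trans _ _ (e / 2)); last lra.
by rewrite ler_pdivrMr ?md_gt0.
Qed.

Lemma neq_near (z a : C) : z != a -> forall w, md (w - z) < md (z - a) -> w != a.
Proof. by move=> za w; apply: contraTneq => ->; rewrite mdBC ltxx. Qed.

Lemma slope_dif f a l z : z != a -> dif f z ->
  dif (fun z => if z == a then l else (f z - f a) / (z - a)) z.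
Proof.
move=> za df; apply: (@dif_near (fun z => (f z - f a) / (z - a)) _ _ (md (z - a))).
- by rewrite md_gt0 subr_eq0.
- by move=> w /(neq_near za)/negbTE ->.
- apply: difM; first by apply: difB => //; exact: dif_cst.
  apply: difV; first by rewrite subr_eq0.
  by apply: difB; [exact: dif_id|exact: dif_cst].
Qed.

(** If the bound failed, [g z / g a] would be small on the boundary, and the difference quotient
    [k], equal there to [(1 - g z / g a) / (z - a)], would be close to 1 / (z - a). Each side of the
    square would then contribute positively to the imaginary part of the integral of [k], which is 0
    because [k] is continuous at [a] and differentiable elsewhere. *)
Lemma weak_mp (r d : R) : 0 < d -> d <= r -> forall g c a M, sq c (r - d) a ->
  (forall z, sq c r z -> dif g z) ->
  (forall z, sqb c r z -> md (g z) <= M) -> md (g a) <= 16 * r ^+ 2 / d ^+ 2 * M.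
Proof.
move=> d0 dr g c a M ain dg gM.
have r0 : 0 < r by exact: lt_le_trans d0 dr.
have r2 : 0 < r ^+ 2 by rewrite exprn_gt0.
have d2 : 0 < d ^+ 2 by rewrite exprn_gt0.
pose K := 16 * r ^+ 2 / d ^+ 2.
have K0 : 0 < K by rewrite divr_gt0// mulr_gt0.
rewrite leNgt; apply/negP => gaK.
have M0 : 0 <= M.
  apply: le_trans (md_ge0 (g (c + mkC r 0))) (gM _ _).
  rewrite /sqb /sq addrC addKr !reimE normr0 (ger0_norm (ltW r0)) lexx (ltW r0).
  by split => //; left.
have ga : 0 < md (g a) by apply: le_lt_trans gaK; rewrite mulr_ge0// ltW.
have ga0 : g a != 0 by rewrite -md_gt0.
pose h z := - (g z / g a).
have hg z : dif g z -> dif h z.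
  move=> dz; apply: (@dif_eq (fun z => (- (g a)^-1) * g z)); first by move=> w; rewrite /h; ring.
  by apply: difM => //; exact: dif_cst.
have ain' : sq c r a by apply: sq_le ain; clear - d0; lra.
have [l hl] := hg a (dg a ain').
pose k z := if z == a then l else (h z - h a) / (z - a).
pose x0 := re c - r; pose x1 := re c + r; pose y0 := im c - r; pose y1 := im c + r.
have x01 : x0 <= x1 by rewrite /x0 /x1; clear - r0; lra.
have y01 : y0 <= y1 by rewrite /y0 /y1; clear - r0; lra.
have kdif z : sq c r z -> z != a -> dif k z.
  by move=> zin za; apply: slope_dif => //; apply: hg; exact: dg.
have kc z : sq c r z -> contat k z.
  move=> zin; have [->|za] := eqVneq z a; first exact: hasd_slope.
  by apply: dif_contat; exact: kdif.
pose k' := k \o clampC x0 x1 y0 y1.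
have ck' : ccts k' by apply: clampC_cts => // z /sq_rect; exact: kc.
have k'k z : sq c r z -> k' z = k z by move=> /sq_rect ?; rewrite /k' /= clampC_id.
have [a1 a2 a3 a4] : [/\ x0 + d <= re a, re a <= x1 - d, y0 + d <= im a & im a <= y1 - d].
  by move/sq_rect: ain; rewrite /x0 /x1 /y0 /y1; clear; case=> *; split; lra.
have int0 : rect_int k' x0 x1 y0 y1 = 0.
  apply: (@rect_int_except _ _ _ _ _ a) => //; try by clear -a1 a2 a3 a4 d0; lra.
  move=> z /sq_rect zin za; have [m hm] := kdif z zin za.
  exists m => e /hm[e' e'0 He']; exists e' => // w /sq_rect win.
  by rewrite !k'k//; exact: He'.
have kb z : sqb c r z -> z != a -> k z = (1 - g z / g a) / (z - a).
  by move=> zin za; rewrite /k (negbTE za) /h divff// opprK addrC.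
have gb z : sqb c r z -> md (g z / g a) <= d ^+ 2 / (16 * r ^+ 2).
  move=> zin; rewrite mdM mdV ler_pdivrMr//; apply: le_trans (gM z zin) _.
  have -> : d ^+ 2 / (16 * r ^+ 2) = K^-1 by rewrite /K; field; rewrite !gt_eqF.
  by rewrite mulrC ler_pdivlMr// mulrC ltW.
have far z : sqb c r z -> z != a.
  move=> zin; rewrite -subr_eq0 -md_gt0; apply: lt_le_trans d0 _.
  by apply: le_trans (sqb_far ain zin); clear; lra.
have zr z : sqb c r z -> md (z - a) ^+ 2 <= 8 * r ^+ 2.
  move=> [/sq_rect[z1 z2 z3 z4] _]; rewrite md_sq !reimE.
  have : (re z - re a) ^+ 2 <= (2 * r) ^+ 2.
    rewrite -[leLHS]real_normK ?num_real// ler_sqr ?nnegrE ?mulr_ge0 ?(ltW r0)//.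
    rewrite ler_norml; clear -z1 z2 a1 a2 d0; rewrite /x0 /x1 in a1 a2.
    by apply/andP; split; lra.
  have : (im z - im a) ^+ 2 <= (2 * r) ^+ 2.
    rewrite -[leLHS]real_normK ?num_real// ler_sqr ?nnegrE ?mulr_ge0 ?(ltW r0)//.
    rewrite ler_norml; clear -z3 z4 a3 a4 d0; rewrite /y0 /y1 in a3 a4.
    by apply/andP; split; lra.
  by clear; rewrite -[(-im a)]/(- im a) exprMn; lra.
pose p := d / (16 * r ^+ 2).
have p0 : 0 < p by rewrite divr_gt0// mulr_gt0.
(* The unit [u] (one of 1, -1, i, -i) rotates a given side of the square to the right-hand one, so
   that [re_kernel] covers all four. *)
have side (u z : C) : sqb c r z -> md u = 1 -> d <= re (u * (z - a)) -> p <= re (k z / u).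
  move=> zin u1 hd; rewrite kb ?far//.
  have u0 : u != 0 by rewrite -md_gt0 u1.
  have -> : (1 - g z / g a) / (z - a) / u = (1 - g z / g a) / (u * (z - a)).
    by rewrite invfM; ring.
  apply: (@re_kernel r d) => //; last exact: gb.
  by rewrite mdM u1 mul1r; exact: zr.
have mid x y : x0 <= x -> x <= x1 -> y0 <= y -> y <= y1 -> sq c r (mkC x y).
  by move=> *; apply/sq_rect; split.
have i0 : mkC 0 1 != 0 :> C.
  by rewrite -md_gt0 md_mk0C normr1.
have iV : (mkC 0 1)^-1 = - mkC 0 1 :> C.
  by apply: (mulfI i0); rewrite divff//; apply: eqC; rewrite !reimE; ring.
have s1 x : x0 <= x -> x <= x1 -> p <= im (k' (mkC x y0)).
  move=> h1 h2; rewrite k'k; last by apply: mid.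
  have -> : im (k (mkC x y0)) = re (k (mkC x y0) / mkC 0 1).
    by rewrite iV !reimE; ring.
  apply: side; rewrite ?md_mk0C ?normr1//.
    split; first exact: mid.
    by right; rewrite !reimE /y0 addrAC subrr add0r normrN (ger0_norm (ltW r0)).
  by rewrite !reimE; clear -a3; lra.
have s2 x : x0 <= x -> x <= x1 -> p <= - im (k' (mkC x y1)).
  move=> h1 h2; rewrite k'k; last by apply: mid.
  have -> : - im (k (mkC x y1)) = re (k (mkC x y1) / (- mkC 0 1)).
    by rewrite invrN iV !reimE; ring.
  apply: side; rewrite ?mdN ?md_mk0C ?normr1//.
    split; first exact: mid.
    by right; rewrite !reimE /y1 addrAC subrr add0r (ger0_norm (ltW r0)).
  by rewrite !reimE; clear -a4; lra.
have s3 y : y0 <= y -> y <= y1 -> p <= re (k' (mkC x1 y)).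
  move=> h1 h2; rewrite k'k; last by apply: mid.
  have -> : re (k (mkC x1 y)) = re (k (mkC x1 y) / 1) by rewrite divr1.
  apply: side; rewrite ?md1//.
    split; first exact: mid.
    by left; rewrite !reimE /x1 addrAC subrr add0r (ger0_norm (ltW r0)).
  by rewrite !reimE; clear -a2; lra.
have s4 y : y0 <= y -> y <= y1 -> p <= - re (k' (mkC x0 y)).
  move=> h1 h2; rewrite k'k; last by apply: mid.
  have -> : - re (k (mkC x0 y)) = re (k (mkC x0 y) / (- 1)).
    by rewrite invrN invr1 !reimE; ring.
  apply: side; rewrite ?mdN ?md1//.
    split; first exact: mid.
    by left; rewrite !reimE /x0 addrAC subrr add0r normrN (ger0_norm (ltW r0)).
  by rewrite !reimE; clear -a1; lra.
have : 0 < im (rect_int k' x0 x1 y0 y1); last by rewrite int0 ltxx.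
rewrite /rect_int !reimE !mul0r add0r mul1r.
have [ch1 ch2] := ccontB (hline_cont y0 ck') (hline_cont y1 ck').
have [cv1 cv2] := ccontB (vline_cont x1 ck') (vline_cont x0 ck').
have xl : x1 - x0 = 2 * r by rewrite /x0 /x1; ring.
have yl : y1 - y0 = 2 * r by rewrite /y0 /y1; ring.
apply: (@lt_le_trans _ _ (2 * p * (x1 - x0) + 2 * p * (y1 - y0))).
  by rewrite xl yl; have : 0 < p * r by [rewrite mulr_gt0]; clear; lra.
rewrite -!rint_cst//.
apply: lerD; apply: le_rint => //; try (by move=> t; exact: cvg_cst).
  move=> x h1 h2; rewrite !reimE; have := s1 x h1 h2; have := s2 x h1 h2.
  by rewrite /hline; clear; lra.
move=> x h1 h2; rewrite !reimE; have := s3 x h1 h2; have := s4 x h1 h2.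
by rewrite /vline; clear; lra.
Qed.

Lemma geometric_absurd (a b q m K : R) : 0 <= a -> a < q -> 0 < m ->
  (forall n, (0 < n)%N -> q ^+ n * m <= K * a ^+ n) -> False.
Proof.
move=> a0 aq m0 H; have q0 : 0 < q by exact: le_lt_trans aq.
have qa : 0 <= a / q by rewrite divr_ge0// ltW.
have : (a / q) ^+ n @[n --> \oo] --> 0.
  by apply: cvg_expr; rewrite ger0_norm// ltr_pdivrMr// mul1r.
have K1 : 0 < `|K| + 1 by rewrite ltr_wpDl.
move=> /cvgrPdist_lt/(_ (m / (`|K| + 1))) [|n _ /(_ n.+1 (leqnSn _))].
  by rewrite divr_gt0.
rewrite sub0r normrN ger0_norm ?exprn_ge0// ltr_pdivlMr// expr_div_n.
rewrite mulrAC ltr_pdivrMr ?exprn_gt0// => h.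
have := H n.+1 isT; rewrite mulrC leNgt => /negP; apply; apply: le_lt_trans h.
by rewrite mulrC ler_wpM2l ?exprn_ge0// (le_trans (ler_norm _))// lerDl.
Qed.

(* Applying the crude bound to [g ^+ n * e] and letting n grow removes the
   constant; e may vanish at points where g itself is not known to be
   differentiable. *)
Lemma max_principle g e c r a M B : 0 < r ->
  (exists2 d, 0 < d & sq c (r - d) a) ->
  (forall z n, sq c r z -> (0 < n)%N -> dif (fun w => g w ^+ n * e w) z) ->
  (forall z, sqb c r z -> md (g z) <= M) ->
  (forall z, sqb c r z -> md (e z) <= B) -> e a != 0 -> md (g a) <= M.
Proof.
move=> r0 [d d0 ain] dg gM eB ea.
have dr : d <= r by rewrite -subr_ge0 (le_trans (normr_ge0 _) ain.1).
rewrite leNgt; apply/negP => Mg.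
have M0 : 0 <= M.
  apply: le_trans (md_ge0 (g (c + mkC r 0))) (gM _ _).
  rewrite /sqb /sq addrC addKr !reimE normr0 (ger0_norm (ltW r0)) lexx (ltW r0).
  by split => //; left.
apply: (@geometric_absurd M 0 (md (g a)) (md (e a)) (16 * r ^+ 2 / d ^+ 2 * B)) => //.
  by rewrite md_gt0.
move=> n n0; rewrite -mdX -mdM.
have -> : 16 * r ^+ 2 / d ^+ 2 * B * M ^+ n = 16 * r ^+ 2 / d ^+ 2 * (M ^+ n * B) by ring.
apply: (@weak_mp r d d0 dr (fun w => g w ^+ n * e w) c) => //.
  by move=> z zin; exact: dg.
move=> z zin; rewrite mdM mdX; apply: ler_pM => //; rewrite ?exprn_ge0//.
  by rewrite lerXn2r ?nnegrE//; exact: gM.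
exact: eB.
Qed.


(** This lemma and the next give differentiability of a product at a point where one factor is
    merely continuous, respectively merely bounded. They feed the auxiliary factor [e] of
    [max_principle]. *)
Lemma hasd_mulX (u : C -> C) a : contat u a -> hasd (fun z => u z * (z - a)) a (u a).
Proof.
move=> cu e /cu[d d0 H]; exists d => // w /H h.
have -> : u w * (w - a) - u a * (a - a) - u a * (w - a) = (u w - u a) * (w - a) by ring.
by rewrite mdM ler_wpM2r// ltW.
Qed.

Lemma hasd_mulX2 (u : C -> C) a d M : 0 < d -> (forall z, md (z - a) < d -> md (u z) <= M) ->
  hasd (fun z => u z * (z - a) ^+ 2) a 0.
Proof.
move=> d0 H e e0.
have M1 : 0 < `|M| + 1 by rewrite ltr_wpDl.
exists (Num.min d (e / (`|M| + 1))); first by rewrite lt_min d0 divr_gt0.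
move=> w; rewrite lt_min => /andP[/H h]; rewrite ltr_pdivlMr// => h'.
have -> : u w * (w - a) ^+ 2 - u a * (a - a) ^+ 2 - 0 * (w - a) =
  (u w * (w - a)) * (w - a) by ring.
rewrite mdM ler_wpM2r// mdM; apply: le_trans (ltW h'); rewrite mulrC.
by rewrite ler_wpM2l// (le_trans h)// (le_trans (ler_norm _))// lerDl.
Qed.

Lemma contatM f g z : contat f z -> contat g z -> contat (fun w => f w * g w) z.
Proof.
by move=> /contatE cf /contatE cg; apply/contatE; exact: continuousM cf cg.
Qed.
Lemma contatX f z n : contat f z -> contat (fun w => f w ^+ n) z.
Proof.
move=> cf; elim: n => [|n ih]; first by apply: dif_contat; exact: dif_cst.
have := contatM cf ih; congr contat; apply/funext => w.
by rewrite exprS.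
Qed.

(** The maximum principle is applied to the difference quotient [q] with base point [w]. The
    auxiliary factor vanishes once at [w], where [q] is only known to be continuous, and twice at
    [a], where [q] is only known to be bounded. On the boundary [md (x - w) >= r / 2], whence
    [2 * M / (r / 2)]. *)
Lemma lipschitz_except g a r M : 0 < r ->
  (forall z, sq a r z -> z != a -> dif g z) ->
  (forall z, sq a r z -> z != a -> md (g z) <= M) ->
  forall z w, sq a (r / 2) z -> sq a (r / 2) w -> z != a -> w != a ->
  md (g z - g w) <= 4 * M / r * md (z - w).
Proof.
move=> r0 dg gM z w zin win za wa.
have [->|zw] := eqVneq z w; first by rewrite !subrr md0 mulr0.
have win' : sq a r w by apply: sq_le win; clear -r0; lra.
have [l hl] := dg w win' wa.
pose q x := if x == w then l else (g x - g w) / (x - w).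
pose e x := (x - w) * (x - a) ^+ 2.
suff : md (q z) <= 4 * M / r.
  rewrite /q (negbTE zw) mdM mdV ler_pdivrMr//.
  by rewrite md_gt0 subr_eq0.
pose B := 32 * r ^+ 3.
apply: (@max_principle q e a r z (4 * M / r) (12 * r ^+ 3)) => //.
- exists (r / 2); first by rewrite divr_gt0.
  by apply: sq_le zin; clear -r0; lra.
- move=> x n xin n0.
  have [->|xa] := eqVneq x a.
    exists 0; pose d := Num.min (md (w - a) / 2) (r / 2).
    have wa0 : 0 < md (w - a) by rewrite md_gt0 subr_eq0.
    (* A bound for [q] near [a]; the value of [g] at [a] itself is arbitrary, hence the term
       [md (g a)]. *)
    pose N := (2 * (`|M| + md (g a)) + md (g w)) / (md (w - a) / 2).
    have := (@hasd_mulX2 (fun x => q x ^+ n * (x - w)) a d (N ^+ n * (2 * r + 2 * r))).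
    rewrite /e; under [in X in _ -> X]eq_fun do rewrite mulrA.
    apply; first by rewrite lt_min !divr_gt0.
    move=> y; rewrite lt_min => /andP[y1 y2]; rewrite mdM mdX.
    have yw : md (w - a) / 2 <= md (y - w).
      by have := md_triangle w y a; rewrite (mdBC w y); clear -y1; lra.
    have yw0 : 0 < md (y - w) by apply: lt_le_trans yw; rewrite divr_gt0.
    have ne : y != w by rewrite -subr_eq0 -md_gt0.
    have yin : sq a (r / 2) y by apply: sq_md; exact: ltW.
    have yin' : sq a r y by apply: sq_le yin; clear -r0; lra.
    apply: ler_pM => //; rewrite ?exprn_ge0//.
      rewrite lerXn2r ?nnegrE//.
        by rewrite divr_ge0// ?addr_ge0 ?mulr_ge0 ?addr_ge0// divr_ge0.
      rewrite /q (negbTE ne) mdM mdV; apply: ler_pM; rewrite ?invr_ge0//.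
        apply: le_trans (mdB_le _ _) _; rewrite lerD2r.
        have [->|ya] := eqVneq y a.
          by have := md_ge0 (g a); have := normr_ge0 M; clear; lra.
        by have := gM y yin' ya; have := ler_norm M; have := normr_ge0 M; have := md_ge0 (g a); clear; lra.
      by rewrite lef_pV2// posrE// divr_gt0.
    have -> : y - w = (y - a) - (w - a) by ring.
    apply: le_trans (mdB_le _ _) _; apply: lerD; exact: md_sq_le.
  have [->|xw] := eqVneq x w.
    have cq : contat q w by exact: hasd_slope.
    apply: (@dif_eq (fun x => q x ^+ n * (x - a) ^+ 2 * (x - w))).
      by move=> y; rewrite /e; ring.
    eexists; apply: hasd_mulX.
    apply: contatM; first exact: contatX.
    apply: dif_contat; apply: difX; apply: difB; [exact: dif_id|exact: dif_cst].
  apply: difM; first by apply: difX; apply: slope_dif => //; exact: dg.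
  apply: difM; last apply: difX; (apply: difB; [exact: dif_id|exact: dif_cst]).
- move=> x xb; have xw := sqb_far win xb.
  have r2 : r - r / 2 = r / 2 by clear; lra.
  rewrite r2 in xw.
  have xw0 : 0 < md (x - w) by apply: lt_le_trans xw; rewrite divr_gt0.
  have ne : x != w by rewrite -subr_eq0 -md_gt0.
  have xa : x != a by rewrite -subr_eq0 -md_gt0; apply: lt_le_trans (sqb_md xb).
  rewrite /q (negbTE ne) mdM mdV.
  have -> : 4 * M / r = (M + M) * (r / 2)^-1 by field; rewrite gt_eqF.
  apply: ler_pM; rewrite ?invr_ge0//.
    apply: le_trans (mdB_le _ _) _; apply: lerD; apply: gM => //.
    exact: sqb_sq.
  by rewrite lef_pV2// posrE// divr_gt0.
- move=> x xb; rewrite /e mdM mdX.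
  have h := md_sq_le (sqb_sq xb).
  have -> : 12 * r ^+ 3 = (3 * r) * (2 * r) ^+ 2 by ring.
  apply: ler_pM => //; rewrite ?exprn_ge0//; last first.
    by rewrite lerXn2r ?nnegrE// mulr_ge0// ltW.
  have -> : x - w = (x - a) - (w - a) by ring.
  by apply: le_trans (mdB_le _ _) _; have := md_sq_le win; clear -h; lra.
- by rewrite /e mulf_neq0// ?expf_neq0// subr_eq0.
Qed.

(** The intervals of centre [x t] and radius [b t] meet pairwise, hence have a common point: the
    supremum of their left ends. This produces limits at a point together with a rate. *)
Lemma cauchy_real (T : Type) (P : T -> Prop) (x : T -> R) (b : T -> R) :
  (exists t, P t) -> (forall s t, P s -> P t -> `|x s - x t| <= b s + b t) ->
  exists v, forall t, P t -> `|x t - v| <= b t.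
Proof.
move=> [t0 Pt0] H.
pose S := [set x t - b t | t in P].
have ub t : P t -> ubound S (x t + b t).
  move=> Pt _ [s Ps <-]; have := H s t Ps Pt; rewrite ler_norml => /andP[_].
  by clear; lra.
have hs : has_sup S by split; [exists (x t0 - b t0); exists t0|exists (x t0 + b t0); exact: ub].
exists (sup S) => t Pt; rewrite ler_norml.
have h1 : x t - b t <= sup S by apply: sup_upper_bound => //; exists t.
have h2 : sup S <= x t + b t by apply: ge_sup; [exact: hs.1|exact: ub].
by apply/andP; split; clear -h1 h2; lra.
Qed.

Lemma cauchy_complex (T : Type) (P : T -> Prop) (x : T -> C) (b : T -> R) :
  (exists t, P t) -> (forall s t, P s -> P t -> md (x s - x t) <= b s + b t) ->
  exists v, forall t, P t -> md (x t - v) <= 2 * b t.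
Proof.
move=> eP H.
have [|u hu] := @cauchy_real T P (fun t => re (x t)) b eP.
  move=> s t Ps Pt; apply: le_trans (H s t Ps Pt).
  by apply: le_trans (re_le_md _); rewrite !reimE.
have [|v hv] := @cauchy_real T P (fun t => im (x t)) b eP.
  move=> s t Ps Pt; apply: le_trans (H s t Ps Pt).
  by apply: le_trans (im_le_md _); rewrite !reimE.
exists (mkC u v) => t Pt; apply: le_trans (md_le_reim _) _; rewrite !reimE.
by rewrite mulr_natl mulr2n lerD// ?hu ?hv.
Qed.

Lemma punctured_sq a r : 0 < r -> exists z, sq a r z /\ z != a.
Proof.
move=> r0; exists (a + mkC r 0); split.
  by apply: sq_md; rewrite addrAC subrr add0r md_mkC0 ger0_norm// ltW.
by rewrite -subr_eq0 addrAC subrr add0r -md_gt0 md_mkC0 gtr0_norm.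
Qed.

(** Passing through [a] in the triangle inequality turns the Lipschitz bound into the hypothesis of
    [cauchy_complex], with radii proportional to [md (z - a)]. *)
Lemma bounded_limit g a r M : 0 < r ->
  (forall z, sq a r z -> z != a -> dif g z) ->
  (forall z, sq a r z -> z != a -> md (g z) <= M) ->
  exists v, forall z, sq a (r / 2) z -> z != a -> md (g z - v) <= 8 * M / r * md (z - a).
Proof.
move=> r0 dg gM.
have M0 : 0 <= M.
  by have [z [h1 h2]] := punctured_sq a r0; exact: le_trans (md_ge0 _) (gM z h1 h2).
have [||v hv] := @cauchy_complex C (fun z => sq a (r / 2) z /\ z != a) g
  (fun z => 4 * M / r * md (z - a)).
- by apply: punctured_sq; rewrite divr_gt0.
- move=> s t [s1 s2] [t1 t2]; apply: le_trans (lipschitz_except r0 dg gM s1 t1 s2 t2) _.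
  rewrite -mulrDr ler_wpM2l ?divr_ge0 ?mulr_ge0 ?(ltW r0)//.
  by rewrite (mdBC t) md_triangle.
exists v => z z1 z2; apply: le_trans (hv z (conj z1 z2)) _.
by rewrite !mulrA; have -> : 2 * 4 = 8 :> R by ring.
Qed.

(** [bounded_limit] is used twice: on [g], giving [v], and on [(g z - v) / (z - a)], which is
    bounded by [8 * M / r] on the half square, giving [l]. The constant is
    [8 * (8 * M / r) / (r / 2)]. *)
Lemma removable g a r M : 0 < r ->
  (forall z, sq a r z -> z != a -> dif g z) ->
  (forall z, sq a r z -> z != a -> md (g z) <= M) ->
  exists v l, forall z, sq a (r / 4) z -> z != a ->
    md (g z - v - l * (z - a)) <= 128 * M / r ^+ 2 * md (z - a) ^+ 2.
Proof.
move=> r0 dg gM; have [v hv] := bounded_limit r0 dg gM.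
have r20 : 0 < r / 2 by rewrite divr_gt0.
have sub z : sq a (r / 2) z -> sq a r z by apply: sq_le; clear -r0; lra.
pose q z := (g z - v) / (z - a).
have zap z : z != a -> 0 < md (z - a) by rewrite md_gt0 subr_eq0.
have [||l hl] := @bounded_limit q a (r / 2) (8 * M / r) r20.
- move=> z zin za; apply: difM; first by apply: difB; [exact: dg (sub _ zin) za|exact: dif_cst].
  apply: difV; first by rewrite subr_eq0.
  by apply: difB; [exact: dif_id|exact: dif_cst].
- by move=> z zin za; rewrite mdM mdV ler_pdivrMr ?zap//; exact: hv.
exists v, l => z zin za; have zin' : sq a (r / 2 / 2) z by move: zin; have -> : r / 4 = r / 2 / 2 by field.
have := hl z zin' za.
have -> : g z - v - l * (z - a) = (q z - l) * (z - a).
  by rewrite /q; field; rewrite subr_eq0.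
rewrite mdM.
have -> : 128 * M / r ^+ 2 * md (z - a) ^+ 2 =
   8 * (8 * M / r) / (r / 2) * md (z - a) * md (z - a) by field; rewrite gt_eqF.
by move=> h; rewrite ler_wpM2r.
Qed.

Lemma hasd_quadratic g a v l K d : 0 < d -> 
  (forall z, md (z - a) < d -> md (g z - v - l * (z - a)) <= K * md (z - a) ^+ 2) ->
  hasd g a l.
Proof.
move=> d0 H.
have gv : g a = v.
  have := H a; rewrite subrr mulr0 subr0 md0 expr0n /= mulr0 => /(_ d0) h.
  by apply/eqP; rewrite -subr_eq0 -md_eq0; apply/eqP/le_anti; rewrite h md_ge0.
move=> e e0; have K1 : 0 < `|K| + 1 by rewrite ltr_wpDl.
exists (Num.min d (e / (`|K| + 1))); first by rewrite lt_min d0 divr_gt0.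
move=> w; rewrite lt_min gv => /andP[/H h]; rewrite ltr_pdivlMr// => h'.
apply: le_trans h _; rewrite expr2 mulrA ler_wpM2r//; apply: le_trans (ltW h').
by rewrite mulrC ler_wpM2l// (le_trans (ler_norm _))// lerDl.
Qed.

Lemma punctured_value g a v l r K : 0 < r -> 0 <= K -> contat g a ->
  (forall z, sq a r z -> z != a ->
     md (g z - v - l * (z - a)) <= K * md (z - a) ^+ 2) -> g a = v.
Proof.
move=> r0 K0 cg H.
apply/eqP; rewrite -subr_eq0 -md_eq0; apply/eqP/le_anti; rewrite md_ge0 andbT.
apply/ler_addgt0Pr => e e0; rewrite add0r.
have [|d d0 Hd] := cg (e / 2); first by rewrite divr_gt0.
pose B := md l + K * r + 1.
have B0 : 0 < B by rewrite /B ltr_wpDl// addr_ge0// mulr_ge0// ltW.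
pose s := Num.min r (Num.min (d / 2) (e / 2 / B)).
have s0 : 0 < s by rewrite !lt_min r0 !divr_gt0.
have : s <= s by []. rewrite {2}/s !le_min => /andP[s1 /andP[s2 s3]].
clearbody s.
pose z := a + mkC s 0.
have za : z - a = mkC s 0 by rewrite /z addrAC subrr add0r.
have mz : md (z - a) = s by rewrite za md_mkC0 gtr0_norm.
have z1 : sq a r z by apply: sq_md; rewrite mz.
have z2 : z != a by rewrite -subr_eq0 -md_gt0 mz.
have h1 := H z z1 z2.
have h2 : md (g z - g a) < e / 2 by apply: Hd; rewrite mz; clear -s2 d0; lra.
have -> : g a - v = (g z - v - l * (z - a)) - (g z - g a) + l * (z - a) by ring.
apply: le_trans (mdD _ _) _; apply: le_trans (lerD (mdB_le _ _) (lexx _)) _.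
rewrite mdM mz; rewrite mz in h1.
have h3 : K * s ^+ 2 + md l * s <= B * s.
  rewrite /B expr2 mulrA !mulrDl mul1r.
  have : K * s * s <= K * r * s by rewrite ler_wpM2r ?ler_wpM2l// ltW.
  by move: s0; clear; lra.
have h4 : B * s <= e / 2 by rewrite mulrC -ler_pdivlMr.
by clear -h1 h2 h3 h4; lra.
Qed.

(** The coefficients found by [removable] must be the value and the derivative. What matters later
    is that the constant depends on [g] through [M] alone. *)
Lemma taylor2 g a l r M : 0 < r -> hasd g a l ->
  (forall z, sq a r z -> dif g z) -> (forall z, sq a r z -> md (g z) <= M) ->
  forall z, sq a (r / 4) z ->
    md (g z - g a - l * (z - a)) <= 128 * M / r ^+ 2 * md (z - a) ^+ 2.
Proof.
move=> r0 hg dg gM.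
have [||v [l' H]] := @removable g a r M r0; try by move=> *; auto.
have r40 : 0 < r / 4 by rewrite divr_gt0.
have M0 : 0 <= M by exact: le_trans (md_ge0 _) (gM a (sq_center a (ltW r0))).
have K0 : 0 <= 128 * M / r ^+ 2 by apply: divr_ge0; [exact: mulr_ge0|exact: sqr_ge0].
set K := 128 * M / r ^+ 2 in H K0 *.
have gv : g a = v by apply: punctured_value r40 K0 (hasd_cont hg) H.
have hl' : hasd g a l'.
  apply: (@hasd_quadratic _ _ v _ K (r / 4)) => // z zin.
  have [->|za] := eqVneq z a.
    by rewrite gv !subrr mulr0 subr0 md0 expr0n /= mulr0.
  by apply: H => //; apply: sq_md; exact: ltW.
move=> z zin; rewrite (hasd_uniq hg hl') gv.
have [->|za] := eqVneq z a; last exact: H.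
by rewrite gv !subrr mulr0 subr0 md0 expr0n /= mulr0.
Qed.


Lemma hasd_taylor g a r M : 0 < r ->
  (forall z, sq a r z -> dif g z) -> (forall z, sq a r z -> md (g z) <= M) ->
  exists2 l, hasd g a l & forall z, sq a (r / 4) z ->
    md (g z - g a - l * (z - a)) <= 128 * M / r ^+ 2 * md (z - a) ^+ 2.
Proof.
move=> r0 dg gM; have [l hl] := dg a (sq_center a (ltW r0)).
by exists l => //; exact: taylor2.
Qed.

(* Pointwise convergence of uniformly bounded holomorphic functions suffices:
   the bound on second order remainders makes difference quotients converge. *)
Lemma limit_dif (gn : nat -> C -> C) g c r M : 0 < r ->
  (forall n z, sq c (2 * r) z -> dif (gn n) z) ->
  (forall n z, sq c (2 * r) z -> md (gn n z) <= M) ->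
  (forall z, sq c (2 * r) z -> forall e, 0 < e ->
     exists N, forall n, (N <= n)%N -> md (gn n z - g z) < e) ->
  forall a, sq c r a -> dif g a.
Proof.
move=> r0 dg gM lim a ain.
have sub z : sq a r z -> sq c (2 * r) z.
  by move=> h; have := sq_trans ain h; rewrite -mulr2n mulr_natl.
pose K := 128 * M / r ^+ 2.
have r40 : 0 < r / 4 by rewrite divr_gt0.
have r20 : 0 < r / 2 by rewrite divr_gt0.
have M0 : 0 <= M by exact: le_trans (md_ge0 _) (gM 0%N a (sub _ (sq_center a (ltW r0)))).
have K0 : 0 <= K by apply: divr_ge0; [exact: mulr_ge0|exact: sqr_ge0].
pose q (f : C -> C) z := (f z - f a) / (z - a).
have qn n z w : sq a (r / 4) z -> sq a (r / 4) w -> z != a -> w != a ->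
    md (q (gn n) z - q (gn n) w) <= K * md (z - a) + K * md (w - a).
  move=> zin win za wa.
  have [l _ H] := hasd_taylor r0 (fun z h => dg n z (sub z h)) (fun z h => gM n z (sub z h)).
  have one x : sq a (r / 4) x -> x != a -> md (q (gn n) x - l) <= K * md (x - a).
    move=> xin xa; have xa0 : x - a != 0 by rewrite subr_eq0.
    have -> : q (gn n) x - l = (gn n x - gn n a - l * (x - a)) / (x - a).
      by rewrite /q; field.
    by rewrite mdM mdV ler_pdivrMr ?md_gt0// -mulrA -expr2; exact: H.
  apply: le_trans (md_triangle _ l _) _; rewrite (mdBC l).
  by apply: lerD; exact: one.
have qg z w : sq a (r / 4) z -> sq a (r / 4) w -> z != a -> w != a ->
    md (q g z - q g w) <= K * md (z - a) + K * md (w - a).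
  move=> zin win za wa; apply/ler_addgt0Pr => e e0.
  have sub4 x : sq a (r / 4) x -> sq c (2 * r) x.
    by move=> h; apply: sub; apply: sq_le h; clear -r0; lra.
  have za0 : 0 < md (z - a) by rewrite md_gt0 subr_eq0.
  have wa0 : 0 < md (w - a) by rewrite md_gt0 subr_eq0.
  pose d := Num.min (e / 4 * md (z - a)) (e / 4 * md (w - a)).
  have d0 : 0 < d by rewrite lt_min !mulr_gt0 ?divr_gt0.
  have [N1 H1] := lim z (sub4 _ zin) d d0.
  have [N2 H2] := lim w (sub4 _ win) d d0.
  have [N3 H3] := lim a (sub _ (sq_center a (ltW r0))) d d0.
  pose n := maxn N1 (maxn N2 N3).
  have {}H1 := H1 n (leq_maxl _ _).
  have {}H2 := H2 n (leq_trans (leq_maxl _ _) (leq_maxr _ _)).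
  have {}H3 := H3 n (leq_trans (leq_maxr _ _) (leq_maxr _ _)).
  have qd x : x != a -> md (gn n x - g x) < d -> d <= e / 4 * md (x - a) ->
      md (q (gn n) x - q g x) <= e / 2.
    move=> xa h hd; have xa0 : 0 < md (x - a) by rewrite md_gt0 subr_eq0.
    have -> : q (gn n) x - q g x = ((gn n x - g x) - (gn n a - g a)) / (x - a).
      by rewrite /q; ring.
    rewrite mdM mdV ler_pdivrMr//; apply: le_trans (mdB_le _ _) _.
    by clear -h hd H3; lra.
  have h1 := qd z za H1; rewrite /d ge_min lexx in h1.
  have h2 := qd w wa H2; rewrite /d ge_min lexx orbT in h2.
  have -> : q g z - q g w = (q (gn n) z - q (gn n) w) - (q (gn n) z - q g z)
     + (q (gn n) w - q g w) by ring.
  apply: le_trans (mdD _ _) _; apply: le_trans (lerD (mdB_le _ _) (lexx _)) _.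
  have := qn n z w zin win za wa; have := h1 isT; have := h2 isT; clear; lra.
have [||l Hl] := @cauchy_complex C (fun z => sq a (r / 4) z /\ z != a) (q g)
  (fun z => K * md (z - a)).
- exact: punctured_sq.
- by move=> s t [s1 s2] [t1 t2]; exact: qg.
exists l; apply: (@hasd_quadratic _ _ (g a) _ (2 * K) (r / 4)) => // z zd.
have [->|za] := eqVneq z a; first by rewrite !subrr mulr0 subr0 md0 expr0n /= mulr0.
have -> : g z - g a - l * (z - a) = (q g z - l) * (z - a).
  by rewrite /q; field; rewrite subr_eq0.
rewrite mdM expr2 mulrA ler_wpM2r// -mulrA; apply: Hl; split => //.
by apply: sq_md; exact: ltW.
Qed.

Lemma dif_bounded_near g a : contat g a -> exists2 r, 0 < r &
  forall z, sq a r z -> md (g z) <= md (g a) + 1.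
Proof.
move=> /(_ 1 ltr01)[d d0 H]; exists (d / 4); first by rewrite divr_gt0.
move=> z /md_sq_le h; have {}h : md (z - a) < d by clear -h d0; lra.
by have := mdB (g z) (g a); have := H z h; clear; lra.
Qed.

Definition holo (f : C -> C) (a : C) := exists2 d : R, 0 < d &
  forall z, sq a d z -> dif f z.

Lemma holoE f a : holo f a <-> holomorphic_near a f.
Proof.
split => [[d d0 H]|/nbhs_md[d d0 H]].
  apply/nbhs_md; exists d => // z /ltW/sq_md/H[l hl].
  exact: hasd_derivable hl.
exists (d / 4); first by rewrite divr_gt0.
move=> z /md_sq_le h; apply: derivable_hasd; apply: H.
by clear -h d0; lra.
Qed.

Lemma holo_dif f a : holo f a -> dif f a.
Proof. by move=> [d d0 H]; apply: H; apply: sq_center; exact: ltW. Qed.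

(** Difference quotients with the real steps [h n] are holomorphic and uniformly bounded, and
    [taylor2] makes them converge to [f']; the theorem on limits then replaces Cauchy's formula. *)
Lemma deriv_holo f f' c r : 0 < r ->
  (forall z, sq c r z -> hasd f z (f' z)) -> holo f' c.
Proof.
move=> r0 hf.
have df z : sq c r z -> dif f z by move=> h; exists (f' z); exact: hf.
have [s' s'0 fM'] := dif_bounded_near (dif_contat (df _ (sq_center c (ltW r0)))).
pose s := Num.min r s'; have s0 : 0 < s by rewrite lt_min r0.
set M := md (f c) + 1 in fM'.
have sr z : sq c s z -> sq c r z by apply: sq_le; rewrite ge_min lexx.
have fM z : sq c s z -> md (f z) <= M.
  by move=> h; apply: fM'; apply: sq_le h; rewrite ge_min lexx orbT.
clearbody s; clear fM' s'0.
pose t := s / 2; have t0 : 0 < t by rewrite divr_gt0.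
have sub a z : sq c t a -> sq a t z -> sq c s z.
  by move=> h1 h2; have := sq_trans h1 h2; rewrite -[t + t]splitr.
pose K := 128 * M / t ^+ 2.
have M0 : 0 <= M by exact: le_trans (md_ge0 _) (fM c (sq_center c (ltW s0))).
have K0 : 0 <= K by apply: divr_ge0; [exact: mulr_ge0|exact: sqr_ge0].
have ty a z : sq c t a -> sq a (t / 4) z ->
    md (f z - f a - f' a * (z - a)) <= K * md (z - a) ^+ 2.
  move=> ain; apply: taylor2 => //.
  - by apply: hf; apply: sr; apply: sq_le ain; rewrite /t; clear -s0; lra.
  - by move=> w h; apply: df; apply: sr; exact: sub h.
  - by move=> w h; apply: fM; exact: sub h.
pose h (n : nat) := mkC (t / 4 / n.+1%:R) 0.
have hm n : md (h n) = t / 4 / n.+1%:R.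
  by rewrite /h md_mkC0 ger0_norm// !divr_ge0// ltW.
have hm0 n : 0 < md (h n) by rewrite hm !divr_gt0.
have hm1 n : md (h n) <= t / 4.
  by rewrite hm ler_pdivrMr// ler_peMr ?ler1n// divr_ge0// ltW.
pose gn n z := (f (z + h n) - f z) / h n.
have gne n a : sq c t a -> md (gn n a - f' a) <= K * md (h n).
  move=> ain; have := ty a (a + h n) ain.
  rewrite [a + _ - a]addrAC subrr add0r => H.
  have hn0 : h n != 0 by rewrite -md_gt0.
  have -> : gn n a - f' a = (f (a + h n) - f a - f' a * h n) / h n by rewrite /gn; field.
  rewrite mdM mdV ler_pdivrMr// -mulrA -expr2; apply: H.
  by apply: sq_md; rewrite addrAC subrr add0r.
have fin a z : sq c t a -> sq a (t / 4) z -> sq c s z.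
  by move=> h1 h2; apply: sub h1 _; apply: sq_le h2; clear -t0; lra.
have f'b a : sq c t a -> md (f' a) <= 2 * M / md (h 0%N) + K * md (h 0%N).
  move=> ain; have -> : f' a = gn 0%N a - (gn 0%N a - f' a) by ring.
  apply: le_trans (mdB_le _ _) _; apply: lerD; last exact: gne.
  rewrite /gn mdM mdV ler_pM2r ?invr_gt0//; apply: le_trans (mdB_le _ _) _.
  rewrite mulr_natl mulr2n; apply: lerD; apply: fM.
    by apply: (fin a) => //; apply: sq_md; rewrite addrAC subrr add0r.
  by apply: (fin a) => //; apply: sq_center; rewrite divr_ge0// ltW.
have t20 : 0 < t / 2 by rewrite divr_gt0.
have t2 : 2 * (t / 2) = t by field.
exists (t / 2) => //.
apply: (@limit_dif gn f' c (t / 2) (K * (t / 4) + (2 * M / md (h 0%N) + K * md (h 0%N)))) => //.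
- move=> n z; rewrite t2 => zin; apply: difM; last exact: dif_cst.
  apply: difB.
    apply: (dif_comp (f := fun z => z + h n)).
      by apply: difD; [exact: dif_id|exact: dif_cst].
    apply: df; apply: sr; apply: (fin z) => //; apply: sq_md.
    by rewrite addrAC subrr add0r.
  by apply: df; apply: sr; apply: sq_le zin; rewrite /t; clear -s0; lra.
- move=> n z; rewrite t2 => zin.
  have -> : gn n z = (gn n z - f' z) + f' z by rewrite subrK.
  apply: le_trans (mdD _ _) _; apply: lerD; last exact: f'b.
  by apply: le_trans (gne n z zin) _; rewrite ler_wpM2l.
- move=> z; rewrite t2 => zin e e0.
  have K1 : 0 < K + 1 by rewrite ltr_wpDl.
  pose N := (Num.truncn ((K + 1) * (t / 4) / e)).
  exists N => n Nn; apply: le_lt_trans (gne n z zin) _.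
  apply: (@le_lt_trans _ _ ((K + 1) * md (h n))); first by rewrite ler_wpM2r// lerDl.
  rewrite hm mulrA ltr_pdivrMr// -ltr_pdivrMl// mulrC.
  apply: (@lt_le_trans _ _ N.+1%:R); first exact: truncnS_gt.
  by rewrite ler_nat.
Qed.

(** The slope, completed by the derivative at [a], is continuous there; [removable] supplies a
    second order remainder, hence a derivative at [a]. *)
Lemma slope_holo f a r : 0 < r -> (forall z, sq a r z -> dif f z) ->
  exists2 g, (forall z, sq a r z -> dif g z) & forall z, f z = f a + (z - a) * g z.
Proof.
move=> r0 df.
have [l hl] := df a (sq_center a (ltW r0)).
pose g z := if z == a then l else (f z - f a) / (z - a).
exists g; last first.
  move=> z; rewrite /g; case: eqVneq => [->|za]; first by rewrite subrr mul0r addr0.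
  by rewrite mulrC divfK ?subr_eq0// addrC subrK.
have gd z : sq a r z -> z != a -> dif g z by move=> h za; apply: slope_dif => //; exact: df.
move=> z zin; have [->|za] := eqVneq z a; last exact: gd.
have cg : contat g a by exact: hasd_slope.
have [s' s'0 gM] := dif_bounded_near cg.
pose s := Num.min r s'; have s0 : 0 < s by rewrite lt_min r0.
have [||v [l' H]] := @removable g a s (md (g a) + 1) s0.
- by move=> w win; apply: gd; apply: sq_le win; rewrite ge_min lexx.
- by move=> w win _; apply: gM; apply: sq_le win; rewrite ge_min lexx orbT.
have K0 : 0 <= 128 * (md (g a) + 1) / s ^+ 2.
  by apply: divr_ge0; [apply: mulr_ge0 => //; exact: addr_ge0|exact: sqr_ge0].
set K := 128 * _ / _ in H K0.
have s40 : 0 < s / 4 by rewrite divr_gt0.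
have gav : g a = v by apply: punctured_value s40 K0 cg H.
exists l'; apply: (@hasd_quadratic _ _ v _ K (s / 4)) => // w wd.
have [->|wa] := eqVneq w a; last by apply: H => //; apply: sq_md; exact: ltW.
by rewrite gav !subrr mulr0 subr0 md0 expr0n /= mulr0.
Qed.

Lemma max_modulus g c r a M : 0 < r -> (exists2 d, 0 < d & sq c (r - d) a) ->
  (forall z, sq c r z -> dif g z) ->
  (forall z, sqb c r z -> md (g z) <= M) -> md (g a) <= M.
Proof.
move=> r0 ain dg gM; apply: (@max_principle g (fun=> 1) c r a M 1) => //.
- move=> z n zin _; apply: difM; [by apply: difX; exact: dg|exact: dif_cst].
- by move=> z _; rewrite md1.
Qed.

(** If factors [z - a] can be split off for ever, the maximum modulus on a square of half-side [s]
    bounds the n-th cofactor by [M / s ^+ n], so [md (f z)] is at most [M * (md (z - a) / s) ^+ n]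
    and tends to 0. The factorisation holds for every [z] since far from [a] the cofactor is a plain
    quotient. *)
Lemma holo_factor f a : holo f a ->
  (exists2 d, 0 < d & forall z, md (z - a) < d -> f z = 0) \/
  exists n k, [/\ holo k a, k a != 0 & forall z, f z = (z - a) ^+ n * k z].
Proof.
move=> hf; have [r r0 df] := hf.
have [[n [k H]]|H] := pselect (exists n k, [/\ holo k a, k a != 0 &
  forall z, f z = (z - a) ^+ n * k z]); [by right; exists n, k|left].
have [s' s'0 fM'] := dif_bounded_near (dif_contat (df _ (sq_center a (ltW r0)))).
pose s := Num.min r s'; have s0 : 0 < s by rewrite lt_min r0.
set M := md (f a) + 1 in fM'.
have fM z : sq a s z -> md (f z) <= M.
  by move=> h; apply: fM'; apply: sq_le h; rewrite ge_min lexx orbT.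
have {}df z : sq a s z -> dif f z.
  by move=> h; apply: df; apply: sq_le h; rewrite ge_min lexx.
clearbody s.
have fk n : exists2 k, (forall z, sq a s z -> dif k z) &
    forall z, f z = (z - a) ^+ n * k z.
  elim: n => [|n [k dk fk]]; first by exists f => // z; rewrite mul1r.
  have ka : k a = 0.
    apply/eqP/negP => /negP ka; apply: H; exists n, k; split => //.
    by exists s.
  have [g dg kg] := slope_holo s0 dk; exists g => // z.
  by rewrite fk kg ka add0r exprSr mulrA.
exists (s / 2); first by rewrite divr_gt0.
move=> z zs; apply/eqP; rewrite -md_eq0; apply/negP => /negP fz.
apply: (@geometric_absurd (md (z - a)) 0 s (md (f z)) M) => //.
- by clear -zs s0; lra.
- by rewrite lt_def fz md_ge0.
move=> n _; have [k dk fkn] := fk n.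
have sn : 0 < s ^+ n by rewrite exprn_gt0.
have : md (k z) <= M / s ^+ n.
  apply: (@max_modulus k a s z) => //.
    exists (s / 2); first by rewrite divr_gt0.
    by apply: sq_md; rewrite {1}[s]splitr addrK ltW.
  move=> w wb; rewrite ler_pdivlMr//.
  have := fM w (sqb_sq wb); rewrite fkn mdM mdX; apply: le_trans.
  by rewrite mulrC ler_wpM2r// lerXn2r ?nnegrE// ?(ltW s0)// sqb_md.
rewrite ler_pdivlMr// => h; rewrite fkn mdM mdX mulrCA [leRHS]mulrC.
by apply: ler_wpM2l; [exact: exprn_ge0|rewrite mulrC].
Qed.

End MaximumPrinciple.

(** * The Riemann sphere in stereographic coordinates *)

Section SphereGeometry.
Variable R : realType.
Local Notation C := (Cplane R).
Local Notation S := (sphere R).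
Local Notation md := (@modulus R).

(* Coordinates in R^3 of the stereographic image. *)
Definition stx (p : S) : R := if p is Some z then 2 * re z / (1 + md z ^+ 2) else 0.
Definition sty (p : S) : R := if p is Some z then 2 * im z / (1 + md z ^+ 2) else 0.
Definition stt (p : S) : R :=
  if p is Some z then (md z ^+ 2 - 1) / (1 + md z ^+ 2) else 1.

(** The l1 distance in R^3, equivalent to the chordal one: it has no square root, and its triangle
    inequality is that of the absolute value. *)
Definition sd (p q : S) : R :=
  `|stx p - stx q| + `|sty p - sty q| + `|stt p - stt q|.

Lemma md1_gt0 (z : C) : 0 < 1 + md z ^+ 2.
Proof. by rewrite ltr_wpDr// sqr_ge0. Qed.

Lemma md1_neq0 (z : C) : 1 + (re z ^+ 2 + im z ^+ 2) != 0.
Proof. by rewrite -md_sq gt_eqF// md1_gt0. Qed.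

Lemma sd_ge0 p q : 0 <= sd p q. Proof. by rewrite !addr_ge0. Qed.
Lemma sdpp p : sd p p = 0. Proof. by rewrite /sd !subrr normr0 !addr0. Qed.
Lemma sdC p q : sd p q = sd q p.
Proof. by rewrite /sd (distrC (stx p)) (distrC (sty p)) (distrC (stt p)). Qed.
Lemma sd_triangle q p r : sd p r <= sd p q + sd q r.
Proof.
rewrite /sd; have := ler_distD (stx q) (stx p) (stx r).
have := ler_distD (sty q) (sty p) (sty r).
by have := ler_distD (stt q) (stt p) (stt r); lra.
Qed.

Lemma st_sphere p : stx p ^+ 2 + sty p ^+ 2 + stt p ^+ 2 = 1.
Proof.
case: p => [z|]; last by rewrite /= expr0n /= !add0r expr1n.
by rewrite /= !md_sq; field; exact: md1_neq0.
Qed.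

Lemma chordal_ge0 (p q : S) : 0 <= chordal_dist p q.
Proof.
by case: p q => [z|] [w|] //=; rewrite ?divr_ge0 ?mulr_ge0 ?sqrtr_ge0.
Qed.

Lemma chordal_sq (p q : S) : chordal_dist p q ^+ 2 =
  (stx p - stx q) ^+ 2 + (sty p - sty q) ^+ 2 + (stt p - stt q) ^+ 2.
Proof.
have sq2 (z : C) : Num.sqrt (1 + md z ^+ 2) ^+ 2 = 1 + md z ^+ 2.
  by rewrite sqr_sqrtr// ltW// md1_gt0.
case: p q => [z|] [w|] /=.
- rewrite expr_div_n !exprMn !sq2 !md_sq !reimE; field.
  by rewrite !md1_neq0.
- by rewrite expr_div_n sq2 !md_sq; field; rewrite md1_neq0.
- by rewrite expr_div_n sq2 !md_sq; field; rewrite md1_neq0.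
- by rewrite !subrr expr0n /= !addr0.
Qed.

Lemma chordal_le_sd p q : chordal_dist p q <= sd p q.
Proof.
rewrite -ler_sqr ?nnegrE ?chordal_ge0 ?sd_ge0// chordal_sq /sd.
rewrite -[X in X + _ + _]real_normK ?num_real//.
rewrite -[X in _ + X + _]real_normK ?num_real//.
rewrite -[X in _ + X <= _]real_normK ?num_real//.
have := normr_ge0 (stx p - stx q); have := normr_ge0 (sty p - sty q).
have := normr_ge0 (stt p - stt q).
set a := `|_|; set b := `|_|; set c := `|_| => *.
have : 0 <= a * b by exact: mulr_ge0.
have : 0 <= a * c by exact: mulr_ge0.
have : 0 <= b * c by exact: mulr_ge0.
by lra.
Qed.

Lemma sd_le_chordal p q : sd p q <= 2 * chordal_dist p q.
Proof.
rewrite -ler_sqr ?nnegrE ?mulr_ge0 ?chordal_ge0 ?sd_ge0// exprMn chordal_sq /sd.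
rewrite -[X in _ * (X + _ + _)]real_normK ?num_real//.
rewrite -[X in _ * (_ + X + _)]real_normK ?num_real//.
rewrite -[X in _ * (_ + X)]real_normK ?num_real//.
set a := `|_|; set b := `|_|; set c := `|_|.
have := sqr_ge0 (a - b); have := sqr_ge0 (a - c); have := sqr_ge0 (b - c).
by have := sqr_ge0 a; have := sqr_ge0 b; have := sqr_ge0 c; lra.
Qed.

Lemma sqrt_md1_ge1 (z : C) : 1 <= Num.sqrt (1 + md z ^+ 2).
Proof. by rewrite -{1}sqrtr1 ler_wsqrtr// lerDl sqr_ge0. Qed.

Lemma sqrt_md1_le (z : C) : Num.sqrt (1 + md z ^+ 2) <= 1 + md z.
Proof.
rewrite -[leRHS]ger0_norm ?addr_ge0// -sqrtr_sqr ler_wsqrtr//.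
by have := md_ge0 z; lra.
Qed.

Lemma sd_fin_fin (z w : C) : sd (Some z) (Some w) <=
  4 * md (z - w) / (Num.sqrt (1 + md z ^+ 2) * Num.sqrt (1 + md w ^+ 2)).
Proof.
apply: le_trans (sd_le_chordal _ _) _; rewrite /= le_eqVlt; apply/orP; left.
by apply/eqP; rewrite /modulus; ring.
Qed.

Lemma sd_fin_le (z w : C) : sd (Some z) (Some w) <= 4 * md (z - w).
Proof.
apply: le_trans (sd_fin_fin _ _) _.
rewrite ler_pdivrMr ?mulr_gt0 ?(lt_le_trans ltr01 (sqrt_md1_ge1 _))//.
rewrite ler_peMr ?mulr_ge0//.
have := ler_pM ler01 ler01 (sqrt_md1_ge1 z) (sqrt_md1_ge1 w); rewrite mulr1.
exact.
Qed.

(** With [X] the chordal distance, [2 * md (a - c) <= X * (1 + md a) * L] and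
    [1 + md a <= L + md (a - c)]; since [X * L <= 1], the last term is absorbed on the left.
    Infinity is excluded because its distance to [c] is at least [2 / L]. *)
Lemma sd_fin_close (p : S) (c : C) : sd p (Some c) * (1 + md c) <= 1 ->
  exists2 a, p = Some a & md (a - c) <= (1 + md c) ^+ 2 * sd p (Some c).
Proof.
set L := 1 + md c; have L0 : 0 < L by rewrite /L ltr_pwDl.
have Lc : Num.sqrt (1 + md c ^+ 2) <= L by exact: sqrt_md1_le.
have sc : 0 < Num.sqrt (1 + md c ^+ 2) by rewrite (lt_le_trans ltr01)// sqrt_md1_ge1.
move=> H; have h : chordal_dist p (Some c) * L <= 1.
  by apply: le_trans H; rewrite ler_wpM2r ?chordal_le_sd// ltW.
case: p H h => [a|] H h; last first.
  move: h; rewrite /= leNgt => /negP; case.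
  rewrite mulrAC ltr_pdivlMr// mul1r; apply: le_lt_trans Lc _.
  by rewrite ltr_pMl// ltr1n.
exists a => //.
have sa : 0 < Num.sqrt (1 + md a ^+ 2) by rewrite (lt_le_trans ltr01)// sqrt_md1_ge1.
set X := chordal_dist _ _ in h.
have X0 : 0 <= X by exact: chordal_ge0.
have E : 2 * md (a - c) = X * (Num.sqrt (1 + md a ^+ 2) * Num.sqrt (1 + md c ^+ 2)).
  rewrite /X /= -/md; field.
  by rewrite !gt_eqF.
have h1 : 2 * md (a - c) <= X * ((1 + md a) * L).
  rewrite E; apply: ler_wpM2l => //; apply: ler_pM; rewrite ?sqrtr_ge0//.
  exact: sqrt_md1_le.
have h2 : 1 + md a <= L + md (a - c).
  by rewrite /L; have := mdD (a - c) c; rewrite subrK; lra.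
have h3 : X * ((1 + md a) * L) <= X * L * L + md (a - c).
  have : X * ((1 + md a) * L) <= X * ((L + md (a - c)) * L).
    by rewrite ler_wpM2l// ler_wpM2r// ltW.
  have : X * L * md (a - c) <= 1 * md (a - c) by rewrite ler_wpM2r.
  lra.
have h4 : md (a - c) <= L ^+ 2 * X by lra.
apply: le_trans h4 _; rewrite ler_wpM2l ?sqr_ge0//; exact: chordal_le_sd.
Qed.

Definition sinv (p : S) : S :=
  if p is Some z then (if z == 0 then None else Some z^-1) else Some 0.

Lemma sinvK : involutive sinv.
Proof.
case=> [z|] /=; last by rewrite eqxx.
by case: eqVneq => [->|z0] //=; rewrite invr_eq0 (negbTE z0) invrK.
Qed.

(** Inversion is the half-turn of the sphere about its first axis, hence an isometry. This is what
    reduces statements at infinity to statements at 0. *)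
Lemma st_sinv p : [/\ stx (sinv p) = stx p, sty (sinv p) = - sty p & stt (sinv p) = - stt p].
Proof.
case: p => [z|] /=; last first.
  by rewrite md0 expr0n /= !mulr0 !mul0r oppr0 sub0r addr0 divr1.
case: eqVneq => [->|z0] /=.
  by rewrite md0 expr0n /= !mulr0 !mul0r oppr0 sub0r addr0 divr1 opprK.
have z2 : re z ^+ 2 + im z ^+ 2 != 0 by rewrite -md_sq expf_neq0// md_eq0.
have rV : re z^-1 = re z / (re z ^+ 2 + im z ^+ 2) by case: (z).
have iV : im z^-1 = - im z / (re z ^+ 2 + im z ^+ 2) by case: (z) => a b; rewrite mulNr.
have n1 := md1_neq0 z; rewrite mdV exprVn md_sq rV iV.
move: z2 n1; set n := _ + _ => n0 n1.
by split; field; rewrite n0 ?n1 // addrC n1.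
Qed.

Lemma sd_sinv p q : sd (sinv p) (sinv q) = sd p q.
Proof.
rewrite /sd; have [-> -> ->] := st_sinv p; have [-> -> ->] := st_sinv q.
by rewrite -!opprD !normrN.
Qed.

Lemma st_inj p q : stx p = stx q -> sty p = sty q -> stt p = stt q -> p = q.
Proof.
move=> h1 h2 h3; have h : sd p q = 0 by rewrite /sd h1 h2 h3 !subrr normr0 !addr0.
case: q h {h1 h2 h3} => [c|] h.
  have [|a pa ac] := @sd_fin_close p c; first by rewrite h mul0r.
  rewrite pa; congr Some; apply/eqP; rewrite -subr_eq0 -md_eq0; apply/eqP/le_anti.
  by rewrite md_ge0 andbT; move: ac; rewrite h mulr0.
have [|a pa ac] := @sd_fin_close (sinv p) 0.
  by rewrite -[Some 0]/(sinv None) sd_sinv h mul0r.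
have a0 : a = 0.
  apply/eqP; rewrite -md_eq0; apply/eqP/le_anti; rewrite md_ge0 andbT.
  by move: ac; rewrite subr0 -[Some 0]/(sinv None) sd_sinv h mulr0.
by rewrite -[p]sinvK pa a0 /= eqxx.
Qed.

Lemma st_surj (x y t : R) : x ^+ 2 + y ^+ 2 + t ^+ 2 = 1 ->
  exists p, [/\ stx p = x, sty p = y & stt p = t].
Proof.
move=> h; have [t1|t1] := eqVneq t 1.
  exists None; rewrite t1 /=.
  have : x ^+ 2 + y ^+ 2 = 0 by move: h; rewrite t1 expr1n; lra.
  by move=> /eqP; rewrite paddr_eq0 ?sqr_ge0// !sqrf_eq0 => /andP[/eqP -> /eqP ->].
have t0 : 1 - t != 0 by rewrite subr_eq0 eq_sym.
exists (Some (mkC (x / (1 - t)) (y / (1 - t)))) => /=; rewrite !md_sq !re_mkC !im_mkC.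
have y2 : y ^+ 2 = (1 - t) * (1 + t) - x ^+ 2.
  by have -> : (1 - t) * (1 + t) = 1 - t ^+ 2 by [ring]; lra.
have -> : (x / (1 - t)) ^+ 2 + (y / (1 - t)) ^+ 2 = (1 + t) / (1 - t).
  by rewrite !expr_div_n y2; field.
have D : 1 + (1 + t) / (1 - t) = 2 / (1 - t) by field.
by rewrite D; split; field.
Qed.

Lemma spherical_lt (e : R) : 0 < e -> exists2 d, 0 < d &
  forall p q : S, sd p q < d -> spherical_dist p q < e.
Proof.
move=> e0.
have c0 : {for 0, continuous (@asin R)} by apply: continuous_asin; lra.
have /cvgrPdist_lt /(_ (e / 2)) : asin (x : R) @[x --> 0] --> (asin 0 : R) by exact: c0.
rewrite divr_gt0// => /(_ isT) /nbhs_ballP[d /= d0 H].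
exists d => // p q h.
have c1 : chordal_dist p q < d by apply: le_lt_trans h; exact: chordal_le_sd.
have := H (chordal_dist p q / 2); rewrite /ball /= sub0r normrN.
have cd := chordal_ge0 p q.
have asin0 : asin 0 = 0 :> R.
  rewrite -[X in asin X]sin0 sinK// in_itv /=; have := pi_gt0 R.
  by move=> pi0; apply/andP; split; lra.
rewrite ger0_norm ?divr_ge0// => /(_ ltac:(lra)).
rewrite asin0 sub0r normrN => h2; rewrite /spherical_dist.
by have := ler_norm (asin (chordal_dist p q / 2)); lra.
Qed.

End SphereGeometry.

(** * Pointwise second order expansions and Laplacians *)

Section SecondOrder.
Variable R : realType.
Local Notation C := (Cplane R).
Local Notation md := (@modulus R).

Definition conjC (z : C) : C := mkC (re z) (- im z).

Definition expansion2 (psi : R -> R) (x p q : R) := forall e, 0 < e ->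
  exists2 d, 0 < d & forall t, `|t| < d ->
    `|psi (x + t) - psi x - p * t - q * t ^+ 2| <= e * t ^+ 2.

Lemma mvt_quadratic (phi phi1 : R -> R) (d e : R) : 0 <= e ->
  (forall s : R, `|s| < d -> is_derive s 1 phi (phi1 s)) ->
  (forall s, `|s| < d -> `|phi1 s| <= e * `|s|) ->
  forall t, `|t| < d -> `|phi t - phi 0| <= e * t ^+ 2.
Proof.
move=> e0 dphi bphi t td.
have cphi s : `|s| < d -> {for s, continuous phi}.
  move=> /dphi [ds _]; apply/differentiable_continuous; exact/derivable1_diffP.
have t2 : t ^+ 2 = `|t| * `|t| by rewrite -expr2 real_normK// num_real.
have [t0|t0] := leP 0 t.
  have [||c] := @MVT_segment R phi phi1 0 t t0.
  - move=> x; rewrite in_itv /= => /andP[x0 xt]; apply: dphi.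
    by rewrite ger0_norm ?(ltW x0)//; move: td; rewrite ger0_norm//; exact: lt_trans.
  - apply: continuous_in_subspaceT => x; rewrite inE /= in_itv /= => /andP[x0 xt].
    apply: cphi; rewrite ger0_norm//; move: td; rewrite ger0_norm//; exact: le_lt_trans.
  rewrite in_itv /= => /andP[c0 ct] ->; rewrite subr0 normrM t2 mulrA ler_wpM2r//.
  have cd : `|c| < d by rewrite ger0_norm//; move: td; rewrite ger0_norm//; exact: le_lt_trans.
  apply: le_trans (bphi c cd) _; rewrite ler_wpM2l//.
  by rewrite !ger0_norm.
have [||c] := @MVT_segment R phi phi1 t 0 (ltW t0).
- move=> x; rewrite in_itv /= => /andP[tx x0]; apply: dphi.
  rewrite ltr0_norm//; move: td; rewrite ltr0_norm//; apply: lt_trans.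
  by rewrite ltrN2.
- apply: continuous_in_subspaceT => x; rewrite inE /= in_itv /= => /andP[tx x0].
  apply: cphi; rewrite ler0_norm//; move: td; rewrite ltr0_norm//; apply: le_lt_trans.
  by rewrite lerN2.
rewrite in_itv /= => /andP[tc c0] h; rewrite distrC h sub0r normrM normrN t2 mulrA ler_wpM2r//.
have cd : `|c| < d.
  rewrite ler0_norm//; move: td; rewrite ltr0_norm//; apply: le_lt_trans.
  by rewrite lerN2.
apply: le_trans (bphi c cd) _; rewrite ler_wpM2l//.
by rewrite (ler0_norm c0) (ltr0_norm t0) lerN2.
Qed.

(** The remainder [phi] has derivative [phi1], which is o(s) because [psi1] is differentiable at the
    one point [x]; the mean value theorem makes [phi] an o(t^2). *)
Lemma expansion2_deriv (psi psi1 : R -> R) (x q d : R) : 0 < d ->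
  (forall t : R, `|t| < d -> is_derive (x + t) 1 psi (psi1 (x + t))) ->
  is_derive x 1 psi1 q -> expansion2 psi x (psi1 x) (q / 2).
Proof.
move=> d0 dpsi [dp1 dq] e e0.
have : (fun h => h^-1 *: ((psi1 \o shift x) (h *: 1) - psi1 x)) @ 0^' --> q.
  by rewrite -dq; exact: dp1.
move=> /cvgrPdist_le /(_ e e0) /nbhs_ballP[d1 /= d10 H].
exists (Num.min d d1); first by rewrite lt_min d0.
move=> t; rewrite lt_min => /andP[td td1].
pose phi t := psi (x + t) - psi1 x * t - q / 2 * t ^+ 2.
pose phi1 t := psi1 (x + t) - psi1 x - q * t.
have -> : psi (x + t) - psi x - psi1 x * t - q / 2 * t ^+ 2 = phi t - phi 0.
  by rewrite /phi addr0; ring.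
apply: (@mvt_quadratic phi phi1 (Num.min d d1)) => //; first exact: ltW.
- move=> s; rewrite lt_min => /andP[sd sd1].
  have h1 : is_derive s 1 (fun t => psi (x + t)) (psi1 (x + s)).
    have := dpsi s sd => h.
    have := @is_derive1_comp R psi (fun t => x + t) s _ _ h.
    move=> /(_ 1) h2; rewrite -[psi1 _]mulr1; apply: h2.
    rewrite -[1 in X in is_derive _ _ _ X]add0r; apply: is_deriveD.
  rewrite /phi1; apply: is_derive_eq.
  rewrite /GRing.scale /= !(mulr0, mulr1, scaler0, addr0, add0r) /=.
  by field.
- move=> s; rewrite lt_min => /andP[sd sd1]; rewrite /phi1.
  have [->|s0] := eqVneq s 0; first by rewrite addr0 subrr mulr0 subr0 normr0 mulr0.
  have := H s; rewrite /ball /= sub0r normrN => /(_ sd1 s0).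
  rewrite /GRing.scale /= mulr1 distrC => h.
  have -> : psi1 (x + s) - psi1 x - q * s = (s^-1 * (psi1 (s + x) - psi1 x) - q) * s.
    by rewrite (addrC s); field.
  by rewrite normrM ler_wpM2r.
- by rewrite lt_min td.
Qed.

Lemma expansion2_exp (x : R) : expansion2 (@expR R) x (expR x) (expR x / 2).
Proof.
apply: (@expansion2_deriv (@expR R) (@expR R) x (expR x) 1) => // t _.
Qed.

Lemma expansion2_ln (x : R) : 0 < x -> expansion2 (@ln R) x x^-1 (- x ^- 2 / 2).
Proof.
move=> x0; apply: (@expansion2_deriv (@ln R) (fun x => x^-1) x _ x) => //.
  move=> t tx; apply: is_derive1_ln.
  by have := ler_norm (- t); rewrite normrN; lra.
have xn : x != 0 by rewrite gt_eqF.
split; first exact: derivableV.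
by rewrite deriveV// derive_id /GRing.scale /= mulr1.
Qed.

(* [g] is a quarter of the Laplacian of [u] at [z]; only the expansion at the
   single point [z] is asked for. *)
Definition E2 (u : C -> R) (z : C) (a : C) (g : R) := exists b : C, forall e, 0 < e ->
  exists2 d, 0 < d & forall h, md h < d ->
    `|u (z + h) - u z - re (a * h) - re (b * h ^+ 2) - g * md h ^+ 2| <= e * md h ^+ 2.

Lemma E2_near u v z a g d : 0 < d -> (forall h, md h < d -> u (z + h) = v (z + h)) ->
  E2 u z a g -> E2 v z a g.
Proof.
move=> d0 uv [b H]; exists b => e /H[d' d'0 H'].
exists (Num.min d d'); first by rewrite lt_min d0.
move=> h; rewrite lt_min => /andP[hd /H'].
rewrite uv//; have := uv 0; rewrite md0 addr0 => -> //.
Qed.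

Lemma E2D u v z a b g k : E2 u z a g -> E2 v z b k ->
  E2 (fun w => u w + v w) z (a + b) (g + k).
Proof.
move=> [c H] [c' H']; exists (c + c') => e e0.
have e2 : 0 < e / 2 by rewrite divr_gt0.
have [d d0 {}H] := H _ e2; have [d' d'0 {}H'] := H' _ e2.
exists (Num.min d d'); first by rewrite lt_min d0.
move=> h; rewrite lt_min => /andP[/H h1 /H' h2].
set x := (X in `|X| <= _) in h1; set y := (X in `|X| <= _) in h2.
have -> : u (z + h) + v (z + h) - (u z + v z) - re ((a + b) * h) -
  re ((c + c') * h ^+ 2) - (g + k) * md h ^+ 2 = x + y.
  by rewrite /x /y !mulrDl !reD; ring.
apply: le_trans (ler_normD _ _) _; move: h1 h2; lra.
Qed.

Lemma E2Z (k : R) u z a g : E2 u z a g ->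
  E2 (fun w => k * u w) z (mkC k 0 * a) (k * g).
Proof.
move=> [c H]; exists (mkC k 0 * c) => e e0.
have K : 0 < `|k| + 1 by rewrite ltr_wpDl.
have [|d d0 {}H] := H (e / (`|k| + 1)); first by rewrite divr_gt0.
exists d => // h /H; set x := (X in `|X| <= _) => h1.
have -> : k * u (z + h) - k * u z - re (mkC k 0 * a * h) - re (mkC k 0 * c * h ^+ 2) -
  k * g * md h ^+ 2 = k * x by rewrite /x !reimE; ring.
rewrite normrM; apply: le_trans (ler_wpM2l _ h1) _ => //.
rewrite mulrA ler_wpM2r ?sqr_ge0// mulrA ler_pdivrMr// mulrC ler_wpM2l ?lerDl//.
exact: ltW.
Qed.

Lemma E2_cst (k : R) z : E2 (fun=> k) z 0 0.
Proof.
exists 0 => e e0; exists 1 => // h _.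
rewrite !mul0r !re0 !subr0 subrr normr0; apply: mulr_ge0; first exact: ltW.
exact: sqr_ge0.
Qed.

Lemma E2_comp psi u z a g p q : E2 u z a g -> expansion2 psi (u z) p q ->
  E2 (fun w => psi (u w)) z (mkC p 0 * a) (p * g + q * (md a ^+ 2 / 2)).
Proof.
move=> [b H] Hpsi.
exists (mkC p 0 * b + mkC (q / 2) 0 * a ^+ 2) => e e0.
have [d0 d00 H0] := H 1 ltr01.
pose K := md b + `|g| + 1.
have K0 : 0 < K by rewrite ltr_wpDl// addr_ge0.
pose L := md a + K; have L0 : 0 < L by rewrite ltr_wpDl.
have L20 : 0 < L ^+ 2 by rewrite exprn_gt0.
have [|d1 d10 H1] := H (e / 3 / (`|p| + 1)); first by rewrite !divr_gt0// ltr_wpDl.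
have [|d2 d20 H2] := Hpsi (e / 3 / L ^+ 2); first by rewrite !divr_gt0.
pose Q := (`|q| + 1) * (K * (2 * md a + K)).
have Q0 : 0 < Q.
  apply: mulr_gt0; first by rewrite ltr_wpDl.
  by apply: mulr_gt0 => //; rewrite ltr_wpDl// mulr_ge0.
exists (Num.min (Num.min 1 d0) (Num.min d1 (Num.min (d2 / L) (e / 3 / Q)))).
  by rewrite !lt_min ltr01 d00 d10 !divr_gt0.
move=> h; rewrite !lt_min => /andP[/andP[k1 k2] /andP[k3 /andP[k4 k5]]].
have {}H0 := H0 h k2; have {}H1 := H1 h k3.
set t := u (z + h) - u z in H0 H1.
set m := md h in k1 k2 k3 k4 k5 H0 H1 *.
have m0 : 0 <= m by exact: md_ge0.
pose r := t - re (a * h).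
have hr : `|r| <= K * m ^+ 2.
  have -> : r = (t - re (a * h) - re (b * h ^+ 2) - g * m ^+ 2) + re (b * h ^+ 2) + g * m ^+ 2.
    by rewrite /r; ring.
  apply: le_trans (ler_normD _ _) _; apply: le_trans (lerD (ler_normD _ _) (lexx _)) _.
  have : `|re (b * h ^+ 2)| <= md b * m ^+ 2.
    by apply: le_trans (re_le_md _) _; rewrite mdM mdX.
  have : `|g * m ^+ 2| <= `|g| * m ^+ 2 by rewrite normrM [`|m ^+ 2|]ger0_norm ?sqr_ge0.
  by move: H0; rewrite /K !mulrDl mul1r; clear; lra.
have ha : `|re (a * h)| <= md a * m by apply: le_trans (re_le_md _) _; rewrite mdM.
have m2m : m ^+ 2 <= m by rewrite expr2 ler_piMr// ltW.
have ht : `|t| <= L * m.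
  have -> : t = re (a * h) + r by rewrite /r; ring.
  apply: le_trans (ler_normD _ _) _; rewrite /L mulrDl; apply: lerD => //.
  by apply: le_trans hr _; rewrite ler_wpM2l// ltW.
have td : `|t| < d2 by apply: le_lt_trans ht _; rewrite mulrC -ltr_pdivlMr.
have {}H2 := H2 t td.
have ut : u (z + h) = u z + t by rewrite /t [RHS]addrC subrK.
rewrite ut.
have t2 : t ^+ 2 <= L ^+ 2 * m ^+ 2.
  rewrite -[t ^+ 2]real_normK ?num_real// -exprMn lerXn2r ?nnegrE ?mulr_ge0//.
  exact: ltW.
have h2 : `|psi (u z + t) - psi (u z) - p * t - q * t ^+ 2| <= e / 3 * m ^+ 2.
  apply: le_trans H2 _; apply: le_trans (ler_wpM2l _ t2) _.
    by rewrite !divr_ge0// ltW.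
  by rewrite mulrA divfK// gt_eqF.
have h1 : `|p * (t - re (a * h) - re (b * h ^+ 2) - g * m ^+ 2)| <= e / 3 * m ^+ 2.
  have p1 : 0 < `|p| + 1 by rewrite ltr_wpDl.
  rewrite normrM; apply: le_trans (ler_wpM2l _ H1) _ => //.
  rewrite mulrA ler_wpM2r ?sqr_ge0// mulrA ler_pdivrMr// mulrC ler_wpM2l ?lerDl//.
  by rewrite divr_ge0// ltW.
have h3 : `|q * (t ^+ 2 - re (a * h) ^+ 2)| <= e / 3 * m ^+ 2.
  rewrite normrM.
  have -> : t ^+ 2 - re (a * h) ^+ 2 = r * (2 * re (a * h) + r) by rewrite /r; ring.
  rewrite normrM.
  have : `|2 * re (a * h) + r| <= (2 * md a + K) * m.
    apply: le_trans (ler_normD _ _) _; rewrite [leRHS]mulrDl normrM [`|2|]ger0_norm// -mulrA.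
    apply: lerD; first by rewrite ler_wpM2l.
    by apply: le_trans hr _; rewrite ler_wpM2l// ltW.
  move=> h4; have := ler_pM (normr_ge0 _) (normr_ge0 _) hr h4 => h5.
  apply: le_trans (ler_wpM2l _ h5) _ => //.
  have : Q * m <= e / 3 by rewrite mulrC -ler_pdivlMr// ltW.
  move=> h6; apply: (@le_trans _ _ (Q * m * m ^+ 2)); last by rewrite ler_wpM2r ?sqr_ge0.
  have -> : `|q| * (K * m ^+ 2 * ((2 * md a + K) * m)) =
    `|q| * ((K * (2 * md a + K)) * (m * m ^+ 2)) by ring.
  rewrite /Q -!mulrA; apply: ler_pM => //.
  - rewrite !mulr_ge0// ?(ltW K0)// addr_ge0// ?mulr_ge0//; exact: ltW.
  - by rewrite lerDl.
have sqh : re (a * h) ^+ 2 = (md a ^+ 2 * m ^+ 2 + re (a ^+ 2 * h ^+ 2)) / 2.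
  by rewrite /m !md_sq !expr2 !reimE; field.
set x := (X in `|X| <= _) in h1; set y := (X in `|X| <= _) in h2.
set w := (X in `|X| <= _) in h3.
have -> : psi (u z + t) - psi (u z) - re (mkC p 0 * a * h) -
   re ((mkC p 0 * b + mkC (q / 2) 0 * a ^+ 2) * h ^+ 2) -
   (p * g + q * (md a ^+ 2 / 2)) * m ^+ 2 = y + x + w.
  have -> : re (mkC p 0 * a * h) = p * re (a * h) by rewrite !reimE; ring.
  have -> : re ((mkC p 0 * b + mkC (q / 2) 0 * a ^+ 2) * h ^+ 2) =
     p * re (b * h ^+ 2) + q / 2 * re (a ^+ 2 * h ^+ 2).
    by rewrite mulrDl reD -!mulrA !(reM (mkC _ _)) !im_mkC !re_mkC; ring.
  by rewrite /x /y /w sqh; field.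
apply: le_trans (ler_normD _ _) _; apply: le_trans (lerD (ler_normD _ _) (lexx _)) _.
by move: h1 h2 h3; clear; lra.
Qed.

(** Adding the expansions at h = s, -s, i s and -i s cancels the terms in [a] and [b] and leaves
    [4 * g * s ^+ 2 <= 4 * e * s ^+ 2]. *)
Lemma E2_max u z a g : E2 u z a g ->
  (exists2 d, 0 < d & forall h, md h < d -> u (z + h) <= u z) -> g <= 0.
Proof.
move=> [b H] [d d0 ud]; apply/ler_addgt0Pr => e e0; rewrite add0r.
have [d' d'0 {}H] := H e e0.
pose s := Num.min d d' / 2.
have s0 : 0 < s by rewrite divr_gt0// lt_min d0.
have sd : s < d.
  have : Num.min d d' <= d by rewrite ge_min lexx.
  by rewrite /s; move: d0; clear; lra.
have sd' : s < d'.
  have : Num.min d d' <= d' by rewrite ge_min lexx orbT.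
  by rewrite /s; move: d'0; clear; lra.
clearbody s.
have key h : md h = s -> g * s ^+ 2 + re (a * h) + re (b * h ^+ 2) <= e * s ^+ 2.
  move=> hs; have := H h; have := ud h; rewrite hs => /(_ sd) h1 /(_ sd').
  by rewrite ler_norml => /andP[h2 _]; move: h1 h2; clear; lra.
have k1 := key (mkC s 0); have k2 := key (mkC (- s) 0).
have k3 := key (mkC 0 s); have k4 := key (mkC 0 (- s)).
rewrite !md_mkC0 !md_mk0C normrN (ger0_norm (ltW s0)) in k1 k2 k3 k4.
have {}k1 := k1 erefl; have {}k2 := k2 erefl.
have {}k3 := k3 erefl; have {}k4 := k4 erefl.
have s2 : 0 < s ^+ 2 by rewrite exprn_gt0.
rewrite -(ler_pM2r s2).
move: k1 k2 k3 k4; rewrite !expr2 !reimE; clear; lra.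
Qed.

(** Two successive slopes: [g] of [f], then [k] of [g]; the coefficient is [k z], and continuity of
    [k] gives the remainder. *)
Lemma holo_taylor2 f z l : holo f z -> hasd f z l ->
  exists c, forall e, 0 < e -> exists2 d, 0 < d & forall h, md h < d ->
    md (f (z + h) - f z - l * h - c * h ^+ 2) <= e * md h ^+ 2.
Proof.
move=> [r r0 df] hl.
have [g dg fg] := slope_holo r0 df.
have [k dk gk] := slope_holo r0 dg.
have ck : contat k z by apply: dif_contat; apply: dk; apply: sq_center; exact: ltW.
have gl : g z = l.
  apply: (hasd_uniq _ hl).
  have := @hasd_mulX R g z (dif_contat (dg z (sq_center z (ltW r0)))).
  move=> /(hasdD (hasd_cst (f z) z)); rewrite add0r.
  by congr hasd; apply/funext => w; rewrite [RHS]fg mulrC.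
exists (k z) => e e0; have [d d0 Hd] := ck e e0.
exists d => // h hd.
have zh : z + h - z = h by rewrite addrAC subrr add0r.
have -> : f (z + h) - f z - l * h - k z * h ^+ 2 = (k (z + h) - k z) * h ^+ 2.
  by rewrite fg gk zh gl; ring.
rewrite mdM mdX ler_wpM2r ?sqr_ge0// ltW//.
by have := Hd (z + h); rewrite zh; exact.
Qed.

(** Harmonicity of ln |f|, without a branch of the logarithm: |f / f z| ^ 2 equals 1 at [z] and has
    quarter Laplacian |l / f z| ^ 2, which the second derivative of ln cancels exactly. *)
Lemma E2_lnmd f z l : holo f z -> hasd f z l -> f z != 0 ->
  E2 (fun w => ln (md (f w))) z (l / f z) 0.
Proof.
move=> hf hl fz.
have [c Hc] := holo_taylor2 hf hl.
pose u w := md (f w / f z) ^+ 2.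
have hu : E2 u z (mkC 2 0 * (l / f z)) (md (l / f z) ^+ 2).
  exists (mkC 2 0 * (c / f z)) => e e0.
  set a := l / f z; set b := c / f z.
  pose K := 2 + 2 * (md a + md b + 1).
  have K0 : 0 < K by rewrite ltr_wpDr// mulr_ge0// !addr_ge0.
  pose T := md a + md b + 1.
  have fz0 : 0 < md (f z) by rewrite md_gt0.
  pose e1 := Num.min 1 (e / 4).
  have e10 : 0 < e1 by rewrite lt_min ltr01 divr_gt0.
  have [|d d0 {}Hc] := Hc (e1 * md (f z)); first by rewrite mulr_gt0.
  pose N := (2 * md a * (md b + 1) + (md b + 1) ^+ 2).
  have N0 : 0 <= N by rewrite addr_ge0 ?sqr_ge0// !mulr_ge0// addr_ge0.
  exists (Num.min (Num.min 1 d) (e / 2 / (N + 1))).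
    by rewrite !lt_min ltr01 d0 !divr_gt0// ltr_wpDl.
  move=> h; rewrite !lt_min => /andP[/andP[h1 /Hc hh] h3].
  set m := md h in h1 h3 hh *.
  have m0 : 0 <= m by exact: md_ge0.
  pose r := f (z + h) / f z - 1 - a * h - b * h ^+ 2.
  have hr : md r <= e1 * m ^+ 2.
    have -> : r = (f (z + h) - f z - l * h - c * h ^+ 2) / f z.
      by rewrite /r /a /b; field.
    by rewrite mdM mdV ler_pdivrMr// mulrAC.
  pose y := b * h ^+ 2 + r.
  have hy : md y <= (md b + 1) * m ^+ 2.
    apply: le_trans (mdD _ _) _; rewrite mdM mdX mulrDl; apply: lerD => //.
    apply: le_trans hr _; rewrite ler_wpM2r ?sqr_ge0//.
    by rewrite /e1 ge_min lexx.
  have E : u (z + h) - u z - re (mkC 2 0 * a * h) - re (mkC 2 0 * b * h ^+ 2) - md a ^+ 2 * m ^+ 2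
     = 2 * re r + 2 * re ((a * h) * conjC y) + md y ^+ 2.
    rewrite /u divff// md1 expr1n.
    have -> : f (z + h) / f z = 1 + a * h + y by rewrite /y /r; ring.
    have -> : re r = re y - re (b * h ^+ 2) by rewrite /y (reD (b * h ^+ 2) r) [RHS]addrAC subrr add0r.
    have -> : re (mkC 2 0 * b * h ^+ 2) = 2 * re (b * h ^+ 2).
      by rewrite -mulrA reM im_mkC re_mkC; ring.
    move: (re (b * h ^+ 2)) => rb; rewrite /m !md_sq /conjC !reimE; clear; ring.
  rewrite E.
  have i1 : `|re r| <= e / 4 * m ^+ 2.
    apply: le_trans (re_le_md _) _; apply: le_trans hr _; rewrite ler_wpM2r ?sqr_ge0//.
    by rewrite /e1 ge_min lexx orbT.
  have i2 : `|re (a * h * conjC y)| <= md a * (md b + 1) * (m * m ^+ 2).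
    apply: le_trans (re_le_md _) _; rewrite (mdM (a * h)) (mdM a h).
    have -> : md (conjC y) = md y by rewrite !mdE /conjC !reimE sqrrN.
    rewrite -/m.
    have -> : md a * (md b + 1) * (m * m ^+ 2) = md a * m * ((md b + 1) * m ^+ 2) by ring.
    by rewrite ler_wpM2l// mulr_ge0.
  have i3 : md y ^+ 2 <= (md b + 1) ^+ 2 * (m * m ^+ 2).
    have : md y ^+ 2 <= ((md b + 1) * m ^+ 2) ^+ 2.
      by rewrite lerXn2r ?nnegrE// mulr_ge0 ?sqr_ge0// addr_ge0.
    move=> hh2; apply: le_trans hh2 _; rewrite exprMn ler_wpM2l ?sqr_ge0//.
    rewrite [(m ^+ 2) ^+ 2]expr2 ler_wpM2r ?sqr_ge0// expr2 ler_piMr//; exact: ltW.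
  have i4 : N * (m * m ^+ 2) <= e / 2 * m ^+ 2.
    rewrite mulrA ler_wpM2r ?sqr_ge0//.
    have : (N + 1) * m <= e / 2 by rewrite mulrC -ler_pdivlMr ?ltr_wpDl// ltW.
    by move: m0; clear; lra.
  apply: le_trans (ler_normD _ _) _; apply: le_trans (lerD (ler_normD _ _) (lexx _)) _.
  rewrite (normrM 2 (re r)) (normrM 2 (re (_ * _))) (ger0_norm (ler0n _ 2)) (ger0_norm (sqr_ge0 _)).
  by move: i1 i2 i3 i4; rewrite /N; move: (m * m ^+ 2); clear => q; lra.
have uz : u z = 1 by rewrite /u divff// md1 expr1n.
have := @E2_comp (@ln R) u z _ _ _ _ hu.
rewrite uz => /(_ _ _ (expansion2_ln ltr01)) /(E2Z (2^-1)).
move=> /(E2D (E2_cst (ln (md (f z))) z)).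
have [d d0 fd] : exists2 d, 0 < d & forall w, md (w - z) < d -> md (f w - f z) < md (f z).
  by apply: (hasd_cont hl); rewrite md_gt0.
have Ea : 0 + mkC 2^-1 0 * (mkC 1^-1 0 * (mkC 2 0 * (l / f z))) = l / f z.
  by apply: eqC; rewrite !reimE; field.
have Eg : 0 + 2^-1 * (1^-1 * md (l / f z) ^+ 2 +
    - 1 ^- 2 / 2 * (md (mkC 2 0 * (l / f z)) ^+ 2 / 2)) = 0.
  by rewrite (mdM (mkC 2 0)) md_mkC0 (ger0_norm (ler0n _ 2)) exprMn expr1n; field.
rewrite Ea Eg; apply: (@E2_near _ _ _ _ _ d) => // h hd.
have fp : 0 < md (f (z + h)).
  have := fd (z + h); rewrite addrAC subrr add0r => /(_ hd).
  by have := mdB (f z) (f (z + h)); rewrite (mdBC (f z)); clear; lra.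
rewrite /u mdM mdV lnXn ?ln_div ?posrE ?divr_gt0// ?md_gt0//.
by rewrite mulr2n; field.
Qed.

(** Up to constants this is minus the logarithm of the Poincare density of the disc of radius [r];
    the coefficient expresses its constant negative curvature. *)
Lemma E2_lndisk (r : R) (z : C) : md z < r ->
  E2 (fun w => ln (r ^+ 2 - md w ^+ 2)) z
     (mkC (r ^+ 2 - md z ^+ 2)^-1 0 * (mkC (- 2) 0 * conjC z))
     (- r ^+ 2 / (r ^+ 2 - md z ^+ 2) ^+ 2).
Proof.
move=> zr; have X0 : 0 < r ^+ 2 - md z ^+ 2.
  by rewrite subr_gt0 ltrXn2r// ?nnegrE// (le_trans (md_ge0 z))// ltW.
have hu : E2 (fun w => r ^+ 2 - md w ^+ 2) z (mkC (- 2) 0 * conjC z) (- 1).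
  exists 0 => e e0; exists 1 => // h _.
  rewrite [X in `|X|](_ : _ = 0) ?normr0; last first.
    by rewrite !md_sq /conjC !expr2 !reimE; ring.
  by rewrite mulr_ge0 ?sqr_ge0// ltW.
have := E2_comp hu (expansion2_ln X0); congr E2.
rewrite mdM md_mkC0 normrN ger0_norm//.
have -> : md (conjC z) = md z by rewrite !mdE /conjC !reimE sqrrN.
by field; rewrite gt_eqF.
Qed.

End SecondOrder.

(** * The explicit metric on the plane without 0 and 1 *)

Section Metric.
Variable R : realType.
Local Notation C := (Cplane R).
Local Notation S := (sphere R).
Local Notation md := (@modulus R).

(* The metric at w has t ^+ 30 = |w| and s ^+ 30 = |w - 1|.  It grows like
   |w| ^ (-14/30) at 0, |1/w| ^ (-19/30) at infinity and |w - 1| ^ (-29/30) at 1;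
   since 14/30 < 1/2, 19/30 < 2/3 and 29/30 < 30/31, its pull-back by a map taking
   these values with orders at least 2, 3 and 31 vanishes at those points. *)
Definition metric (t s : R) : R := (1 + t) * (1 + s) / (t ^+ 14 * s ^+ 29).

Lemma le_pow30 (a b : R) : 0 <= a -> 0 <= b -> a ^+ 30 <= b ^+ 30 -> a <= b.
Proof. by move=> a0 b0; rewrite ler_pXn2r. Qed.

Lemma le_pow_ge1 (t : R) m n : 1 <= t -> (m <= n)%N -> t ^+ m <= t ^+ n.
Proof. by move=> t1 mn; rewrite ler_weXn2l. Qed.

Lemma pow30_le2 (t s : R) : 1 <= t -> 0 <= s -> s ^+ 30 <= 1 + t ^+ 30 -> s <= 2 * t.
Proof.
move=> t1 s0 h; have t0 : 0 <= t by apply: le_trans t1.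
apply: le_pow30 => //; first by rewrite mulr_ge0.
apply: le_trans h _; rewrite exprMn.
have h1 : 1 <= t ^+ 30 by rewrite exprn_ege1.
have h2 : (2 : R) ^+ 1 <= 2 ^+ 30 by apply: le_pow_ge1 => //; rewrite ler1n.
have : 2 * t ^+ 30 <= 2 ^+ 30 * t ^+ 30 by rewrite ler_wpM2r// (le_trans ler01).
by move: h1; clear; lra.
Qed.

Lemma pow30_lt1 (t s : R) : 0 <= t -> t <= 1 -> 0 <= s -> s ^+ 30 <= 1 + t ^+ 30 -> s <= 2.
Proof.
move=> t0 t1 s0 h; rewrite -[2]mulr1; apply: pow30_le2 => //.
by apply: le_trans h _; rewrite lerD2l expr1n exprn_ile1.
Qed.

Lemma ler_pM3 (a b c a' b' c' : R) : 0 <= a -> 0 <= b -> 0 <= c ->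
  a <= a' -> b <= b' -> c <= c' -> a * b * c <= a' * b' * c'.
Proof. by move=> *; rewrite ler_pM// ?mulr_ge0// ler_pM. Qed.

Lemma half_pow30 : (2^-1 : R) ^+ 30 <= 2^-1.
Proof. by rewrite -[leRHS]expr1 ler_wiXn2l// ?invr_ge0// invf_le1// ler1n. Qed.

Lemma pow30_ge_half (t s : R) : 0 <= t -> t <= 2^-1 -> 0 <= s -> 1 <= t ^+ 30 + s ^+ 30 ->
  2^-1 <= s.
Proof.
move=> t0 t1 s0 h; apply: le_pow30 => //.
have := half_pow30.
have : t ^+ 30 <= 2^-1 ^+ 30 by rewrite lerXn2r ?nnegrE ?invr_ge0.
by move: h; clear; lra.
Qed.

(** Times |H'| ^ 2 / 3600, the right-hand side is the quarter Laplacian of the logarithm of the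
    metric pulled back by H, so this is the upper bound on the curvature. For [t >= 2^-1] the term
    in [s] suffices ([A]); for smaller [t] one has [s >= 2^-1] and the term in [t] suffices ([B]).
    The hypotheses on 30th powers are triangle inequalities for 0, 1 and w; [2 ^- 70] is
    generous. *)
Lemma metric_curvature (t s : R) : 0 < t -> 0 < s -> s ^+ 30 <= 1 + t ^+ 30 ->
  1 <= t ^+ 30 + s ^+ 30 ->
  2 ^- 70 * metric t s ^+ 2 <= (t ^+ 59 * (1 + t) ^+ 2)^-1 + (s ^+ 59 * (1 + s) ^+ 2)^-1.
Proof.
move=> t0 s0 h1 h2.
have t1 : 0 < 1 + t by rewrite ltr_pwDl// ltW.
have s1 : 0 < 1 + s by rewrite ltr_pwDl// ltW.
have k0 : 0 <= (2 : R) ^- 70 by rewrite invr_ge0 exprn_ge0.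
have A : 2 ^- 70 * ((1 + t) ^+ 2 * (1 + s) ^+ 4 * s) <= t ^+ 28 ->
   2 ^- 70 * metric t s ^+ 2 <= (s ^+ 59 * (1 + s) ^+ 2)^-1.
  move=> h; rewrite -[leRHS]div1r ler_pdivlMr ?mulr_gt0 ?exprn_gt0//.
  have -> : 2 ^- 70 * metric t s ^+ 2 * (s ^+ 59 * (1 + s) ^+ 2) =
     2 ^- 70 * ((1 + t) ^+ 2 * (1 + s) ^+ 4 * s) / t ^+ 28.
    rewrite /metric; field; rewrite !gt_eqF//.
  by rewrite ler_pdivrMr ?exprn_gt0// mul1r.
have B : 2 ^- 70 * ((1 + t) ^+ 4 * (1 + s) ^+ 2 * t ^+ 31) <= s ^+ 58 ->
   2 ^- 70 * metric t s ^+ 2 <= (t ^+ 59 * (1 + t) ^+ 2)^-1.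
  move=> h; rewrite -[leRHS]div1r ler_pdivlMr ?mulr_gt0 ?exprn_gt0//.
  have -> : 2 ^- 70 * metric t s ^+ 2 * (t ^+ 59 * (1 + t) ^+ 2) =
     2 ^- 70 * ((1 + t) ^+ 4 * (1 + s) ^+ 2 * t ^+ 31) / s ^+ 58.
    rewrite /metric; field; rewrite !gt_eqF//.
  by rewrite ler_pdivrMr ?exprn_gt0// mul1r.
have P1 : 0 <= (t ^+ 59 * (1 + t) ^+ 2)^-1 by rewrite invr_ge0 mulr_ge0// exprn_ge0// ltW.
have P2 : 0 <= (s ^+ 59 * (1 + s) ^+ 2)^-1 by rewrite invr_ge0 mulr_ge0// exprn_ge0// ltW.
have pw (a b : R) n : 0 <= a -> a <= b -> a ^+ n <= b ^+ n.
  by move=> a0 ab; rewrite lerXn2r ?nnegrE// (le_trans a0).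
have [t_ge1|t_lt1] := leP 1 t.
  apply: le_trans (A _) _; last by rewrite lerDr.
  have s2 := pow30_le2 t_ge1 (ltW s0) h1.
  have q1 : (1 + t) ^+ 2 <= (2 * t) ^+ 2 by apply: pw; [exact: ltW|clear -t_ge1; lra].
  have q2 : (1 + s) ^+ 4 <= (3 * t) ^+ 4 by apply: pw; [exact: ltW|clear -t_ge1 s2; lra].
  have q3 : (1 + t) ^+ 2 * (1 + s) ^+ 4 * s <= 2 ^+ 10 * t ^+ 7.
    apply: (@le_trans _ _ ((2 * t) ^+ 2 * (3 * t) ^+ 4 * (2 * t))).
      by apply: ler_pM3 => //; rewrite ?exprn_ge0// ltW.
    have -> : (2 * t) ^+ 2 * (3 * t) ^+ 4 * (2 * t) = 648 * t ^+ 7 by ring.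
    by rewrite ler_wpM2r ?exprn_ge0// ?(ltW t0)// -natrX ler_nat.
  apply: (@le_trans _ _ (2 ^- 70 * (2 ^+ 10 * t ^+ 7))); first by rewrite ler_wpM2l.
  rewrite mulrA; apply: (@le_trans _ _ (t ^+ 7)); last exact: le_pow_ge1.
  rewrite -[leRHS]mul1r ler_wpM2r ?exprn_ge0 ?(ltW t0)//.
  by rewrite mulrC ler_pdivrMr ?exprn_gt0// mul1r le_pow_ge1// ler1n.
have s2 := pow30_lt1 (ltW t0) (ltW t_lt1) (ltW s0) h1.
have [t_ge|t_lt] := leP 2^-1 t.
  apply: le_trans (A _) _; last by rewrite lerDr.
  have q3 : (1 + t) ^+ 2 * (1 + s) ^+ 4 * s <= 2 ^+ 10.
    apply: (@le_trans _ _ (2 ^+ 2 * 3 ^+ 4 * 2)); last by rewrite -!natrX -!natrM ler_nat.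
    apply: ler_pM3 => //; rewrite ?exprn_ge0 ?(ltW t1) ?(ltW s1) ?(ltW s0)//.
      by apply: pw; [exact: ltW|clear -t_lt1; lra].
    by apply: pw; [exact: ltW|clear -s2; lra].
  apply: (@le_trans _ _ (2 ^- 70 * 2 ^+ 10)); first by rewrite ler_wpM2l.
  apply: (@le_trans _ _ (2^-1 ^+ 28)); last by apply: pw => //; rewrite invr_ge0.
  rewrite mulrC ler_pdivrMr ?exprn_gt0//.
  have -> : (2 : R) ^+ 70 = 2 ^+ 28 * 2 ^+ 42 by rewrite -exprD.
  by rewrite mulrA -exprMn mulVf// expr1n mul1r le_pow_ge1// ler1n.
apply: le_trans (B _) _; last by rewrite lerDl.
have s3 := pow30_ge_half (ltW t0) (ltW t_lt) (ltW s0) h2.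
have q3 : (1 + t) ^+ 4 * (1 + s) ^+ 2 * t ^+ 31 <= 2 ^+ 10.
  apply: (@le_trans _ _ (2 ^+ 4 * 3 ^+ 2 * 1)); last by rewrite mulr1 -!natrX -!natrM ler_nat.
  apply: ler_pM3; rewrite ?exprn_ge0 ?(ltW t1) ?(ltW s1) ?(ltW t0)//.
  - by apply: pw; [exact: ltW|clear -t_lt1; lra].
  - by apply: pw; [exact: ltW|clear -s2; lra].
  - by rewrite exprn_ile1 ?ltW.
apply: (@le_trans _ _ (2 ^- 70 * 2 ^+ 10)); first by rewrite ler_wpM2l.
apply: (@le_trans _ _ (2^-1 ^+ 58)); last by apply: pw => //; rewrite invr_ge0.
rewrite mulrC ler_pdivrMr ?exprn_gt0//.
have -> : (2 : R) ^+ 70 = 2 ^+ 58 * 2 ^+ 12 by rewrite -exprD.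
by rewrite mulrA -exprMn mulVf// expr1n mul1r le_pow_ge1// ler1n.
Qed.

Lemma metric_gt0 (t s : R) : 0 < t -> 0 < s -> 0 < metric t s.
Proof. by move=> t0 s0; rewrite divr_gt0// !mulr_gt0// ?exprn_gt0// ltr_pwDl// ltW. Qed.

(** As [t ^+ 60] is |w| ^ 2, this compares with the spherical metric; it converts a bound for the
    pulled back metric into one for the spherical derivative. *)
Lemma metric_lower (t s : R) : 0 < t -> 0 < s -> s ^+ 30 <= 1 + t ^+ 30 ->
  1 <= 2 ^+ 29 * (metric t s * (1 + t ^+ 60)).
Proof.
move=> t0 s0 h1.
have D0 : 0 < t ^+ 14 * s ^+ 29 by rewrite mulr_gt0 ?exprn_gt0.
have -> : 2 ^+ 29 * (metric t s * (1 + t ^+ 60)) =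
  2 ^+ 29 * ((1 + t) * (1 + s) * (1 + t ^+ 60)) / (t ^+ 14 * s ^+ 29).
  by rewrite /metric; ring.
rewrite ler_pdivlMr// mul1r.
have T : 1 + t ^+ 60 <= (1 + t) * (1 + s) * (1 + t ^+ 60).
  rewrite ler_peMl ?addr_ge0 ?exprn_ge0 ?(ltW t0)//.
  by have := mulr_gt0 t0 s0; move: t0 s0; clear; nra.
apply: (@le_trans _ _ (2 ^+ 29 * (1 + t ^+ 60))); last by rewrite ler_wpM2l// exprn_ge0.
have [t1|t1] := leP 1 t.
  have s2 := pow30_le2 t1 (ltW s0) h1.
  have : t ^+ 14 * s ^+ 29 <= t ^+ 14 * (2 * t) ^+ 29.
    by rewrite ler_wpM2l ?exprn_ge0 ?(ltW t0)// lerXn2r ?nnegrE ?mulr_ge0 ?(ltW t0) ?(ltW s0).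
  move=> h; apply: le_trans h _; rewrite exprMn mulrCA -exprD ler_wpM2l ?exprn_ge0//.
  by apply: le_trans (@le_pow_ge1 t 43 60 t1 _) _ => //; rewrite lerDr.
have s2 := pow30_lt1 (ltW t0) (ltW t1) (ltW s0) h1.
have : t ^+ 14 * s ^+ 29 <= 1 * 2 ^+ 29.
  rewrite ler_pM ?exprn_ge0 ?(ltW t0) ?(ltW s0)// ?exprn_ile1 ?(ltW t0) ?(ltW t1)//.
  by rewrite lerXn2r ?nnegrE ?(ltW s0).
rewrite mul1r => h; apply: le_trans h _; rewrite ler_peMr ?exprn_ge0// lerDl.
by rewrite exprn_ge0// ltW.
Qed.

Lemma metric_at0 (t s : R) : 0 < t -> t <= 2^-1 -> 0 < s -> s ^+ 30 <= 1 + t ^+ 30 ->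
  1 <= t ^+ 30 + s ^+ 30 -> metric t s <= 6 * 2 ^+ 29 / t ^+ 14.
Proof.
move=> t0 t1 s0 h1 h2.
have tl : t <= 1 by apply: le_trans t1 _; rewrite invf_le1 ?ler1n.
have s2 := pow30_lt1 (ltW t0) tl (ltW s0) h1.
have s3 := pow30_ge_half (ltW t0) t1 (ltW s0) h2.
have -> : metric t s = (1 + t) * (1 + s) * s ^- 29 / t ^+ 14.
  by rewrite /metric; field; rewrite !gt_eqF.
rewrite ler_wpM2r ?invr_ge0 ?exprn_ge0 ?(ltW t0)//.
apply: ler_pM.
- by rewrite mulr_ge0// addr_ge0// ltW.
- by rewrite invr_ge0 exprn_ge0// ltW.
- have : (1 + t) * (1 + s) <= 2 * 3.
    apply: ler_pM; rewrite ?addr_ge0 ?(ltW t0) ?(ltW s0)//; clear -tl s2; lra.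
  by rewrite -natrM.
- rewrite -exprVn lerXn2r ?nnegrE ?invr_ge0 ?(ltW s0)//.
  by rewrite -[leRHS]invrK lef_pV2 ?posrE ?invr_gt0.
Qed.

Lemma metric_at1 (t s : R) : 0 < t -> s <= 2^-1 -> 0 < s -> t ^+ 30 <= 1 + s ^+ 30 ->
  1 <= t ^+ 30 + s ^+ 30 -> metric t s <= 6 * 2 ^+ 14 / s ^+ 29.
Proof.
move=> t0 s1 s0 h1 h2.
have sl : s <= 1 by apply: le_trans s1 _; rewrite invf_le1 ?ler1n.
have t2 := pow30_lt1 (ltW s0) sl (ltW t0) h1.
rewrite addrC in h2; have t3 := pow30_ge_half (ltW s0) s1 (ltW t0) h2.
have -> : metric t s = (1 + t) * (1 + s) * t ^- 14 / s ^+ 29.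
  by rewrite /metric; field; rewrite !gt_eqF.
rewrite ler_wpM2r ?invr_ge0 ?exprn_ge0 ?(ltW s0)//.
apply: ler_pM.
- by rewrite mulr_ge0// addr_ge0// ltW.
- by rewrite invr_ge0 exprn_ge0// ltW.
- have : (1 + t) * (1 + s) <= 3 * 2.
    apply: ler_pM; rewrite ?addr_ge0 ?(ltW t0) ?(ltW s0)//; clear -sl t2; lra.
  by rewrite -natrM.
- rewrite -exprVn lerXn2r ?nnegrE ?invr_ge0 ?(ltW t0)//.
  by rewrite -[leRHS]invrK lef_pV2 ?posrE ?invr_gt0.
Qed.

(** Each of [1 + t] and [1 + s] cancels one power of the denominator, so 41 = 14 + 29 - 2. *)
Lemma metric_atoo (t s : R) : 2 <= t -> 0 < s -> t ^+ 30 <= 1 + s ^+ 30 ->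
  metric t s <= 6 * 2 ^+ 28 / t ^+ 41.
Proof.
move=> t2 s0 h; have t1 : 1 <= t by apply: le_trans t2; rewrite ler1n.
have t0 : 0 < t by apply: lt_le_trans t1.
have ts : t / 2 <= s.
  have s1 : 1 <= s.
    rewrite leNgt; apply/negP => s1.
    have : s ^+ 30 <= 1 by rewrite exprn_ile1 ?ltW.
    have : 2 ^+ 30 <= t ^+ 30 by rewrite lerXn2r ?nnegrE// ltW.
    have : (2 : R) ^+ 2 <= 2 ^+ 30 by apply: le_pow_ge1 => //; rewrite ler1n.
    by move: h; clear; lra.
  rewrite ler_pdivrMr// mulrC; exact: pow30_le2 (ltW t0) h.
have s1 : 1 <= s by clear -t2 ts; lra.
have -> : metric t s = ((1 + t) * (1 + s) / (t * s)) * (t ^- 13 * s ^- 28).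
  by rewrite /metric; field; rewrite !gt_eqF.
have -> : 6 * 2 ^+ 28 / t ^+ 41 = 6 * (t ^- 13 * (t / 2) ^- 28).
  by field; rewrite gt_eqF.
apply: ler_pM.
- by rewrite divr_ge0// mulr_ge0// ?addr_ge0// ltW.
- by rewrite mulr_ge0// invr_ge0 exprn_ge0// ltW.
- rewrite ler_pdivrMr ?mulr_gt0//.
  apply: (@le_trans _ _ ((2 * t) * (3 * s))).
    apply: ler_pM; rewrite ?addr_ge0 ?(ltW t0) ?(ltW s0)//; clear -t1 s1; lra.
  by rewrite le_eqVlt; apply/orP; left; apply/eqP; ring.
- rewrite ler_wpM2l ?invr_ge0 ?exprn_ge0 ?(ltW t0)//.
  by rewrite lef_pV2 ?posrE ?exprn_gt0 ?divr_gt0// lerXn2r ?nnegrE ?divr_ge0// ltW.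
Qed.

(** Written through exp and ln so that second order expansions compose. It is positive everywhere,
    with a default value at 0; [density] is therefore meaningful off 0 and 1 only. *)
Definition root30 (x : R) : R := expR (30^-1 * ln x).

Lemma root30_gt0 x : 0 < root30 x. Proof. exact: expR_gt0. Qed.
Lemma root30K x : 0 < x -> root30 x ^+ 30 = x.
Proof.
move=> x0; rewrite /root30 -expRM_natl mulrA divff// mul1r lnK// posrE.
Qed.

Definition density (w : C) : R := metric (root30 (md w)) (root30 (md (w - 1))).

Lemma density_gt0 w : 0 < density w.
Proof. by apply: metric_gt0; exact: root30_gt0. Qed.

Lemma density_roots w : w != 0 -> w != 1 ->
  [/\ root30 (md (w - 1)) ^+ 30 <= 1 + root30 (md w) ^+ 30,
      root30 (md w) ^+ 30 <= 1 + root30 (md (w - 1)) ^+ 30 &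
      1 <= root30 (md w) ^+ 30 + root30 (md (w - 1)) ^+ 30].
Proof.
move=> w0 w1; rewrite !root30K ?md_gt0 ?subr_eq0//; split.
- by rewrite [leRHS]addrC -(md1 R); exact: mdB_le.
- by have := mdD (w - 1) 1; rewrite subrK md1 [X in _ <= X]addrC.
- by have := mdB_le w (w - 1); have -> : w - (w - 1) = 1 by [ring]; rewrite md1.
Qed.

End Metric.

(** * Holomorphic maps into the sphere and the pulled back metric *)

Section SphereMaps.
Variable R : realType.
Local Notation C := (Cplane R).
Local Notation S := (sphere R).
Local Notation md := (@modulus R).
Implicit Types (f g H : C -> C) (F : C -> S) (z w : C).

(** Holomorphy in one of the two charts. The constant infinity is allowed, so the notion is
    invariant under [sinv] and closed under the limits taken at the end. *)
Definition shol (F : C -> S) (z : C) := exists H, holo H z /\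
  exists2 d : R, 0 < d &
    (forall w, md (w - z) < d -> F w = Some (H w)) \/
    (forall w, md (w - z) < d -> F w = sinv (Some (H w))).

(** A bound on the distance instead of a factorisation: it covers maps constantly equal to [p],
    treats infinity like any other point, and composes well. *)
Definition order_ge (F : C -> S) (z : C) (p : S) (e : nat) := exists K d : R,
  0 < d /\ forall w, md (w - z) < d -> sd (F w) p <= K * md (w - z) ^+ e.

(* The orders are those of the orbifold points 0, infinity and 1. *)
Definition admissible (F : C -> S) (z : C) := [/\ shol F z,
  F z = Some 0 -> order_ge F z (Some 0) 2,
  F z = None -> order_ge F z None 3 &
  F z = Some 1 -> order_ge F z (Some 1) 31].

Definition finite_part (p : S) : C := if p is Some z then z else 0.

Lemma dif_derive f z : dif f z -> hasd f z ('D_1 f z).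
Proof. by move=> [l /hasdE dl]; apply/hasdE; split; [case: dl|]. Qed.

Lemma hasd_derive f z l : hasd f z l -> 'D_1 f z = l.
Proof. by move=> /hasdE[]. Qed.

Lemma holo_near f z : holo f z -> exists2 d : R, 0 < d &
  forall w, md (w - z) < d -> holo f w.
Proof.
move=> [d d0 H]; exists (d / 2); first by rewrite divr_gt0.
move=> w wd; exists (d / 2); first by rewrite divr_gt0.
move=> x xw; apply: H; have := sq_trans (sq_md (ltW wd)) xw.
by rewrite -splitr.
Qed.

Lemma holo_eq f g z d : 0 < d -> (forall w, md (w - z) < d -> f w = g w) ->
  holo f z -> holo g z.
Proof.
move=> d0 fg [r r0 H].
exists (Num.min r (d / 4)); first by rewrite lt_min r0 divr_gt0.
move=> w win; have := H w (sq_le _ win); rewrite ge_min lexx => /(_ isT).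
have /md_sq_le wd : sq z (d / 4) w by apply: sq_le win; rewrite ge_min lexx orbT.
apply: (@dif_near _ _ _ _ (d / 2)); first by rewrite divr_gt0.
move=> x xw; apply: fg; have := md_triangle x w z.
by move: wd xw; clear -d0; lra.
Qed.

Lemma holo_contat f z : holo f z -> contat f z.
Proof. by move=> /holo_dif; exact: dif_contat. Qed.

Lemma holo_derive f z : holo f z -> holo (fun w => 'D_1 f w) z.
Proof.
by move=> [d d0 H]; apply: (@deriv_holo R f _ z d) => // w /H; exact: dif_derive.
Qed.

Lemma holo_mk f z : (exists2 d : R, 0 < d & forall w, md (w - z) < d -> dif f w) -> holo f z.
Proof.
move=> [d d0 H]; exists (d / 4); first by rewrite divr_gt0.
by move=> w /md_sq_le wd; apply: H; move: wd; clear -d0; lra.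
Qed.

Lemma holoB f g z : holo f z -> holo g z -> holo (fun w => f w - g w) z.
Proof.
move=> /holo_near[d d0 H] /holo_near[d' d'0 H']; apply: holo_mk.
exists (Num.min d d'); first by rewrite lt_min d0.
by move=> w; rewrite lt_min => /andP[/H/holo_dif h /H'/holo_dif h']; exact: difB.
Qed.

Lemma holoM f g z : holo f z -> holo g z -> holo (fun w => f w * g w) z.
Proof.
move=> /holo_near[d d0 H] /holo_near[d' d'0 H']; apply: holo_mk.
exists (Num.min d d'); first by rewrite lt_min d0.
by move=> w; rewrite lt_min => /andP[/H/holo_dif h /H'/holo_dif h']; exact: difM.
Qed.

Lemma holo_cst c z : holo (fun=> c) z.
Proof. by exists 1 => // w _; exact: dif_cst. Qed.

Lemma holo_id z : holo (fun w => w) z.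
Proof. by exists 1 => // w _; exact: dif_id. Qed.

Lemma holoX f z n : holo f z -> holo (fun w => f w ^+ n) z.
Proof. by move=> [d d0 H]; exists d => // w /H; exact: difX. Qed.

Lemma contat_neq f z a : contat f z -> f z != a ->
  exists2 d : R, 0 < d & forall w, md (w - z) < d -> f w != a.
Proof.
move=> cf fa; have fa0 : 0 < md (f z - a) by rewrite md_gt0 subr_eq0.
have [d d0 H] := cf _ fa0; exists d => // w /H; apply: contraTneq => ->.
by rewrite mdBC ltxx.
Qed.

Lemma holoV f z : holo f z -> f z != 0 -> holo (fun w => (f w)^-1) z.
Proof.
move=> hf fz; have [d d0 H] := holo_near hf.
have [d' d'0 H'] := contat_neq (holo_contat hf) fz; apply: holo_mk.
exists (Num.min d d'); first by rewrite lt_min d0.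
by move=> w; rewrite lt_min => /andP[/H/holo_dif h /H' h']; exact: difV.
Qed.

Lemma holo_comp f g z : holo f z -> holo g (f z) -> holo (fun w => g (f w)) z.
Proof.
move=> hf hg; have [d d0 H] := holo_near hf.
have [d' d'0 H'] := holo_near hg.
have [d2 d20 H2] := holo_contat hf d'0; apply: holo_mk.
exists (Num.min d d2); first by rewrite lt_min d0.
move=> w; rewrite lt_min => /andP[/H/holo_dif h /H2/H'/holo_dif h'].
exact: dif_comp.
Qed.

Lemma shol_finite F z : shol F z -> F z != None ->
  exists H, holo H z /\ exists2 d : R, 0 < d &
    forall w, md (w - z) < d -> F w = Some (H w).
Proof.
move=> [H [hH [d d0 [FH|FH]]]] Fz; first by exists H; split => //; exists d.
have Hz : H z != 0.
  apply: contra_neq Fz => Hz; rewrite FH ?subrr ?md0//= Hz eqxx //.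
have [d' d'0 H'] := contat_neq (holo_contat hH) Hz.
exists (fun w => (H w)^-1); split; first exact: holoV.
exists (Num.min d d'); first by rewrite lt_min d0.
by move=> w; rewrite lt_min => /andP[/FH -> /H' /negbTE h]; rewrite /= h.
Qed.

Lemma shol_sinv F z : shol F z -> shol (fun w => sinv (F w)) z.
Proof.
move=> [H [hH [d d0 h]]]; exists H; split => //; exists d => //.
case: h => h; [right|left] => w wd; rewrite h ?sinvK//.
Qed.

Lemma shol_infinite F z : shol F z -> F z = None ->
  exists H, [/\ holo H z, H z = 0 & exists2 d : R, 0 < d &
    forall w, md (w - z) < d -> F w = sinv (Some (H w))].
Proof.
move=> hF Fz; have [|H [hH [d d0 h]]] := shol_finite (shol_sinv hF); first by rewrite Fz.
have h' w : md (w - z) < d -> F w = sinv (Some (H w)) by move=> /h <-; rewrite sinvK.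
exists H; split => //; last by exists d.
by have := h z; rewrite subrr md0 Fz => /(_ d0)[].
Qed.

Lemma order_ge_modulus H z e F (d : R) p (c : C) : 0 < d ->
  (forall w, md (w - z) < d -> sd (F w) p = sd (Some (H w)) (Some c)) ->
  (0 < e)%N -> order_ge F z p e -> exists K d' : R, 0 < d' /\
    forall w, md (w - z) < d' -> md (H w - c) <= K * md (w - z) ^+ e.
Proof.
move=> d0 FH e0 [K [d' [d'0 h]]].
have K1 : 0 < `|K| + 1 by rewrite ltr_wpDl.
have c1 : 0 < 1 + md c by rewrite ltr_pwDl.
exists ((1 + md c) ^+ 2 * K), (Num.min (Num.min d d') (Num.min 1 ((`|K| + 1) * (1 + md c))^-1)); split.
  by rewrite !lt_min d0 d'0 ltr01 invr_gt0 mulr_gt0.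
move=> w; rewrite !lt_min => /andP[/andP[/FH w1 /h w2] /andP[w3 w4]].
rewrite w1 in w2.
have small : sd (Some (H w)) (Some c) * (1 + md c) <= 1.
  apply: (@le_trans _ _ ((`|K| + 1) * md (w - z) * (1 + md c))); last first.
    by rewrite mulrAC mulrC -ler_pdivlMr ?mulr_gt0// div1r ltW.
  rewrite ler_wpM2r ?(ltW c1)//; apply: le_trans w2 _.
  apply: (@le_trans _ _ ((`|K| + 1) * md (w - z) ^+ e)).
    by rewrite ler_wpM2r ?exprn_ge0// (le_trans (ler_norm _))// lerDl.
  rewrite ler_wpM2l ?(ltW K1)// -[leRHS]expr1 ler_wiXn2l//; exact: ltW.
have [a [Ha] ha] := sd_fin_close small; rewrite -Ha in ha.
by apply: le_trans ha _; rewrite -mulrA ler_wpM2l ?sqr_ge0.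
Qed.

Lemma sd_sinv_oo (p : S) : sd (sinv p) None = sd p (Some 0).
Proof.
have -> : None = sinv (Some 0) :> S by rewrite /= eqxx.
by rewrite sd_sinv.
Qed.

(** The value 0 at the singular points is the limit that the prescribed orders enforce for
    admissible maps. *)
Definition pulled (w l : C) : R :=
  if (w == 0) || (w == 1) then 0 else density w * md l.

Definition speed (F : C -> S) (z : C) : R :=
  if F z is Some w then pulled w ('D_1 (fun x => finite_part (F x)) z) else 0.

Lemma pulled_ge0 w l : 0 <= pulled w l.
Proof. by rewrite /pulled; case: ifP => // _; rewrite mulr_ge0// ltW// density_gt0. Qed.

Lemma speed_ge0 F z : 0 <= speed F z.
Proof. by rewrite /speed; case: (F z) => // w; exact: pulled_ge0. Qed.

Lemma speed_finite F H z l d : 0 < d ->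
  (forall w, md (w - z) < d -> F w = Some (H w)) -> hasd H z l ->
  speed F z = pulled (H z) l.
Proof.
move=> d0 FH hl; rewrite /speed FH ?subrr ?md0//; congr pulled.
apply: hasd_derive; apply: hasd_near hl; apply/nbhs_md; exists d => //.
by move=> w /FH ->.
Qed.

(** If [H] has order [n >= e] at [z], then |H'| ^ 30 is of size m ^ (30 (n - 1)) and |H| ^ j of size
    m ^ (n j), where m = |w - z|; the first exponent is larger as soon as (30 - j) n > 30. The pairs
    (j, e) used are (14, 2), (19, 3) and (29, 31), with (30 - j) e equal to 32, 33 and 31. *)
Lemma deriv_pow30_small H z e j : holo H z -> H z = 0 -> (j <= 30)%N -> (30 < (30 - j) * e)%N ->
  (exists K d : R, 0 < d /\ forall w, md (w - z) < d -> md (H w) <= K * md (w - z) ^+ e) ->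
  forall eps, 0 < eps -> exists2 d : R, 0 < d & forall w, md (w - z) < d -> H w != 0 ->
    md ('D_1 H w) ^+ 30 <= eps * md (H w) ^+ j.
Proof.
move=> hH Hz j30 je [K [d [d0 HK]]] eps eps0.
have [[d1 d10 H0]|[n [k [hk kz Hk]]]] := holo_factor hH.
  by exists d1 => // w /H0 ->; rewrite eqxx.
have kz0 : 0 < md (k z) by rewrite md_gt0.
have [dk dk0 kc] : exists2 dk : R, 0 < dk & forall w, md (w - z) < dk ->
    [/\ md (k z) / 2 <= md (k w), md (k w) <= 2 * md (k z),
        md ('D_1 k w) <= md ('D_1 k z) + 1 & holo k w].
  have [|d1 d10 H1] := holo_contat hk (e := md (k z) / 2); first by rewrite divr_gt0.
  have [d2 d20 H2] := holo_contat (holo_derive hk) ltr01.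
  have [d3 d30 H3] := holo_near hk.
  exists (Num.min d1 (Num.min d2 d3)); first by rewrite !lt_min d10 d20.
  move=> w; rewrite !lt_min => /andP[/H1 h1 /andP[/H2 h2 /H3 h3]]; split => //.
  - by have := mdB (k z) (k w); rewrite (mdBC (k z)); move: h1; clear; lra.
  - by have := mdB (k w) (k z); move: h1 kz0; clear; lra.
  - move: ('D_1 k w) ('D_1 k z) h2 => a b; have := mdB a b; clear; lra.
have n_gt0 : (0 < n)%N.
  case: n Hk => // /(_ z); rewrite Hz expr0 mul1r => h.
  by rewrite -h eqxx in kz.
(* For [n < e] the order bound would give [md (k w) <= (|K| + 1) * m] at points with [m] arbitrarily
   small, against [k z != 0]. *)
have en : (e <= n)%N.
  rewrite leqNgt; apply/negP => ne.
  have K1 : 0 < `|K| + 1 by rewrite ltr_wpDl.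
  pose m := Num.min (Num.min (d / 2) (dk / 2)) (Num.min 1 (md (k z) / 4 / (`|K| + 1))).
  have m0 : 0 < m by rewrite !lt_min ltr01 !divr_gt0.
  have : m <= m by [].
  rewrite {2}/m !le_min => /andP[/andP[m1 m2] /andP[m3 m4]]; clearbody m.
  pose w := z + mkC m 0.
  have wz : md (w - z) = m by rewrite /w addrAC subrr add0r md_mkC0 gtr0_norm.
  have h1 : md (H w) <= K * m ^+ e.
    by have := HK w; rewrite wz; apply; move: m1 d0; clear; lra.
  have [|h2 _ _ _] := kc w; first by rewrite wz; move: m2 dk0; clear; lra.
  rewrite Hk mdM mdX wz in h1.
  have mn : 0 < m ^+ n by rewrite exprn_gt0.
  have h3 : md (k w) * m ^+ n <= ((`|K| + 1) * m) * m ^+ n.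
    rewrite mulrC; apply: le_trans h1 _; rewrite -mulrA -exprS.
    apply: (@le_trans _ _ ((`|K| + 1) * m ^+ e)).
      rewrite ler_wpM2r ?exprn_ge0 ?(ltW m0)//.
      by rewrite (le_trans (ler_norm _))// lerDl.
    by rewrite ler_wpM2l ?(ltW K1)// ler_wiXn2l// ltW.
  rewrite ler_pM2r// in h3.
  rewrite ler_pdivlMr// mulrC in m4.
  by move: h2 h3 m4 kz0; clear; lra.
pose A := n%:R * (2 * md (k z)) + (md ('D_1 k z) + 1).
pose B := md (k z) / 2.
have A0 : 0 < A by rewrite ltr_wpDr// ?mulr_ge0// ?mulr_gt0// ?ltr0n// addr_ge0.
have B0 : 0 < B by rewrite divr_gt0.
exists (Num.min dk (Num.min 1 (eps * B ^+ j / A ^+ 30))).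
  by rewrite !lt_min dk0 ltr01 divr_gt0 ?mulr_gt0 ?exprn_gt0.
move=> w; rewrite !lt_min => /andP[/kc[w1 w2 w3 w4] /andP[w5 w6]] _.
set m := md (w - z) in w5 w6 *; have m0 : 0 <= m by exact: md_ge0.
have dH : 'D_1 H w = n%:R * (w - z) ^+ n.-1 * k w + (w - z) ^+ n * 'D_1 k w.
  apply: hasd_derive.
  have h1 : hasd (fun x => x - z) w (1 - 0) by apply: hasdB; [exact: hasd_id|exact: hasd_cst].
  have := hasdM (hasdX n h1) (dif_derive (holo_dif w4)).
  rewrite subr0 mulr1 => h2.
  have -> : H = (fun w => (w - z) ^+ n * k w) by apply/funext => x; exact: Hk.
  by rewrite addrC (mulrC _ (k w)).
have h1 : md ('D_1 H w) <= A * m ^+ n.-1.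
  rewrite dH; apply: le_trans (mdD _ _) _; rewrite /A mulrDl; apply: lerD.
    have mn : md (n%:R : C) = n%:R.
      have -> : (n%:R : C) = mkC n%:R 0.
        elim: (n) => [|p ih]; first by [].
        by rewrite -!natr1 ih; apply: eqC; rewrite !reimE ?addr0.
      by rewrite md_mkC0 ger0_norm.
    by rewrite !mdM mn mdX -/m mulrAC ler_wpM2r ?exprn_ge0// ler_wpM2l.
  rewrite mdM mdX -/m mulrC; apply: ler_pM => //; first by rewrite exprn_ge0.
  by rewrite ler_wiXn2l ?(ltW w5)// leq_pred.
have h2 : B * m ^+ n <= md (H w).
  by rewrite Hk mdM mdX -/m mulrC ler_wpM2l ?exprn_ge0.
have h3 : md ('D_1 H w) ^+ 30 <= A ^+ 30 * m ^+ (n.-1 * 30).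
  rewrite exprM -exprMn lerXn2r ?nnegrE ?mulr_ge0 ?exprn_ge0//.
  exact: ltW.
have h4 : B ^+ j * m ^+ (n * j) <= md (H w) ^+ j.
  rewrite exprM -exprMn lerXn2r ?nnegrE ?mulr_ge0 ?exprn_ge0//.
apply: le_trans h3 _; apply: le_trans (ler_wpM2l (ltW eps0) h4).
(* One spare power of [m] absorbs all constants and [eps]. *)
have ex : (n * j + 1 <= n.-1 * 30)%N.
  have : (30 < (30 - j) * n)%N by apply: leq_trans je _; rewrite leq_mul2l en orbT.
  clear - n_gt0 j30; case: n n_gt0 => // n _; nia.
apply: (@le_trans _ _ (A ^+ 30 * (m * m ^+ (n * j)))).
  rewrite ler_wpM2l ?exprn_ge0 ?(ltW A0)// -exprS.
  by rewrite ler_wiXn2l// ?(ltW w5)// -addn1.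
rewrite mulrA mulrA ler_wpM2r ?exprn_ge0//.
by rewrite mulrC -ler_pdivlMr ?exprn_gt0// ltW.
Qed.


Definition contR (u : C -> R) (z : C) := forall e, 0 < e ->
  exists2 d : R, 0 < d & forall w, md (w - z) < d -> `|u w - u z| < e.

Lemma contRE u z : contR u z <-> {for z, continuous u}.
Proof.
split => [H|].
  have := (@cvgrPdist_lt _ _ _ (nbhs z) _ u (u z)).2; apply => e e0.
  have [d d0 h] := H e e0; apply: (nbhs_md z _).2; exists d => // w /h.
  by rewrite distrC.
have := (@cvgrPdist_lt _ _ _ (nbhs z) _ u (u z)).1 => /[apply] H e e0.
have /nbhs_md[d d0 h] := H e e0; exists d => // w /h.
by rewrite distrC.
Qed.

Lemma contR_md f z : contat f z -> {for z, continuous (fun w => md (f w))}.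
Proof.
move=> cf; apply/contRE => e /cf[d d0 h]; exists d => // w /h.
apply: le_lt_trans; rewrite ler_norml; apply/andP; split.
  by have := mdB (f z) (f w); rewrite (mdBC (f z)); lra.
exact: mdB.
Qed.

Lemma contat_subc f z (c : C) : contat f z -> contat (fun w => f w - c) z.
Proof.
move=> cf e /cf[d d0 h]; exists d => // w /h.
by rewrite opprB addrA subrK.
Qed.

Lemma contR_near u v z d : 0 < d -> (forall w, md (w - z) < d -> u w = v w) ->
  contR u z -> contR v z.
Proof.
move=> d0 uv H e /H[d' d'0 h]; exists (Num.min d d'); first by rewrite lt_min d0.
by move=> w; rewrite lt_min => /andP[wd /h]; rewrite !uv// subrr md0.
Qed.

Lemma continuous_root30 (x : R) : 0 < x -> {for x, continuous (@root30 R)}.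
Proof.
move=> x0; rewrite /root30; apply: continuous_comp; last exact: continuous_expR.
by apply: continuousM; [exact: cvg_cst|exact: continuous_ln].
Qed.

Lemma contR_density f z : contat f z -> f z != 0 -> f z != 1 ->
  {for z, continuous (fun w => density (f w))}.
Proof.
move=> cf f0 f1.
have h1 : {for z, continuous (fun w => root30 (md (f w)))}.
  apply: (@continuous_comp _ _ _ (fun w => md (f w)) (@root30 R)).
    exact: contR_md.
  by apply: continuous_root30; rewrite md_gt0.
have h2 : {for z, continuous (fun w => root30 (md (f w - 1)))}.
  apply: (@continuous_comp _ _ _ (fun w => md (f w - 1)) (@root30 R)).
    by apply: contR_md; exact: contat_subc.
  by apply: continuous_root30; rewrite md_gt0 subr_eq0.
have pw (u : C -> R) n : {for z, continuous u} -> {for z, continuous (fun w => u w ^+ n)}.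
  move=> cu; elim: n => [|n ih].
    have -> : (fun w => u w ^+ 0) = cst 1 by apply/funext.
    by apply/contRE => e e0; exists 1 => // w _; rewrite /= subrr normr0.
  have -> : (fun w => u w ^+ n.+1) = (fun w => u w * u w ^+ n).
    by apply/funext => w; rewrite exprS.
  exact: continuousM.
have cst1 : {for z, continuous (fun=> 1 : R)}.
  by apply/contRE => e e0; exists 1 => // w _; rewrite /= subrr normr0.
rewrite /density /metric.
apply: continuousM.
  by apply: continuousM; [exact: continuousD cst1 h1|exact: continuousD cst1 h2].
apply: continuousV; first by rewrite mulf_neq0// expf_neq0// gt_eqF// root30_gt0.
by apply: continuousM; exact: pw.
Qed.

Lemma speed_near F H z d : 0 < d -> (forall w, md (w - z) < d -> F w = Some (H w)) ->
  holo H z -> exists2 d' : R, 0 < d' &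
  forall w, md (w - z) < d' -> speed F w = pulled (H w) ('D_1 H w).
Proof.
move=> d0 FH hH; have [d1 d10 h1] := holo_near hH.
exists (Num.min (d / 2) d1); first by rewrite lt_min d10 divr_gt0.
move=> w; rewrite lt_min => /andP[wd /h1 hw].
apply: (@speed_finite _ _ _ _ (d / 2)); first by rewrite divr_gt0.
  move=> x xw; apply: FH; have := md_triangle x w z; move: wd xw; clear; lra.
by apply: dif_derive; exact: holo_dif.
Qed.

Lemma contR_small u z : u z = 0 -> (forall w, 0 <= u w) ->
  (forall e, 0 < e -> exists2 d : R, 0 < d & forall w, md (w - z) < d -> u w < e) ->
  contR u z.
Proof.
move=> uz u0 H e /H[d d0 h]; exists d => // w /h.
by rewrite uz subr0 ger0_norm.
Qed.

Lemma lt_pow30 (a b : R) : 0 <= a -> 0 < b -> a ^+ 30 < b ^+ 30 -> a < b.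
Proof. by move=> a0 b0; rewrite ltr_pXn2r// nnegrE ltW. Qed.

(* With j as in deriv_pow30_small, a bound of the metric by [|H| ^ (-j/30)] makes the
   pulled back metric tend to 0. *)
Lemma speed_tends0 (v : C -> R) H z j (K d : R) : 0 < K -> 0 < d ->
  (forall eps, 0 < eps -> exists2 d : R, 0 < d & forall w, md (w - z) < d -> H w != 0 ->
    md ('D_1 H w) ^+ 30 <= eps * md (H w) ^+ j) ->
  (forall w, md (w - z) < d -> 0 <= v w) ->
  (forall w, md (w - z) < d -> v w != 0 -> H w != 0 /\
     v w <= K / root30 (md (H w)) ^+ j * md ('D_1 H w)) ->
  forall e, 0 < e -> exists2 d : R, 0 < d & forall w, md (w - z) < d -> v w < e.
Proof.
move=> K0 d0 hH v0 vK e e0.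
have [|d1 d10 h1] := hH ((e / 2) ^+ 30 / K ^+ 30).
  by rewrite divr_gt0 ?exprn_gt0// divr_gt0.
exists (Num.min d d1); first by rewrite lt_min d0.
move=> w; rewrite lt_min => /andP[wd wd1].
have [->//|vw] := eqVneq (v w) 0.
have [Hw hv] := vK w wd vw.
have Hw0 : 0 < md (H w) by rewrite md_gt0.
apply: lt_pow30 => //; first exact: v0.
apply: (@le_lt_trans _ _ ((e / 2) ^+ 30)); last first.
  by rewrite ltr_pXn2r ?nnegrE ?divr_ge0 ?(ltW e0)//; move: e0; clear; lra.
apply: (@le_trans _ _ ((K / root30 (md (H w)) ^+ j * md ('D_1 H w)) ^+ 30)).
  rewrite lerXn2r ?nnegrE ?v0// mulr_ge0// divr_ge0 ?(ltW K0)// exprn_ge0//.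
  exact: ltW (root30_gt0 _).
rewrite !exprMn exprVn -[(_ ^+ j) ^+ 30]exprM mulnC exprM root30K//.
rewrite -mulrA [X in _ * X]mulrC mulrA ler_pdivrMr ?exprn_gt0//.
rewrite mulrC -ler_pdivlMr ?exprn_gt0//.
by have := h1 w wd1 Hw; rewrite exprMn mulrAC.
Qed.

Lemma order_ge_self F z p e : order_ge F z p e -> (0 < e)%N -> F z = p.
Proof.
move=> [K [d [d0 h]]] e0; have := h z; rewrite subrr md0 expr0n gtn_eqF// mulr0.
move=> /(_ d0) h0.
have s0 : sd (F z) p = 0 by apply/le_anti; rewrite h0 sd_ge0.
have := sd_ge0 (F z) p; move: s0; rewrite /sd => s0 _.
have a0 := normr_ge0 (stx (F z) - stx p); have b0 := normr_ge0 (sty (F z) - sty p).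
have c0 := normr_ge0 (stt (F z) - stt p).
apply: st_inj; apply/eqP; rewrite -subr_eq0 -normr_eq0; apply/eqP; move: s0 a0 b0 c0; clear; lra.
Qed.

Lemma density_pulled w l : w != 0 -> w != 1 -> pulled w l = density w * md l.
Proof. by rewrite /pulled => /negbTE -> /negbTE ->. Qed.

Lemma root30V (x : R) : 0 < x -> root30 x^-1 = (root30 x)^-1.
Proof. by move=> x0; rewrite /root30 lnV ?posrE// mulrN expRN. Qed.

Lemma root30_le_half (x : R) : 0 < x -> x <= 2^-1 ^+ 30 -> root30 x <= 2^-1.
Proof.
move=> x0 hx; apply: le_pow30 => //; first exact: ltW (root30_gt0 _).
by rewrite root30K.
Qed.

Lemma contat_small H z (e : R) : contat H z -> H z = 0 -> 0 < e ->
  exists2 d : R, 0 < d & forall w, md (w - z) < d -> md (H w) <= e.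
Proof.
by move=> cH Hz /cH[d d0 h]; exists d => // w /h; rewrite Hz subr0 => /ltW.
Qed.

(** The orders of an admissible map serve here: at the values infinity, 0 and 1 they make the speed
    tend to 0, which is its value by definition. Elsewhere it is a product of continuous
    functions. *)
Lemma speed_contR F z : admissible F z -> contR (speed F) z.
Proof.
move=> [hF F0 Foo F1].
have h30 : 0 < (2^-1 : R) ^+ 30 by rewrite exprn_gt0// invr_gt0.
have [Fz|Fz] := eqVneq (F z) None.
  have [H [hH Hz [d d0 FH]]] := shol_infinite hF Fz.
  have OH : exists K d' : R, 0 < d' /\
    forall w, md (w - z) < d' -> md (H w) <= K * md (w - z) ^+ 3.
    have [|K [d' [d'0 h]]] := @order_ge_modulus H z 3 F d None 0 d0 _ isT (Foo Fz).
      by move=> w /FH ->; exact: sd_sinv_oo.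
    by exists K, d'; split => // w /h; rewrite subr0.
  have [d1 d10 h1] := holo_near hH.
  have [d2 d20 hs] := contat_small (holo_contat hH) Hz h30.
  apply: contR_small; [by rewrite /speed Fz|exact: speed_ge0|].
  apply: (@speed_tends0 _ H z 19 (6 * 2 ^+ 28) (Num.min (d / 2) (Num.min d1 d2))) => //.
  - by rewrite !lt_min divr_gt0// d10.
  - exact: (deriv_pow30_small hH Hz _ _ OH).
  - by move=> w _; exact: speed_ge0.
  move=> w; rewrite !lt_min => /andP[wd /andP[wd1 wd2]].
  have wd' : md (w - z) < d by move: wd d0; clear; lra.
  have [Hw|Hw] := eqVneq (H w) 0.
    by rewrite /speed FH//= Hw eqxx eqxx.
  have hw := h1 w wd1.
  have [d3 d30 h3] := contat_neq (holo_contat hw) Hw.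
  have -> : speed F w = pulled (H w)^-1 (- (H w)^-2 * 'D_1 H w).
    apply: (@speed_finite _ (fun w => (H w)^-1) _ _ (Num.min (d / 2) d3)).
    - by rewrite lt_min divr_gt0.
    - move=> x; rewrite lt_min => /andP[xw /h3/negbTE Hx].
      rewrite FH /= ?Hx//; have := md_triangle x w z; move: wd xw; clear; lra.
    - by apply: hasdV => //; apply: dif_derive; exact: holo_dif.
  rewrite {1}/pulled; case: ifPn; first by rewrite eqxx.
  rewrite negb_or => /andP[w0 w1] _; split => //.
  rewrite density_pulled//.
  have [r1 r2 r3] := density_roots w0 w1.
  have Hw0 : 0 < md (H w) by rewrite md_gt0.
  set u := root30 (md (H w)).
  have u0 : 0 < u by exact: root30_gt0.
  have tu : root30 (md (H w)^-1) = u^-1 by rewrite mdV root30V.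
  have u2 : u <= 2^-1 by apply: root30_le_half => //; exact: hs.
  have t2 : 2 <= u^-1 by rewrite -[2]invrK lef_pV2 ?posrE ?invr_gt0.
  rewrite /density tu in r1 r2 r3 *.
  have := metric_atoo t2 (root30_gt0 _) r2 => h.
  rewrite mdM mdN mdV mdX -[md (H w) in X in _ * X](root30K Hw0) -/u.
  (* The derivative of 1 / H brings |H| ^ (-2) = [u ^- 60], and 60 - 41 = 19 is the exponent
     announced above. *)
  apply: (@le_trans _ _ (6 * 2 ^+ 28 / u^-1 ^+ 41 * (((u ^+ 30) ^+ 2)^-1 * md ('D_1 H w)))).
    by rewrite ler_wpM2r// mulr_ge0// invr_ge0 exprn_ge0// exprn_ge0// ltW.
  rewrite le_eqVlt; apply/orP; left; apply/eqP; field.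
  by rewrite gt_eqF.
have [H [hH [d d0 FH]]] := shol_finite hF Fz.
have [d1 d10 sH] := speed_near d0 FH hH.
have sz : speed F z = pulled (H z) ('D_1 H z) by apply: sH; rewrite subrr md0.
have [Hz|Hz] := eqVneq (H z) 0.
  have Fz0 : F z = Some 0 by rewrite FH ?subrr ?md0// Hz.
  have OH : exists K d' : R, 0 < d' /\
    forall w, md (w - z) < d' -> md (H w) <= K * md (w - z) ^+ 2.
    have [|K [d' [d'0 h]]] := @order_ge_modulus H z 2 F d (Some 0) 0 d0 _ isT (F0 Fz0).
      by move=> w /FH ->.
    by exists K, d'; split => // w /h; rewrite subr0.
  have [d2 d20 hs] := contat_small (holo_contat hH) Hz h30.
  apply: contR_small; [by rewrite sz /pulled Hz eqxx|exact: speed_ge0|].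
  apply: (@speed_tends0 _ H z 14 (6 * 2 ^+ 29) (Num.min d1 d2)) => //.
  - by rewrite lt_min d10.
  - exact: (deriv_pow30_small hH Hz _ _ OH).
  - by move=> w _; exact: speed_ge0.
  move=> w; rewrite lt_min => /andP[wd1 wd2]; rewrite sH//.
  rewrite {1}/pulled; case: ifPn; first by rewrite eqxx.
  rewrite negb_or => /andP[w0 w1] _; split => //.
  rewrite density_pulled// ler_wpM2r//.
  have [r1 r2 r3] := density_roots w0 w1.
  apply: metric_at0 => //; try exact: root30_gt0.
  by apply: root30_le_half; rewrite ?md_gt0//; exact: hs.
have [Hz1|Hz1] := eqVneq (H z) 1.
  have Fz1 : F z = Some 1 by rewrite FH ?subrr ?md0// Hz1.
  have hH1 : holo (fun w => H w - 1) z by apply: holoB => //; exact: holo_cst.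
  have OH : exists K d' : R, 0 < d' /\
    forall w, md (w - z) < d' -> md (H w - 1) <= K * md (w - z) ^+ 31.
    by apply: (@order_ge_modulus H z 31 F d (Some 1) 1) => //; [move=> w /FH ->|exact: F1].
  have [d2 d20 hs] := contat_small (holo_contat hH1) ltac:(by rewrite /= Hz1 subrr) h30.
  have [d3 d30 h3] := holo_near hH.
  have DH w : md (w - z) < d3 -> 'D_1 (fun w => H w - 1) w = 'D_1 H w.
    move=> /h3/holo_dif/dif_derive hw; apply: hasd_derive.
    by rewrite -[X in hasd _ _ X]subr0; apply: hasdB => //; exact: hasd_cst.
  apply: contR_small; [by rewrite sz /pulled Hz1 eqxx orbT|exact: speed_ge0|].
  apply: (@speed_tends0 _ (fun w => H w - 1) z 29 (6 * 2 ^+ 14) (Num.min d3 (Num.min d1 d2))) => //.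
  - by rewrite !lt_min d30 d10.
  - by apply: (@deriv_pow30_small _ z 31 29) => //; rewrite Hz1 subrr.
  - by move=> w _; exact: speed_ge0.
  move=> w; rewrite !lt_min => /andP[wd3 /andP[wd1 wd2]]; rewrite sH// DH//.
  rewrite {1}/pulled; case: ifPn; first by rewrite eqxx.
  rewrite negb_or => /andP[w0 w1] _; split; first by rewrite subr_eq0.
  rewrite density_pulled// ler_wpM2r//.
  have [r1 r2 r3] := density_roots w0 w1.
  apply: metric_at1 => //; try exact: root30_gt0.
  by apply: root30_le_half; rewrite ?md_gt0 ?subr_eq0//; exact: hs.
have [d2 d20 h0] := contat_neq (holo_contat hH) Hz.
have [d3 d30 h1] := contat_neq (holo_contat hH) Hz1.
apply: (@contR_near (fun w => density (H w) * md ('D_1 H w)) _ _ (Num.min d1 (Num.min d2 d3))).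
- by rewrite !lt_min d10 d20.
- move=> w; rewrite !lt_min => /andP[wd1 /andP[wd2 wd3]].
  by rewrite (sH w wd1) (density_pulled _ (h0 w wd2) (h1 w wd3)).
apply/contRE; apply: continuousM; first by apply: contR_density => //; exact: holo_contat.
by apply: contR_md; apply: holo_contat; exact: holo_derive.
Qed.

End SphereMaps.

(** * The Ahlfors-Schwarz bound and the uniform Lipschitz estimate *)

Section AhlforsSchwarz.
Variable R : realType.
Local Notation C := (Cplane R).
Local Notation S := (sphere R).
Local Notation md := (@modulus R).
Implicit Types (f g H : C -> C) (F : C -> S) (z w : C).

(** For harmonic u the quarter Laplacian of phi (u) is phi'' (u) |a| ^ 2 / 4; the factor 1/30 in the
    exponent, squared, turns 4 into 3600. This is the source of the negative curvature. *)
Lemma E2_softplus (u : C -> R) z a : E2 u z a 0 -> let t := expR (30^-1 * u z) in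
  exists a', E2 (fun w => ln (1 + expR (30^-1 * u w))) z a'
    (t / (3600 * (1 + t) ^+ 2) * md a ^+ 2).
Proof.
move=> hu t; have t0 : 0 < t by exact: expR_gt0.
have t1 : 0 < 1 + t by rewrite ltr_pwDl// ltW.
have h1 := E2_comp (E2Z 30^-1 hu) (expansion2_exp (30^-1 * u z)).
have h2 := E2_comp (E2D (E2_cst 1 z) h1) (expansion2_ln t1).
eexists; move: h2; congr E2.
rewrite -/t !add0r !mulr0 !add0r (mdM (mkC t 0)) !(mdM (mkC 30^-1 0)) !md_mkC0.
rewrite (ger0_norm (ltW t0)) ger0_norm ?invr_ge0//.
by field; rewrite gt_eqF.
Qed.

Lemma ln_metric (t s : R) : 0 < t -> 0 < s ->
  ln (metric t s) = ln (1 + t) + ln (1 + s) + (- 14%:R * ln t + - 29%:R * ln s).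
Proof.
move=> t0 s0.
have t1 : 0 < 1 + t by rewrite ltr_pwDl// ltW.
have s1 : 0 < 1 + s by rewrite ltr_pwDl// ltW.
rewrite /metric ln_div ?posrE ?mulr_gt0 ?exprn_gt0//.
rewrite lnM ?posrE// lnM ?posrE ?exprn_gt0// lnXn// lnXn//.
by rewrite opprD -(mulr_natl (ln t) 14) -(mulr_natl (ln s) 29) !mulNr.
Qed.

(** The logarithm is a sum of two terms handled by [E2_softplus] and of multiples of ln |H|, ln |H -
    1| and ln |H'|, which are harmonic here. The powers 60 are |H| ^ 2 and |H - 1| ^ 2. *)
Lemma E2_lnpulled H z l : holo H z -> hasd H z l -> H z != 0 -> H z != 1 -> l != 0 ->
  let t := root30 (md (H z)) in let s := root30 (md (H z - 1)) in
  exists a, E2 (fun w => ln (density (H w) * md ('D_1 H w))) z a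
   (md l ^+ 2 / 3600 * (t / (t ^+ 60 * (1 + t) ^+ 2) + s / (s ^+ 60 * (1 + s) ^+ 2))).
Proof.
move=> hH hl H0 H1 l0 t s.
have t0 : 0 < t by exact: root30_gt0.
have s0 : 0 < s by exact: root30_gt0.
have hH1 : holo (fun w => H w - 1) z by apply: holoB => //; exact: holo_cst.
have hl1 : hasd (fun w => H w - 1) z l.
  by rewrite -[l]subr0; apply: hasdB => //; exact: hasd_cst.
have hD := holo_derive hH.
have Dz : 'D_1 H z = l by exact: hasd_derive.
have u1 := E2_lnmd hH hl H0.
have H10 : H z - 1 != 0 by rewrite subr_eq0.
have u2 := E2_lnmd hH1 hl1 H10.
have D0 : 'D_1 H z != 0 by rewrite Dz.
have u3 := E2_lnmd hD (dif_derive (holo_dif hD)) D0.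
have [a1 v1] := E2_softplus u1.
have [a2 v2] := E2_softplus u2.
have w1 := E2Z (- 14%:R / 30) u1.
have w2 := E2Z (- 29%:R / 30) u2.
have [d1 d10 h1] := contat_neq (holo_contat hH) H0.
have [d2 d20 h2] := contat_neq (holo_contat hH) H1.
have [d3 d30 h3] := contat_neq (holo_contat hD) D0.
have zh (h : C) : z + h - z = h by rewrite addrAC subrr add0r.
have E := E2D (E2D (E2D v1 v2) (E2D w1 w2)) u3.
eexists; apply: (@E2_near R _ _ _ _ _ (Num.min d1 (Num.min d2 d3))); last first.
- move: E; rewrite /= -/(root30 _) -/t -/(root30 _) -/s; congr E2.
  have e1 : md (l / H z) ^+ 2 = md l ^+ 2 / t ^+ 60.
    by rewrite mdM mdV exprMn exprVn (exprM t 30 2) root30K ?md_gt0.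
  have e2 : md (l / (H z - 1)) ^+ 2 = md l ^+ 2 / s ^+ 60.
    by rewrite mdM mdV exprMn exprVn (exprM s 30 2) root30K ?md_gt0.
  rewrite e1 e2 !mulr0 !addr0; move: (md l) => L.
  have t1 : 1 + t != 0 by rewrite gt_eqF// ltr_pwDl// ltW.
  have s1 : 1 + s != 0 by rewrite gt_eqF// ltr_pwDl// ltW.
  by clear -t0 s0 t1 s1; field; rewrite t1 s1 !gt_eqF.
- move=> h; rewrite !lt_min => /andP[hd1 /andP[hd2 hd3]].
  have k1 : H (z + h) != 0 by apply: h1; rewrite zh.
  have k2 : H (z + h) != 1 by apply: h2; rewrite zh.
  have k3 : 'D_1 H (z + h) != 0 by apply: h3; rewrite zh.
  rewrite (lnM (x := density _)) ?posrE ?density_gt0 ?md_gt0//.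
  rewrite /density ln_metric; try exact: root30_gt0.
  by rewrite /root30 !expRK; field.
- by rewrite !lt_min d10 d20.
Qed.

Lemma speed_gt0_finite F z : shol F z -> 0 < speed F z ->
  exists H, [/\ holo H z, H z != 0, H z != 1, 'D_1 H z != 0 & exists2 d : R, 0 < d &
    forall w, md (w - z) < d -> speed F w = density (H w) * md ('D_1 H w)].
Proof.
move=> hF v0; have [|H [hH [d d0 FH]]] := shol_finite hF.
  by apply: contraTneq v0 => Fz; rewrite /speed Fz ltxx.
have [d1 d10 sH] := speed_near d0 FH hH.
have sz : speed F z = pulled (H z) ('D_1 H z) by apply: sH; rewrite subrr md0.
move: v0; rewrite sz /pulled; case: ifPn; first by rewrite ltxx.
rewrite negb_or => /andP[H0 H1] v0.
have [d2 d20 h0] := contat_neq (holo_contat hH) H0.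
have [d3 d30 h1] := contat_neq (holo_contat hH) H1.
exists H; split => //.
  by apply: contraTneq v0 => ->; rewrite md0 mulr0 ltxx.
exists (Num.min d1 (Num.min d2 d3)); first by rewrite !lt_min d10 d20.
move=> w; rewrite !lt_min => /andP[wd1 /andP[wd2 wd3]].
by rewrite (sH w wd1) (density_pulled _ (h0 w wd2) (h1 w wd3)).
Qed.

Lemma contR_weight (r : R) z : {for z, continuous (fun w => Num.max 0 (r ^+ 2 - md w ^+ 2))}.
Proof.
have cm : {for z, continuous (fun w => md w)}.
  by apply: contR_md; apply: dif_contat; exact: dif_id.
apply: (@continuous_comp _ _ _ (fun w => md w) (fun x => Num.max 0 (r ^+ 2 - x ^+ 2))) => //.
have c0 : {for md z, continuous (fun=> 0 : R)} by exact: cvg_cst.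
apply: (@continuous_max _ _ (fun=> 0 : R)) => //.
apply: continuousB; first exact: cvg_cst.
exact: exprn_continuous.
Qed.

Lemma ln_le_add (a b c d : R) : 0 < a -> 0 < b -> 0 < c -> 0 < d -> a * b <= c * d ->
  ln a + ln b <= ln c + ln d.
Proof.
by move=> a0 b0 c0 d0 h; rewrite -!lnM ?posrE// ler_ln ?posrE// mulr_gt0.
Qed.

(** At an interior maximum of [speed F z * (r ^+ 2 - md z ^+ 2)] the Laplacian of the logarithm is
    at most 0. The curvature bound for the metric and the exact curvature of the disc then bound the
    product at the maximum, hence everywhere; 60 and [2 ^+ 35] are the square roots of 3600 and
    [2 ^+ 70]. *)
Lemma speed_bound F (r r' : R) : 0 < r -> r < r' ->
  (forall z, md z < r' -> admissible F z) ->
  forall z, md z < r -> speed F z * (r ^+ 2 - md z ^+ 2) <= 60 * 2 ^+ 35 * r.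
Proof.
move=> r0 rr adm.
(* Truncating the weight at 0 makes [W] vanish outside the disc and continuous on the whole plane,
   although the speed is controlled only for [md z < r']. *)
pose W z := speed F z * Num.max 0 (r ^+ 2 - md z ^+ 2).
have X0 z : md z < r -> 0 < r ^+ 2 - md z ^+ 2.
  by move=> zr; rewrite subr_gt0 ltrXn2r ?nnegrE// ltW.
have W0 z : r <= md z -> W z = 0.
  move=> zr; rewrite /W max_l ?mulr0// subr_le0 lerXn2r ?nnegrE//; exact: ltW.
have cW z : contR W z.
  have [zr|zr] := ltP (md z) r'.
    apply/contRE; apply: continuousM; last exact: contR_weight.
    by apply/contRE; apply: speed_contR; exact: adm.
  apply: (@contR_near R (fun=> 0) _ _ (r' - r)); rewrite ?subr_gt0//.
    move=> w wz; rewrite W0//; have := mdB z w; rewrite (mdBC z); move: wz zr; clear; lra.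
  by move=> e e0; exists 1 => // w _; rewrite subrr normr0.
pose f (p : R * R) := W (mkC p.1 p.2).
have cf : continuous f.
  move=> p; apply: (@continuous_comp _ _ _ (fun q : R * R => mkC q.1 q.2 : C) W); last first.
    by apply/contRE; exact: cW.
  move=> U /nbhs_md[d d0 h].
  exists (ball p.1 (d / 2), ball p.2 (d / 2)).
    by split; apply: nbhsx_ballx; rewrite divr_gt0.
  move=> [q1 q2] [/= b1 b2]; apply: h => /=; apply: le_lt_trans (md_le_reim _) _.
  rewrite !reimE; move: b1 b2; rewrite /ball /= => b1 b2.
  by rewrite (distrC q1) (distrC q2) [d]splitr ltrD.
(* The maximum is taken over a square containing the disc; where it is positive, the point lies in
   the open disc. *)
have [] := @compact_EVT_max (R * R)%type R f (`[- r, r] `*` `[- r, r]).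
- by exists (0, 0); split; rewrite /= in_itv /= oppr_le0 (ltW r0).
- by apply: compact_setX; exact: segment_compact.
- exact: continuous_subspaceT.
move=> [x y] _ Hmax.
pose z0 := mkC x y : C.
have {}Hmax z : md z < r -> W z <= W z0.
  move=> zr; have := Hmax (re z, im z); rewrite /f /= mkC_eta; apply.
  rewrite inE /= !in_itv /= -!ler_norml.
  by rewrite (le_trans (re_le_md _) (ltW zr)) (le_trans (im_le_md _) (ltW zr)).
have WE z : md z < r -> speed F z * (r ^+ 2 - md z ^+ 2) = W z.
  by move=> /X0/ltW h; rewrite /W max_r.
move=> z zr; rewrite WE//; apply: le_trans (Hmax z zr) _.
have K0 : 0 <= 60 * 2 ^+ 35 * r by rewrite !mulr_ge0 ?exprn_ge0// ltW.
have [h|Wz0] := leP (W z0) 0; first exact: le_trans h K0.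
have z0r : md z0 < r by rewrite ltNge; apply/negP => /W0 h; rewrite h ltxx in Wz0.
have v0 : 0 < speed F z0.
  rewrite lt_def speed_ge0 andbT; apply/eqP => h.
  by move: Wz0; rewrite /W h mul0r ltxx.
have adm0 : admissible F z0 by apply: adm; exact: lt_trans rr.
have [H [hH H0 H1 D0 [d d0 sH]]] := speed_gt0_finite (let: And4 h _ _ _ := adm0 in h) v0.
have [a E] := E2_lnpulled hH (dif_derive (holo_dif hH)) H0 H1 D0.
have E' := E2D E (E2_lndisk z0r).
set t := root30 (md (H z0)) in E'; set s := root30 (md (H z0 - 1)) in E'.
have t0 : 0 < t by exact: root30_gt0.
have s0 : 0 < s by exact: root30_gt0.
have szE : speed F z0 = density (H z0) * md ('D_1 H z0) by apply: sH; rewrite subrr md0.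
have A0 : 0 < density (H z0) * md ('D_1 H z0).
  by apply: mulr_gt0; [exact: density_gt0|rewrite md_gt0].
have [d1 d10 k1] := contat_neq (holo_contat (holo_derive hH)) D0.
set l := 'D_1 H z0 in D0 E'.
set X := r ^+ 2 - md z0 ^+ 2 in E'.
have Xp : 0 < X by exact: X0.
have rd : 0 < r - md z0 by rewrite subr_gt0.
have := E2_max E'.
have zh (h : C) : z0 + h - z0 = h by rewrite addrAC subrr add0r.
have loc : exists2 d, 0 < d & forall h, md h < d ->
   ln (density (H (z0 + h)) * md ('D_1 H (z0 + h))) + ln (r ^+ 2 - md (z0 + h) ^+ 2) <=
   ln (density (H z0) * md ('D_1 H z0)) + ln (r ^+ 2 - md z0 ^+ 2).
  exists (Num.min d (Num.min d1 (r - md z0))); first by rewrite !lt_min d0 d10.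
  move=> h; rewrite !lt_min => /andP[hd /andP[hd1 hr]].
  have zhr : md (z0 + h) < r by apply: le_lt_trans (mdD _ _) _; move: hr; clear; lra.
  have D1 : 'D_1 H (z0 + h) != 0 by apply: k1; rewrite zh.
  apply: ln_le_add; [| exact: X0| |exact: X0|].
  - by apply: mulr_gt0; [exact: density_gt0|rewrite md_gt0].
  - exact: A0.
  - have := Hmax _ zhr; rewrite -(WE _ zhr) -(WE _ z0r) szE.
    by have -> : speed F (z0 + h) = density (H (z0 + h)) * md ('D_1 H (z0 + h)) by apply: sH; rewrite zh.
move=> /(_ loc) {E E' loc Hmax cW cf W0 adm}.
(* [C1]: at the maximum the curvature term of the pulled back metric is at most [r ^+ 2 / X ^+ 2],
   that of the disc. *)
rewrite mulNr subr_le0 => C1.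
have [r1 r2 r3] := density_roots H0 H1.
have C2 := metric_curvature t0 s0 r1 r3.
have L0 : 0 < md l by rewrite md_gt0.
set m := metric t s in C2.
have m0 : 0 < m by exact: metric_gt0.
have C3 : 2 ^- 70 * m ^+ 2 <= t / (t ^+ 60 * (1 + t) ^+ 2) + s / (s ^+ 60 * (1 + s) ^+ 2).
  apply: le_trans C2 _; rewrite le_eqVlt; apply/orP; left; apply/eqP.
  have t1 : 1 + t != 0 by rewrite gt_eqF// ltr_pwDl// ltW.
  have s1 : 1 + s != 0 by rewrite gt_eqF// ltr_pwDl// ltW.
  by clear -t0 s0 t1 s1; field; rewrite s1 t1 !gt_eqF.
have C4 : md l ^+ 2 / 3600 * (2 ^- 70 * m ^+ 2) <= r ^+ 2 / X ^+ 2.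
  by apply: le_trans (ler_wpM2l _ C3) C1; apply: divr_ge0; [exact: sqr_ge0|exact: ler0n].
rewrite -(WE _ z0r) szE -/X -/l.
have -> : density (H z0) = m by [].
have P : 0 <= m * md l * X by apply: mulr_ge0; [apply: mulr_ge0 => //|]; exact: ltW.
have [q [q0 q1 q2]] : exists q : R, [/\ 0 < q, (2 : R) ^+ 35 = q & (2 : R) ^+ 70 = q ^+ 2].
  by exists (2 ^+ 35); split; [exact: exprn_gt0|by []|rewrite -exprM].
rewrite q1 in K0 *; rewrite q2 in C4.
suff : (m * md l * X) ^+ 2 <= (60 * q * r) ^+ 2 by rewrite ler_sqr ?nnegrE.
move: (md l) C4 => L C4.
have -> : (m * L * X) ^+ 2 = 3600 * q ^+ 2 * X ^+ 2 * (L ^+ 2 / 3600 * (q ^- 2 * m ^+ 2)).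
  by clear -q0; field; rewrite gt_eqF.
have -> : (60 * q * r) ^+ 2 = 3600 * q ^+ 2 * X ^+ 2 * (r ^+ 2 / X ^+ 2).
  by clear -Xp; field; rewrite gt_eqF.
apply: ler_wpM2l C4; apply: mulr_ge0; last exact: sqr_ge0.
by apply: mulr_ge0; [exact: ler0n|exact: sqr_ge0].
Qed.

(** Continuous induction: the supremum of the parameters where the bound from 0 holds belongs to the
    set, and the local bound carries it further unless it is 1. *)
Lemma lipschitz_segment (phi : R -> S) (B : R) : 0 <= B ->
  (forall s, 0 <= s -> s <= 1 -> exists2 d : R, 0 < d & forall s', 0 <= s' -> s' <= 1 ->
     `|s' - s| < d -> sd (phi s') (phi s) <= B * `|s' - s|) ->
  sd (phi 1) (phi 0) <= B.
Proof.
move=> B0 H.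
pose A := [set s : R | [/\ 0 <= s, s <= 1 & sd (phi s) (phi 0) <= B * s]].
have A0 : A 0 by split => //; rewrite sdpp mulr0.
have hs : has_sup A by split; [exists 0|exists 1 => s []].
pose c := sup A.
have c0 : 0 <= c by apply: sup_upper_bound.
have c1 : c <= 1 by apply: ge_sup; [exact: hs.1|move=> s []].
have [d d0 Hd] := H c c0 c1.
have Ac : A c.
  have [s [s0 s1 As] sc] := sup_adherent d0 hs.
  have sc' : s <= c by apply: sup_upper_bound => //; split.
  split => //; apply: le_trans (sd_triangle (phi s) _ _) _.
  have := Hd s s0 s1; rewrite (sdC (phi s)) ler0_norm ?subr_le0// opprB => h.
  have {}h : sd (phi c) (phi s) <= B * (c - s) by apply: h; move: sc; rewrite -/c; clear; lra.
  by move: h As; rewrite mulrBr; clear; lra.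
have [c1'|c1'] := leP 1 c.
  have cE : c = 1 by apply/le_anti; rewrite c1 c1'.
  by case: Ac => _ _; rewrite cE mulr1.
pose s := Num.min 1 (c + d / 2).
have s1 : s <= 1 by rewrite /s ge_min lexx.
have cs : c < s by rewrite /s lt_min c1' ltrDl divr_gt0.
have sd' : s - c < d.
  have : s <= c + d / 2 by rewrite /s ge_min lexx orbT.
  by move: d0; clear; lra.
have As : A s.
  split => //; first by rewrite (le_trans c0)// ltW.
  apply: le_trans (sd_triangle (phi c) _ _) _.
  have := Hd s (le_trans c0 (ltW cs)) s1; rewrite gtr0_norm ?subr_gt0// => /(_ sd').
  by case: Ac => _ _; rewrite mulrBr; clear; lra.
by have := sup_upper_bound hs As; rewrite leNgt cs.
Qed.

Lemma order_ge_lipschitz F z p e (B : R) : 0 < B -> (1 < e)%N -> order_ge F z p e ->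
  exists2 d : R, 0 < d & forall w, md (w - z) < d -> sd (F w) (F z) <= B * md (w - z).
Proof.
move=> B0 e1 hF; have -> : F z = p by apply: order_ge_self hF _; exact: ltnW.
have [K [d [d0 h]]] := hF.
have K1 : 0 < `|K| + 1 by rewrite ltr_wpDl.
exists (Num.min d (Num.min 1 (B / (`|K| + 1)))).
  by rewrite !lt_min d0 ltr01 divr_gt0.
move=> w; rewrite !lt_min => /andP[/h h1 /andP[w1 w2]]; apply: le_trans h1 _.
apply: (@le_trans _ _ ((`|K| + 1) * md (w - z) ^+ 2)).
  apply: (@le_trans _ _ ((`|K| + 1) * md (w - z) ^+ e)).
    by rewrite ler_wpM2r ?exprn_ge0// (le_trans (ler_norm _))// lerDl.
  by rewrite ler_wpM2l ?(ltW K1)// ler_wiXn2l// ltW.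
rewrite expr2 mulrA ler_wpM2r//.
by rewrite mulrC -ler_pdivlMr// ltW.
Qed.

(** At the values 0, 1 and infinity the order exceeds 1, so any positive slope will do. Elsewhere
    [metric_lower] bounds the spherical derivative by [2 ^+ 29 * V]; a further factor 16 covers the
    remainder, the variation of the denominator and the passage from the modulus to [sd]. *)
Lemma speed_lipschitz F z (V : R) : 0 < V -> admissible F z -> speed F z <= V ->
  exists2 d : R, 0 < d & forall w, md (w - z) < d ->
    sd (F w) (F z) <= 2 ^+ 33 * V * md (w - z).
Proof.
move=> V0 [hF F0 Foo F1] vV.
have B0 : 0 < 2 ^+ 33 * V by rewrite mulr_gt0// exprn_gt0.
have [Fz|Fz] := eqVneq (F z) None; first exact: order_ge_lipschitz (Foo Fz).
have [Fz0|Fz0] := eqVneq (F z) (Some 0); first exact: order_ge_lipschitz (F0 Fz0).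
have [Fz1|Fz1] := eqVneq (F z) (Some 1); first exact: order_ge_lipschitz (F1 Fz1).
have [H [hH [d d0 FH]]] := shol_finite hF Fz.
have FzH : F z = Some (H z) by rewrite FH ?subrr ?md0.
have H0 : H z != 0 by apply: contra_neq Fz0; rewrite FzH => ->.
have H1 : H z != 1 by apply: contra_neq Fz1; rewrite FzH => ->.
have hd := dif_derive (holo_dif hH).
rewrite (speed_finite d0 FH hd) (density_pulled _ H0 H1) in vV.
set l := 'D_1 H z in hd vV.
have [r1 r2 r3] := density_roots H0 H1.
have lo := metric_lower (root30_gt0 _) (root30_gt0 _) r1.
have P0 : 0 < 1 + md (H z) ^+ 2 by exact: md1_gt0.
have {}lo : md l / (1 + md (H z) ^+ 2) <= 2 ^+ 29 * V.
  rewrite ler_pdivrMr//.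
  have : 1 * md l <= 2 ^+ 29 * (density (H z) * (1 + md (H z) ^+ 2)) * md l.
    rewrite ler_wpM2r//; move: lo.
    by rewrite (exprM _ 30 2) root30K ?md_gt0.
  rewrite mul1r => h; apply: le_trans h _.
  have -> : 2 ^+ 29 * (density (H z) * (1 + md (H z) ^+ 2)) * md l =
     2 ^+ 29 * (density (H z) * md l) * (1 + md (H z) ^+ 2) by ring.
  by rewrite ler_wpM2r ?(ltW P0)// ler_wpM2l// exprn_ge0.
have [d1 d10 h1] := hd (2 ^+ 29 * V) ltac:(by rewrite mulr_gt0// exprn_gt0).
have [d2 d20 h2] := hasd_cont hd ltr01.
exists (Num.min d (Num.min d1 d2)); first by rewrite !lt_min d0 d10.
move=> w; rewrite !lt_min => /andP[/FH wd /andP[/h1 wd1 /h2 wd2]].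
rewrite wd FzH; apply: le_trans (sd_fin_fin _ _) _.
set sz := Num.sqrt (1 + md (H z) ^+ 2); set sw := Num.sqrt (1 + md (H w) ^+ 2).
have sz0 : 0 < sz by apply: lt_le_trans (sqrt_md1_ge1 _).
have sw0 : 0 < sw by apply: lt_le_trans (sqrt_md1_ge1 _).
(* [H w] is within 1 of [H z], so the two spherical factors are comparable. *)
have szw : sz <= 2 * sw.
  rewrite -ler_sqr ?nnegrE ?mulr_ge0 ?(ltW sz0) ?(ltW sw0)// exprMn.
  rewrite (sqr_sqrtr (ltW (md1_gt0 (H z)))) (sqr_sqrtr (ltW (md1_gt0 (H w)))).
  have : md (H z) <= md (H w) + 1.
    by have := mdB (H z) (H w); rewrite (mdBC (H z)); move: wd2; clear; lra.
  move=> h; have : md (H z) ^+ 2 <= (md (H w) + 1) ^+ 2 by rewrite lerXn2r ?nnegrE// addr_ge0.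
  by have := sqr_ge0 (md (H w) - 1); have := sqr_ge0 (md (H w)); clear; lra.
have zz : sz * sz = 1 + md (H z) ^+ 2 by rewrite -expr2 sqr_sqrtr ?ltW ?md1_gt0.
have dist : md (H w - H z) <= (md l + 2 ^+ 29 * V) * md (w - z).
  have -> : H w - H z = (H w - H z - l * (w - z)) + l * (w - z) by rewrite subrK.
  apply: le_trans (mdD _ _) _; rewrite mdM mulrDl addrC lerD2l; exact: wd1.
have lz : md l <= 2 ^+ 29 * V * (sz * sz) by rewrite zz -ler_pdivrMr.
rewrite ler_pdivrMr ?mulr_gt0//.
have zz1 : 1 <= sz * sz by rewrite zz lerDl sqr_ge0.
set m := md (w - z) in dist *; have m0 : 0 <= m by exact: md_ge0.
set A := 2 ^+ 29 * V in dist lz.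
have A0 : 0 <= A by rewrite mulr_ge0 ?exprn_ge0// ltW.
have e1 : md l + A <= 2 * A * (sz * sz).
  have : A * 1 <= A * (sz * sz) by rewrite ler_wpM2l.
  by move: lz; clear; lra.
have e2 : md (H w - H z) <= 2 * A * (sz * sz) * m.
  by apply: le_trans dist _; rewrite ler_wpM2r.
have e3 : sz * sz <= 2 * (sw * sz) by rewrite mulrA ler_wpM2r// ltW.
have e4 : 2 * A * (sz * sz) * m <= 2 * A * (2 * (sw * sz)) * m.
  by rewrite ler_wpM2r// ler_wpM2l// mulr_ge0.
have -> : 2 ^+ 33 * V * m * (sw * sz) = 4 * (2 * A * (2 * (sw * sz)) * m).
  by rewrite /A; ring.
by rewrite ler_wpM2l// (le_trans e2).
Qed.

Theorem admissible_lipschitz (r : R) : 0 < r -> exists B, 0 <= B /\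
  forall F, (forall z, md z < r -> admissible F z) ->
  forall z, md z <= r / 2 -> sd (F z) (F 0) <= B * md z.
Proof.
(* A radius strictly between [r / 2] and [r]: below [r] the map is admissible, and on the disc of
   radius [r / 2] the weight stays away from 0. *)
move=> r0; pose r1 := 3 / 4 * r.
have r10 : 0 < r1 by rewrite mulr_gt0// divr_gt0.
have r1r : r1 < r by rewrite /r1; move: r0; clear; lra.
pose V := 60 * 2 ^+ 35 * r1 / (r1 ^+ 2 - (r / 2) ^+ 2).
have D0 : 0 < r1 ^+ 2 - (r / 2) ^+ 2.
  by rewrite subr_gt0 ltrXn2r ?nnegrE ?divr_ge0 ?(ltW r0) ?(ltW r10)// /r1; move: r0; clear; lra.
have V0 : 0 < V by rewrite divr_gt0// !mulr_gt0// exprn_gt0.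
exists (2 ^+ 33 * V); split; first by rewrite mulr_ge0 ?exprn_ge0// ltW.
move=> F adm z zr.
have vV w : md w <= r / 2 -> speed F w <= V.
  move=> wr; have wr1 : md w < r1 by rewrite /r1; move: r0 wr; clear; lra.
  have := speed_bound r10 r1r adm wr1.
  rewrite /V ler_pdivlMr// => h; apply: le_trans h; rewrite ler_wpM2l ?speed_ge0//.
  by rewrite lerD2l lerN2 lerXn2r ?nnegrE ?divr_ge0 ?(ltW r0).
have B0 : 0 <= 2 ^+ 33 * V * md z by rewrite mulr_ge0// mulr_ge0 ?exprn_ge0// ltW.
have := @lipschitz_segment (fun s => F (mkC s 0 * z)) _ B0.
have e1 : mkC 1 0 * z = z by rewrite (_ : mkC 1 0 = 1)// mul1r.
have e0 : mkC 0 0 * z = 0 by rewrite (_ : mkC 0 0 = 0)// mul0r.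
rewrite e1 e0; apply => s s0 s1.
have sz : md (mkC s 0 * z) <= r / 2.
  rewrite mdM md_mkC0 ger0_norm//; apply: le_trans zr; rewrite -[leRHS]mul1r.
  by rewrite ler_wpM2r.
have [|d d0 H] := speed_lipschitz V0 _ (vV _ sz).
  by apply: adm; move: sz r0; clear; lra.
have z1 : 0 < md z + 1 by rewrite ltr_wpDl.
exists (d / (md z + 1)); first by rewrite divr_gt0.
move=> s' s'0 s'1 ss; have E : mkC s' 0 * z - mkC s 0 * z = mkC (s' - s) 0 * z.
  by rewrite -mulrBl; congr (_ * _); apply: eqC; rewrite !reimE ?subrr.
have := H (mkC s' 0 * z); rewrite E mdM md_mkC0 => h.
have -> : 2 ^+ 33 * V * md z * `|s' - s| = 2 ^+ 33 * V * (`|s' - s| * md z) by ring.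
apply: h.
rewrite ltr_pdivlMr// in ss; apply: le_lt_trans ss.
by rewrite ler_wpM2l// lerDl.
Qed.

End AhlforsSchwarz.

(** * Equicontinuity at a point through the quotients by psi *)

Section LocalEquicontinuity.
Variable R : realType.
Local Notation C := (Cplane R).
Local Notation S := (sphere R).
Local Notation md := (@modulus R).
Implicit Types (f g h H psi : C -> C) (F : C -> S) (z w : C).

Lemma exists_le3 (a b c : R) : 0 < a -> 0 < b -> 0 < c -> exists d, 
  [/\ 0 < d, d <= a, d <= b & d <= c].
Proof.
move=> a0 b0 c0; exists (Num.min a (Num.min b c)).
by split; rewrite ?lt_min ?a0 ?b0 ?c0// !ge_min ?lexx ?orbT.
Qed.

Lemma order_ge_sinv F z p e : order_ge F z p e -> order_ge (fun w => sinv (F w)) z (sinv p) e.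
Proof. by move=> [K [d [d0 h]]]; exists K, d; split => // w /h; rewrite sd_sinv. Qed.

Lemma order_ge_le F z p e e' : (e' <= e)%N -> order_ge F z p e -> order_ge F z p e'.
Proof.
move=> ee [K [d [d0 h]]]; exists `|K|, (Num.min d 1); split; first by rewrite lt_min d0 /=.
move=> w; rewrite lt_min => /andP[/h h1 w1]; apply: le_trans h1 _.
apply: (@le_trans _ _ (`|K| * md (w - z) ^+ e)).
  by rewrite ler_wpM2r ?exprn_ge0// ler_norm.
by rewrite ler_wpM2l// ler_wiXn2l// ltW.
Qed.

Lemma order_ge_comp F (phi : C -> C) z p e n (K d : R) : 0 < d -> contat phi z ->
  (forall w, md (w - z) < d -> md (phi w - phi z) <= K * md (w - z) ^+ n) ->
  order_ge F (phi z) p e -> order_ge (fun w => F (phi w)) z p (n * e).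
Proof.
move=> d0 cphi hphi [L [d1 [d10 h]]].
have [d2 d20 h2] := cphi d1 d10.
exists (`|L| * `|K| ^+ e), (Num.min d d2); split; first by rewrite lt_min d0.
move=> w; rewrite lt_min => /andP[/hphi k1 /h2/h k2]; apply: le_trans k2 _.
apply: (@le_trans _ _ (`|L| * md (phi w - phi z) ^+ e)).
  by rewrite ler_wpM2r ?exprn_ge0// ler_norm.
rewrite -mulrA ler_wpM2l// exprM -exprMn lerXn2r ?nnegrE//.
  by rewrite mulr_ge0 ?exprn_ge0.
by apply: le_trans k1 _; rewrite ler_wpM2r ?exprn_ge0// ler_norm.
Qed.

Lemma hasd_lipschitz f z l : hasd f z l -> exists2 d : R, 0 < d &
  forall w, md (w - z) < d -> md (f w - f z) <= (md l + 1) * md (w - z).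
Proof.
move=> /(_ 1 ltr01)[d d0 h]; exists d => // w /h.
rewrite mul1r => h1; rewrite -[f w - f z](subrK (l * (w - z))).
by apply: le_trans (mdD _ _) _; rewrite mdM mulrDl mul1r addrC lerD2l.
Qed.

(** Holomorphic maps are locally Lipschitz into the sphere. This trivial order 1 becomes 31 under
    the substitution of a 31st power. *)
Lemma shol_order1 F z : shol F z -> order_ge F z (F z) 1.
Proof.
move=> [H [hH [d d0 FH]]].
have [l hl] := holo_dif hH; have [d1 d10 h1] := hasd_lipschitz hl.
exists (4 * (md l + 1)), (Num.min d d1); split; first by rewrite lt_min d0.
move=> w; rewrite lt_min => /andP[wd /h1 wd1]; rewrite expr1.
have -> : sd (F w) (F z) = sd (Some (H w)) (Some (H z)).
  by case: FH => FH; rewrite !FH ?subrr ?md0// sd_sinv.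
by apply: le_trans (sd_fin_le _ _) _; rewrite -mulrA ler_wpM2l.
Qed.

Lemma shol_comp F phi z : holo phi z -> shol F (phi z) -> shol (fun w => F (phi w)) z.
Proof.
move=> hphi [H [hH [d d0 FH]]]; exists (fun w => H (phi w)); split.
  exact: holo_comp.
have [d1 d10 h1] := holo_contat hphi d0; exists d1 => //.
by case: FH => FH; [left|right] => w /h1/FH.
Qed.

Definition mero_fin F z H := holo H z /\ exists2 d : R, 0 < d &
  forall w, md (w - z) < d -> F w = Some (H w).

Definition mero_pole F z n h := [/\ (0 < n)%N, holo h z, h z != 0, F z = None &
  exists2 d : R, 0 < d & forall w, w != z -> md (w - z) < d ->
    F w = Some (h w / (w - z) ^+ n)].

Lemma mero_poleE F z n : pole_of_mult F z n <-> exists h, mero_pole F z n h.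
Proof.
split => [[n0 [h [/holoE hh h0 Fz /dnbhs_md[d d0 Hd]]]]|[h [n0 /holoE hh h0 Fz [d d0 Hd]]]].
  by exists h; split => //; exists d.
by split => //; exists h; split => //; apply: (dnbhs_md z _).2; exists d.
Qed.

Lemma meroE (D : set C) F : meromorphic_on D F <-> forall z, D z ->
  (exists H, mero_fin F z H) \/ (exists n h, mero_pole F z n h).
Proof.
split => mF z /mF [].
- by move=> [H /holoE hH /nbhs_md[d d0 h]]; left; exists H; split => //; exists d.
- by move=> [n /mero_poleE[h hh]]; right; exists n, h.
- move=> [H [/holoE hH [d d0 h]]]; left; exists H => //.
  by apply: (nbhs_md z _).2; exists d.
- by move=> [n [h hh]]; right; exists n; apply/mero_poleE; exists h.
Qed.

Lemma zero_of_multP F z H n k : mero_fin F z H -> holo k z -> k z != 0 -> (0 < n)%N ->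
  (forall w, H w = (w - z) ^+ n * k w) -> zero_of_mult F z n.
Proof.
move=> [hH [d d0 FH]] hk k0 n0 Hk; split => //; exists k; split => //.
  exact/holoE.
by apply: (nbhs_md z _).2; exists d => // w /FH ->; rewrite Hk.
Qed.

Lemma mero_pole_sinv F z n h : mero_pole F z n h -> exists H, [/\ holo H z,
   (exists2 d : R, 0 < d & forall w, md (w - z) < d -> F w = sinv (Some (H w)) /\ h w != 0) &
   forall w, H w = (w - z) ^+ n / h w].
Proof.
move=> [n0 hh h0 Fz [d d0 Fh]].
exists (fun w => (w - z) ^+ n / h w); split => //.
  apply: holoM; last exact: holoV.
  by apply: holoX; apply: holoB; [exact: holo_id|exact: holo_cst].
have [d1 d10 h1] := contat_neq (holo_contat hh) h0.
exists (Num.min d d1); first by rewrite lt_min d0.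
move=> w; rewrite lt_min => /andP[wd /h1 hw]; split => //=.
have [->|wz] := eqVneq w z; first by rewrite subrr expr0n gtn_eqF// mul0r eqxx.
have wz0 : (w - z) ^+ n != 0 by rewrite expf_neq0// subr_eq0.
by rewrite mulf_eq0 invr_eq0 (negbTE wz0) (negbTE hw) Fh// invf_div.
Qed.

Lemma mero_shol F z : (exists H, mero_fin F z H) \/ (exists n h, mero_pole F z n h) ->
  shol F z.
Proof.
case=> [[H [hH [d d0 h]]]|[n [h /mero_pole_sinv[H [hH [d d0 hd] _]]]]].
  by exists H; split => //; exists d => //; left.
by exists H; split => //; exists d => //; right => w /hd[].
Qed.

(** At a zero of the divisor the value is the limit of the quotient when the zeros of the dividend
    have higher order: 0 if the dividend vanishes, infinity otherwise. *)
Definition sdiv (p : S) (c : C) : S := if p is Some a then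
    (if c == 0 then (if a == 0 then Some 0 else None) else Some (a / c))
  else None.

Definition smul (c : C) (p : S) : S := if p is Some a then Some (c * a) else None.

Lemma sdivK p c : c != 0 -> smul c (sdiv p c) = p.
Proof. by case: p => //= a c0; rewrite (negbTE c0) /= mulrC divfK. Qed.

Lemma smul_sinv p c : c != 0 -> sinv (smul c p) = smul c^-1 (sinv p).
Proof.
move=> c0; case: p => [a|] /=; last by rewrite mulr0.
by rewrite mulf_eq0 (negbTE c0) /=; case: eqVneq => //= _; rewrite invfM.
Qed.

(* Valid also at a zero of [psi], provided zeros of [F] there have higher order. *)
Lemma quotient_shol F psi z k psi1 :
  (exists H, mero_fin F z H) \/ (exists n h, mero_pole F z n h) ->
  holo psi1 z -> psi1 z != 0 -> (forall w, psi w = (w - z) ^+ k * psi1 w) ->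
  (forall n, zero_of_mult F z n -> (k < n)%N) -> shol (fun w => sdiv (F w) (psi w)) z.
Proof.
move=> mF hp p0 Hp zF.
have hpsi : holo psi z.
  have -> : psi = (fun w => (w - z) ^+ k * psi1 w) by apply/funext.
  apply: holoM => //; apply: holoX; apply: holoB; [exact: holo_id|exact: holo_cst].
have [dp dp0 hdp] := contat_neq (holo_contat hp) p0.
have psi_neq0 w : md (w - z) < dp -> w != z -> psi w != 0.
  by move=> /hdp h wz; rewrite Hp mulf_neq0// expf_neq0// subr_eq0.
case: mF => [[H mH]|[n [h mh]]]; last first.
  have [H [hH [d d0 FH] HE]] := mero_pole_sinv mh.
  have [n0 _ _ _ _] := mh.
  exists (fun w => H w * psi w); split; first exact: holoM.
  exists (Num.min d dp); first by rewrite lt_min d0.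
  right => w; rewrite lt_min => /andP[/FH[-> hw] wd] /=.
  have [->|wz] := eqVneq w z.
    by rewrite HE subrr expr0n gtn_eqF// !mul0r eqxx.
  rewrite mulf_eq0 (negbTE (psi_neq0 w wd wz)) orbF.
  by case: eqVneq => //= _; rewrite (negbTE (psi_neq0 w wd wz)) invfM.
have [hH [d d0 FH]] := mH.
have [Hz|Hz] := eqVneq (H z) 0.
  have [[d1 d10 H0]|[n [g [hg g0 Hg]]]] := holo_factor hH.
    exists (fun=> 0); split; first exact: holo_cst.
    exists (Num.min d d1); first by rewrite lt_min d0.
    left => w; rewrite lt_min => /andP[/FH -> /H0 ->] /=.
    by rewrite eqxx mul0r; case: ifP.
  have n0 : (0 < n)%N.
    by case: n Hg => // /(_ z); rewrite Hz expr0 mul1r => h; rewrite -h eqxx in g0.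
  have kn : (k < n)%N by apply: zF; exact: zero_of_multP Hg.
  exists (fun w => (w - z) ^+ (n - k) * (g w / psi1 w)); split.
    apply: holoM; last by apply: holoM => //; exact: holoV.
    by apply: holoX; apply: holoB; [exact: holo_id|exact: holo_cst].
  exists (Num.min d dp); first by rewrite lt_min d0.
  left => w; rewrite lt_min => /andP[/FH -> wd] /=.
  have [->|wz] := eqVneq w z.
    rewrite Hz eqxx subrr expr0n subn_eq0 leqNgt kn /= mul0r.
    by case: ifP => // _; rewrite mul0r.
  rewrite (negbTE (psi_neq0 w wd wz)) Hg Hp; congr Some.
  have wz0 : w - z != 0 by rewrite subr_eq0.
  rewrite -(subnK (ltnW kn)) exprD addnK.
  by field; rewrite expf_neq0// hdp.
case: k Hp zF psi_neq0 => [|k] Hp zF psi_neq0.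
  have pz : psi z != 0 by rewrite Hp expr0 mul1r.
  exists (fun w => H w / psi w); split; first by apply: holoM => //; exact: holoV.
  exists (Num.min d dp); first by rewrite lt_min d0.
  left => w; rewrite lt_min => /andP[/FH -> wd] /=.
  by rewrite Hp expr0 mul1r (negbTE (hdp w wd)).
exists (fun w => psi w / H w); split; first by apply: holoM => //; exact: holoV.
have [d1 d10 h1] := contat_neq (holo_contat hH) Hz.
exists (Num.min (Num.min d d1) dp); first by rewrite !lt_min d0 d10.
right => w; rewrite !lt_min => /andP[/andP[/FH -> /h1 Hw] wd] /=.
rewrite mulf_eq0 invr_eq0 (negbTE Hw) orbF; case: eqVneq => //= _.
by rewrite invf_div.
Qed.

Lemma quotient_orders F psi z a0 aoo : (0 < a0)%N ->
  (exists H, mero_fin F z H) \/ (exists n h, mero_pole F z n h) ->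
  holo psi z -> psi z != 0 ->
  (forall n, zero_of_mult F z n -> (a0 <= n)%N) ->
  (forall n, pole_of_mult F z n -> (aoo <= n)%N) ->
  (sdiv (F z) (psi z) = Some 0 -> order_ge (fun w => sdiv (F w) (psi w)) z (Some 0) a0) /\
  (sdiv (F z) (psi z) = None -> order_ge (fun w => sdiv (F w) (psi w)) z None aoo).
Proof.
move=> a00 mF hp p0 zF pF.
have bnd f d (e : nat) : holo f z -> 0 < d -> exists K d' : R, 0 < d' /\
    forall w, md (w - z) < d' -> md (w - z) < d /\ md ((w - z) ^+ e * f w) <= K * md (w - z) ^+ e.
  move=> hf d0; have [d1 d10 h1] := holo_contat hf ltr01.
  exists (md (f z) + 1), (Num.min d d1); split; first by rewrite lt_min d0.
  move=> w; rewrite lt_min => /andP[-> /h1 fw]; split => //.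
  rewrite mdM mdX mulrC ler_wpM2r ?exprn_ge0//.
  by have := mdB (f w) (f z); move: fw; clear; lra.
have [dp dp0 hdp] := contat_neq (holo_contat hp) p0.
case: mF => [[H mH]|[n [h mh]]].
  have [hH [d d0 FH]] := mH.
  have Fz : F z = Some (H z) by rewrite FH ?subrr ?md0.
  rewrite Fz /= (negbTE p0); split => // -[/eqP].
  rewrite mulf_eq0 invr_eq0 (negbTE p0) orbF => /eqP Hz.
  have [[d1 d10 H0]|[n [g [hg g0 Hg]]]] := holo_factor hH.
    exists 0, (Num.min (Num.min d d1) dp); split; first by rewrite !lt_min d0 d10.
    move=> w; rewrite !lt_min => /andP[/andP[/FH -> /H0 ->] /hdp/negbTE pw] /=.
    by rewrite pw mul0r sdpp mul0r.
  have n0 : (0 < n)%N.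
    by case: n Hg => // /(_ z); rewrite Hz expr0 mul1r => h; rewrite -h eqxx in g0.
  have an : (a0 <= n)%N by apply: zF; exact: zero_of_multP Hg.
  have hgp : holo (fun w => g w / psi w) z by apply: holoM => //; exact: holoV.
  have [K [d' [d'0 hK]]] := bnd _ _ n hgp d0.
  apply: (order_ge_le an).
  exists (4 * K), (Num.min (Num.min d d') dp); split; first by rewrite !lt_min d0 d'0.
  move=> w; rewrite !lt_min => /andP[/andP[/FH -> /hK[_ wK]] /hdp/negbTE pw] /=.
  rewrite pw; apply: le_trans (sd_fin_le _ _) _; rewrite subr0 -mulrA ler_wpM2l//.
  by rewrite Hg -mulrA.
have [n0 _ _ Fz _] := mh; rewrite Fz; split => // _.
have an : (aoo <= n)%N by apply: pF; apply/mero_poleE; exists h.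
have [H [hH [d d0 FH] HE]] := mero_pole_sinv mh.
have [_ hh h0 _ _] := mh.
have hgp : holo (fun w => psi w / h w) z by apply: holoM => //; exact: holoV.
have [K [d' [d'0 hK]]] := bnd _ _ n hgp d0.
apply: (order_ge_le an).
exists (4 * K), (Num.min d' dp); split; first by rewrite !lt_min d'0.
move=> w; rewrite !lt_min => /andP[/hK[/FH[-> hw] wK] /hdp pw] /=.
have -> : sdiv (if H w == 0 then None else Some (H w)^-1) (psi w) = sinv (Some (H w * psi w)).
  by rewrite /= mulf_eq0 (negbTE pw) orbF; case: eqVneq => //= _; rewrite (negbTE pw) invfM.
rewrite sd_sinv_oo; apply: le_trans (sd_fin_le _ _) _; rewrite subr0 -mulrA ler_wpM2l//.
by rewrite HE mulrAC -mulrA.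
Qed.


Lemma smul_close psi z0 : contat psi z0 -> forall e : R, 0 < e ->
  exists eta d : R, [/\ 0 < eta, 0 < d & forall z p b, md (z - z0) < d -> md b <= 1 ->
    sd p (Some b) < eta -> sd (smul (psi z) p) (smul (psi z0) (Some b)) < e].
Proof.
move=> cpsi e e0; pose c := md (psi z0) + 1.
have c0 : 0 < c by rewrite ltr_wpDl.
have [|d d0 hd] := cpsi (Num.min 1 (e / 16)); first by rewrite lt_min ltr01 divr_gt0.
pose eta := Num.min 2^-1 (e / (64 * c)).
have eta0 : 0 < eta by rewrite lt_min invr_gt0 ltr0n divr_gt0// mulr_gt0.
exists eta, d; split => // z p b /hd; rewrite lt_min => /andP[z1 z2] b1 hp.
have [h1 h2] : sd p (Some b) < 2^-1 /\ sd p (Some b) < e / (64 * c).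
  by move: hp; rewrite lt_min => /andP[].
have s0 := sd_ge0 p (Some b).
have [|a pa ab] := @sd_fin_close R p b.
  apply: (@le_trans _ _ (2^-1 * 2)); last by rewrite mulVf.
  by apply: ler_pM => //; [exact: addr_ge0|exact: ltW|move: b1; clear; lra].
rewrite pa /=; apply: le_lt_trans (sd_fin_le _ _) _.
have -> : psi z * a - psi z0 * b = psi z * (a - b) + (psi z - psi z0) * b by ring.
have k1 : md (a - b) <= 4 * sd p (Some b).
  apply: le_trans ab _; rewrite ler_wpM2r//.
  have : (1 + md b) ^+ 2 <= 2 ^+ 2.
    by rewrite lerXn2r ?nnegrE ?addr_ge0//; move: b1; clear; lra.
  by rewrite -natrX.
have k2 : md (psi z) <= c.
  by rewrite /c; have := mdB (psi z) (psi z0); move: z1; clear; lra.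
have k3 : md (psi z * (a - b)) <= c * (4 * sd p (Some b)) by rewrite mdM ler_pM.
have k4 : md ((psi z - psi z0) * b) <= e / 16.
  by rewrite mdM -[leRHS]mulr1 ler_pM// ltW.
have k5 : c * sd p (Some b) < e / 64.
  move: h2; have -> : e / (64 * c) = e / 64 / c by field; rewrite gt_eqF.
  by rewrite ltr_pdivlMr// mulrC.
have := mdD (psi z * (a - b)) ((psi z - psi z0) * b).
by move: k3 k4 k5 e0; clear; lra.
Qed.

(** [smul_close] works in the closed unit disc. A point outside it is moved inside by inversion,
    which replaces psi by its reciprocal. *)
Lemma smul_equicontinuous psi z0 : contat psi z0 -> psi z0 != 0 -> forall e : R, 0 < e ->
  exists eta d : R, [/\ 0 < eta, 0 < d & forall z p q, md (z - z0) < d ->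
    sd p q < eta -> sd (smul (psi z) p) (smul (psi z0) q) < e].
Proof.
move=> cpsi p0 e e0.
have [d0 d00 h0] := contat_neq cpsi p0.
have cV : contat (fun z => (psi z)^-1) z0.
  apply/contatE; apply: continuousV => //; exact/contatE.
have [n1 [d1 [n10 d10 h1]]] := smul_close cpsi e0.
have [n2 [d2 [n20 d20 h2]]] := smul_close cV e0.
exists (Num.min n1 n2), (Num.min d0 (Num.min d1 d2)); split; rewrite ?lt_min ?n10 ?d00 ?d10//.
move=> z p q; rewrite !lt_min => /andP[/h0 pz /andP[z1 z2]] /andP[s1 s2].
have big : (forall b, q = Some b -> 1 < md b) ->
    sd (smul (psi z) p) (smul (psi z0) q) < e.
  move=> qb; rewrite -sd_sinv !smul_sinv//.
  have [b [qE b1]] : exists b, sinv q = Some b /\ md b <= 1.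
    case: q qb {s1 s2} => [a|] qb; last by exists 0; rewrite md0.
    have a1 := qb a erefl; exists a^-1; rewrite mdV /=.
    have a0 : a != 0 by rewrite -md_gt0 (lt_trans ltr01).
    by rewrite (negbTE a0) invf_le1 ?md_gt0// ltW.
  by rewrite qE; apply: h2 => //; rewrite -qE sd_sinv.
case: q s1 s2 big => [b|] s1 s2 big; last exact: big.
have [b1|b1] := leP (md b) 1; first exact: h1.
by apply: big => _ [<-].
Qed.

(** Inversion exchanges 0 and infinity and fixes 1, so the second alternative on the orders reduces
    to the first. *)
Lemma admissible_sinv G z : shol G z -> (G z = Some 0 -> order_ge G z (Some 0) 3) ->
  (G z = None -> order_ge G z None 2) -> (G z = Some 1 -> order_ge G z (Some 1) 31) ->
  admissible (fun w => sinv (G w)) z.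
Proof.
move=> hG G0 Goo G1; split; first exact: shol_sinv.
- move=> h; have : G z = None by rewrite -[G z]sinvK h /= eqxx.
  by move/Goo/order_ge_sinv.
- move=> h; have : G z = Some 0 by rewrite -[G z]sinvK h.
  by move/G0/order_ge_sinv; rewrite /= eqxx.
- move=> h; have : G z = Some 1 by rewrite -[G z]sinvK h /= oner_eq0 invr1.
  by move/G1/order_ge_sinv; rewrite /= oner_eq0 invr1.
Qed.

(** The radius [r] is the same for all members of [A]; the uniformity of every later estimate rests
    on this. *)
Record quotient_data (A : set (C -> S)) psi z0 (r : R) k psi1 (a0 aoo : nat) : Prop := {
  qd_r : 0 < r;
  qd_mero : forall F, A F -> forall z, md (z - z0) < r ->
    (exists H, mero_fin F z H) \/ (exists n h, mero_pole F z n h);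
  qd_holo : forall z, md (z - z0) < r -> holo psi z;
  qd_neq0 : forall z, md (z - z0) < r -> z != z0 -> psi z != 0;
  qd_holo1 : holo psi1 z0;
  qd_neq01 : psi1 z0 != 0;
  qd_factor : forall w, psi w = (w - z0) ^+ k * psi1 w;
  qd_zero : forall F, A F -> forall z n, md (z - z0) < r -> zero_of_mult F z n ->
    (a0 <= n)%N /\ (k < n)%N;
  qd_pole : forall F, A F -> forall z n, md (z - z0) < r -> pole_of_mult F z n -> (aoo <= n)%N;
  qd_omit : forall F, A F -> forall z, md (z - z0) < r -> z != z0 -> F z <> Some (psi z);
  qd_orders : (a0 = 2%N /\ aoo = 3%N) \/ (a0 = 3%N /\ aoo = 2%N) }.

(* The substitution [z = z0 + w ^+ 31] raises all orders at z0 to at least 31, so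
   that no information on the quotient at z0 itself is needed. *)
Lemma quotient_equicontinuous A psi z0 r k psi1 a0 aoo :
  quotient_data A psi z0 r k psi1 a0 aoo -> forall e : R, 0 < e ->
  exists2 d : R, 0 < d & forall F, A F -> forall z, md (z - z0) < d ->
    sd (sdiv (F z) (psi z)) (sdiv (F z0) (psi z0)) < e.
Proof.
move=> [r0 mF hpsi psi0 hp1 p10 Hp zF pF om ords] e e0.
pose s := Num.min 1 r; have s0 : 0 < s by rewrite lt_min ltr01.
have sr : s <= r by rewrite ge_min lexx orbT.
have s1 : s <= 1 by rewrite ge_min lexx.
pose phi (w : C) := z0 + w ^+ 31.
have phi0 w : phi w - z0 = w ^+ 31 by rewrite /phi addrAC subrr add0r.
have phir w : md w < s -> md (phi w - z0) < r.
  move=> ws; rewrite phi0 mdX; apply: le_lt_trans (lt_le_trans ws sr).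
  by rewrite -[leRHS]expr1 ler_wiXn2l// (le_trans (ltW ws)).
have hphi w : holo phi w.
  exists 1 => // x _; apply: difD; first exact: dif_cst.
  by apply: difX; exact: dif_id.
pose Q F w := sdiv (F w) (psi w).
have a0g : (0 < a0)%N by case: ords => -[-> _].
have a031 : (a0 <= 31)%N by case: ords => -[-> _].
have aoo31 : (aoo <= 31)%N by case: ords => -[_ ->].
have hQ F z : A F -> md (z - z0) < r -> shol (Q F) z.
  move=> AF zr; have [->|zz] := eqVneq z z0.
    by apply: (@quotient_shol F psi z0 k psi1) => //; [apply: mF => //; rewrite subrr md0|
      move=> n /zF []//; rewrite subrr md0].
  apply: (@quotient_shol F psi z 0 psi) => //; [exact: mF|exact: hpsi|exact: psi0|
    by move=> w; rewrite expr0 mul1r|by move=> n []].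
have ordsG F w : A F -> md w < s -> let G := fun w => Q F (phi w) in
   [/\ shol G w, G w = Some 0 -> order_ge G w (Some 0) a0,
       G w = None -> order_ge G w None aoo & G w = Some 1 -> order_ge G w (Some 1) 31].
  move=> AF ws G; have pr := phir w ws.
  have sG : shol G w by apply: (@shol_comp (Q F) phi w); [exact: hphi|exact: hQ].
  have cphi : contat phi w by exact: holo_contat.
  (* At 0 the substitution alone gives order 31 at whatever value is taken, and 31 exceeds all
     prescribed orders. Off 0 it is Lipschitz and the orders of the quotient carry over. *)
  have [w0|w0] := eqVneq w 0.
    have p31 : order_ge G w (G w) 31.
      have -> : 31%N = (31 * 1)%N by [].
      apply: (@order_ge_comp (Q F) phi w (G w) 1 31 1 1) => //.
        by move=> x _; rewrite w0 /phi expr0n addr0 -/(phi x) phi0 subr0 mdX mul1r.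
      by apply: shol_order1; exact: hQ.
    by split => // h; rewrite h in p31 => //; apply: order_ge_le p31.
  have pz : phi w != z0 by rewrite -subr_eq0 phi0 expf_neq0.
  have [l hl] := holo_dif (hphi w).
  have [d d0 hd] := hasd_lipschitz hl.
  have comp p n : order_ge (Q F) (phi w) p n -> order_ge G w p n.
    rewrite -[X in _ -> order_ge _ _ _ X]mul1n.
    by apply: (@order_ge_comp (Q F) phi w p n 1 (md l + 1) d) => // x /hd; rewrite expr1.
  have [q0 qoo] := @quotient_orders F psi (phi w) a0 aoo a0g (mF F AF _ pr) (hpsi _ pr)
     (psi0 _ pr pz) (fun n hn => (zF F AF _ n pr hn).1) (fun n hn => pF F AF _ n pr hn).
  split => // [h|h|]; [by apply: comp; exact: q0|by apply: comp; exact: qoo|].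
  (* The quotient never equals 1 off [z0], so the requirement at the value 1 is vacuous. *)
  rewrite /G /Q; case E : (F (phi w)) => [x|] //=.
  rewrite (negbTE (psi0 _ pr pz)) => -[xp]; exfalso.
  apply: (om F AF _ pr pz); rewrite E; congr Some.
  by move/eqP: xp; rewrite -subr_eq0 -[1](divff (psi0 _ pr pz)) -mulrBl mulf_eq0 invr_eq0
    (negbTE (psi0 _ pr pz)) orbF subr_eq0 => /eqP.
have [B [B0 HB]] := admissible_lipschitz s0.
have lip F w : A F -> md w <= s / 2 -> sd (Q F (phi w)) (Q F (phi 0)) <= B * md w.
  move=> AF ws; case: ords => -[e1 e2]; subst a0 aoo.
    by apply: (HB (fun w => Q F (phi w))) => // x xs; have [] := ordsG F x AF xs.
  rewrite -sd_sinv; apply: (HB (fun w => sinv (Q F (phi w)))) => // x xs.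
  by have [] := ordsG F x AF xs; exact: admissible_sinv.
pose eta := Num.min (s / 2) (e / (B + 1)).
have B1 : 0 < B + 1 by rewrite ltr_wpDl.
have eta0 : 0 < eta by rewrite lt_min !divr_gt0.
exists (eta ^+ 31); first by rewrite exprn_gt0.
move=> F AF z zd.
(* A complex 31st root: every [z] near [z0] is reached by the substitution, with
   [md w ^+ 31 = md (z - z0)]. *)
have [w wz] : exists w : C, w ^+ 31 = z - z0 by exists (31.-root (z - z0)); rewrite rootCK.
have we : md w < eta.
  by move: zd; rewrite -wz mdX ltr_pXn2r// ?nnegrE// ltW.
have := lip F w AF; rewrite /phi expr0n addr0 wz addrC subrK => h.
move: we; rewrite lt_min => /andP[w1 w2].
apply: le_lt_trans (h (ltW w1)) _; apply: (@le_lt_trans _ _ ((B + 1) * md w)).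
  by rewrite ler_wpM2r// lerDl.
by rewrite mulrC -ltr_pdivlMr.
Qed.

Lemma lipschitz_center g a (r M : R) : 0 < r -> (forall z, sq a r z -> dif g z) ->
  (forall z, sq a r z -> md (g z) <= M) -> forall z, sq a (r / 2) z ->
  md (g z - g a) <= 8 * M / r * md (z - a).
Proof.
move=> r0 dg gM.
have [||v hv] := @bounded_limit R g a r M r0; try by move=> *; auto.
have M0 : 0 <= M by exact: le_trans (md_ge0 _) (gM a (sq_center a (ltW r0))).
suff gv : g a = v.
  move=> z zin; have [->|za] := eqVneq z a; last by rewrite gv; exact: hv.
  by rewrite !subrr md0 mulr0.
apply/eqP; rewrite -subr_eq0 -md_eq0; apply/negP => /negP gv.
have gv0 : 0 < md (g a - v) by rewrite lt_def gv md_ge0.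
set eta := md (g a - v) in gv0.
have [|d d0 hd] := dif_contat (dg a (sq_center a (ltW r0))) (e := eta / 2).
  by rewrite divr_gt0.
pose K := 8 * M / r; have K0 : 0 <= K by rewrite divr_ge0 ?mulr_ge0// ltW.
have K1 : 0 < K + 1 by rewrite ltr_wpDl.
have [m [m0 m1 m2 m3]] := @exists_le3 (d / 2) (r / 2) (eta / 2 / (K + 1))
  ltac:(by rewrite divr_gt0) ltac:(by rewrite divr_gt0) ltac:(by rewrite !divr_gt0).
pose z := a + mkC m 0.
have zm : md (z - a) = m by rewrite /z addrAC subrr add0r md_mkC0 gtr0_norm.
have za : z != a by rewrite -subr_eq0 -md_gt0 zm.
have h1 : md (g z - g a) < eta / 2 by apply: hd; rewrite zm; move: m1 d0; clear; lra.
have h2 : md (g z - v) <= K * m.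
  by rewrite -zm; apply: hv => //; apply: sq_md; rewrite zm.
have h3 : (K + 1) * m <= eta / 2 by rewrite mulrC -ler_pdivlMr.
have := md_triangle (g a) (g z) v; rewrite (mdBC (g a) (g z)) -/eta.
by move: h1 h2 h3 m0; clear; lra.
Qed.

Lemma finite_part_holo F z : shol F z -> F z != None ->
  holo (fun w => finite_part (F w)) z.
Proof.
move=> hF Fz; have [H [hH [d d0 FH]]] := shol_finite hF Fz.
by apply: (holo_eq d0 _ hH) => w /FH ->.
Qed.

Lemma sd_Some0 (p : S) : sd p (Some 0) <= 1 -> exists2 a, p = Some a & md a <= sd p (Some 0).
Proof.
move=> h; have [|a pa ha] := @sd_fin_close R p 0; first by rewrite md0 addr0 mulr1.
by exists a => //; move: ha; rewrite subr0 md0 addr0 expr1n mul1r.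
Qed.

(** Suppose psi vanishes at [z0]. If [F z0] is 0, the quotient is bounded by 1 nearby and F is its
    product with the small psi. Otherwise the reciprocal of the quotient is bounded by 1; a lower
    bound for psi on the boundary of a square then bounds 1 / F there, hence inside, and a bounded
    holomorphic function is Lipschitz at the centre. *)
Lemma family_equicontinuous A psi z0 r k psi1 a0 aoo :
  quotient_data A psi z0 r k psi1 a0 aoo -> forall e : R, 0 < e ->
  exists2 d : R, 0 < d & forall F, A F -> forall z, md (z - z0) < d ->
    sd (F z) (F z0) < e.
Proof.
move=> qd e e0; have [r0 mF hpsi psi0 hp1 p10 Hp zF pF om ords] := qd.
have hpz : holo psi z0 by apply: hpsi; rewrite subrr md0.
have cpsi := holo_contat hpz.
have [pz0|pz0] := eqVneq (psi z0) 0; last first.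
  have psi_neq0 z : md (z - z0) < r -> psi z != 0.
    by move=> zr; have [->//|zz] := eqVneq z z0; exact: psi0.
  have [eta [d [eta0 d0 H]]] := smul_equicontinuous cpsi pz0 e0.
  have [d1 d10 H1] := quotient_equicontinuous qd eta0.
  exists (Num.min r (Num.min d d1)); first by rewrite !lt_min r0 d0.
  move=> F AF z; rewrite !lt_min => /andP[zr /andP[zd zd1]].
  have := H z _ _ zd (H1 F AF z zd1).
  by rewrite !sdivK ?psi_neq0// subrr md0.
have [d1 d10 H1] := quotient_equicontinuous qd ltr01.
pose c := md (psi1 z0) / 2.
have c0 : 0 < c by rewrite divr_gt0// md_gt0.
have [d2 d20 H2] := holo_contat hp1 c0.
have psi1c z : md (z - z0) < d2 -> c <= md (psi1 z).
  by move=> /H2; have := mdB (psi1 z0) (psi1 z); rewrite (mdBC (psi1 z0)) /c; clear; lra.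
have [d3 d30 H3] := cpsi (e / 8) ltac:(by rewrite divr_gt0).
pose del := Num.min r (Num.min d1 d2).
have del0 : 0 < del by rewrite !lt_min r0 d10.
have delP z : md (z - z0) < del -> [/\ md (z - z0) < r, md (z - z0) < d1 & md (z - z0) < d2].
  by rewrite !lt_min => /andP[? /andP[]].
clearbody del.
pose rho := del / 4; have rho0 : 0 < rho by rewrite divr_gt0.
(* On the boundary of the square of half-side [rho], psi = (w - z0) ^ k psi1 has modulus at least
   [rho ^+ k * c]. *)
pose M := (rho ^+ k * c)^-1.
have M0 : 0 < M by rewrite invr_gt0 mulr_gt0// exprn_gt0.
pose L := 4 * (8 * M / (rho / 2)).
have L0 : 0 < L by rewrite !mulr_gt0// invr_gt0 divr_gt0.
exists (Num.min (Num.min del d3) (Num.min (rho / 4) (e / (L + 1)))).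
  by rewrite !lt_min del0 d30 !divr_gt0// ltr_wpDl// ltW.
move=> F AF z; rewrite !lt_min => /andP[/andP[zd zd3] /andP[zr ze]].
have Fmul w : md (w - z0) < r -> w != z0 -> F w = smul (psi w) (sdiv (F w) (psi w)).
  by move=> wr wz; rewrite sdivK//; exact: psi0.
have [zz|zz] := eqVneq z z0; first by rewrite zz sdpp.
have [Q0|Q0] := eqVneq (F z0) (Some 0).
  have [zr' zd1 _] := delP z zd.
  have := H1 F AF z zd1; rewrite Q0 pz0 /= eqxx => /ltW /sd_Some0[a Qa ha].
  have a1 : md a <= 1.
    by apply: le_trans ha _; have := H1 F AF z zd1; rewrite Q0 pz0 /= eqxx => /ltW.
  rewrite (Fmul z zr' zz) Qa /=; apply: le_lt_trans (sd_fin_le _ _) _.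
  rewrite subr0 mdM; have := H3 z zd3; rewrite pz0 subr0 => h3.
  have : md (psi z) * md a <= e / 8 * 1 by rewrite ler_pM// ltW.
  by move: e0; clear; lra.
have Qz0 : sdiv (F z0) (psi z0) = None.
  rewrite pz0; case: (F z0) Q0 => //= a Q0.
  by rewrite eqxx ifN//; apply: contra_neq Q0 => ->.
pose kf w := finite_part (sinv (F w)).
have Qw w : md (w - z0) < del -> exists2 a, sinv (sdiv (F w) (psi w)) = Some a & md a <= 1.
  move=> /delP[_ wd1 _]; have := H1 F AF w wd1; rewrite Qz0 -sd_sinv /= => h.
  have [a Ea ha] := sd_Some0 (ltW h); exists a => //; apply: le_trans ha _; exact: ltW.
have sF w : md (w - z0) < del -> sinv (F w) = Some (kf w).
  move=> wd; rewrite /kf; case E : (sinv (F w)) => [//|]; exfalso.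
  (* A zero of [F] would be a zero of the quotient, whose reciprocal is finite here. *)
  have Fw : F w = Some 0 by rewrite -[F w]sinvK E.
  have [a] := Qw w wd; rewrite Fw /= eqxx mul0r.
  by case: ifP => _; rewrite /= eqxx.
have hk w : md (w - z0) < del -> holo kf w.
  move=> wd; apply: finite_part_holo; last by rewrite sF.
  by apply: shol_sinv; apply: mero_shol; apply: mF => //; have [] := delP w wd.
have inr w : sq z0 rho w -> md (w - z0) < del.
  by move/md_sq_le => h; apply: le_lt_trans h _; rewrite /rho; move: del0; clear; lra.
have kb w : sqb z0 rho w -> md (kf w) <= M.
  move=> wb; have wd := inr w (sqb_sq wb).
  have [wr _ wd2] := delP w wd.
  have far := sqb_md wb.
  have wz : w != z0 by rewrite -subr_eq0 -md_gt0 (lt_le_trans rho0).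
  have pw := psi0 w wr wz.
  have [a Qa a1] := Qw w wd.
  have := sF w wd; rewrite (Fmul w wr wz) smul_sinv// Qa /= => -[<-].
  rewrite mdM mdV -[leRHS]mulr1; apply: ler_pM => //; first by rewrite invr_ge0.
  have rc0 : 0 < rho ^+ k * c by rewrite mulr_gt0 ?exprn_gt0.
  rewrite lef_pV2 ?posrE ?md_gt0//.
  rewrite Hp mdM mdX; apply: ler_pM; rewrite ?exprn_ge0 ?(ltW rho0) ?(ltW c0)//.
    by rewrite lerXn2r ?nnegrE// ltW.
  exact: psi1c.
have kM w : sq z0 (rho / 2) w -> md (kf w) <= M.
  move=> win; apply: (@max_modulus R kf z0 rho w M) => //.
    by exists (rho / 2); [rewrite divr_gt0|rewrite {1}[rho]splitr addrK].
  by move=> x xin; apply: holo_dif; apply: hk; exact: inr.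
rewrite -sd_sinv !sF//; last by rewrite subrr md0.
apply: le_lt_trans (sd_fin_le _ _) _.
have : md (kf z - kf z0) <= 8 * M / (rho / 2) * md (z - z0).
  apply: lipschitz_center => //.
  - by rewrite divr_gt0.
  - move=> x xin; apply: holo_dif; apply: hk; apply: inr; apply: sq_le xin.
    by move: rho0; clear; lra.
  - apply: sq_md; apply: ltW; move: zr; have -> : rho / 2 / 2 = rho / 4 by field.
    by [].
move=> h; apply: (@le_lt_trans _ _ (L * md (z - z0))).
  by rewrite /L -mulrA ler_wpM2l.
have L1 : 0 < L + 1 by rewrite ltr_wpDl// ltW.
apply: (@le_lt_trans _ _ ((L + 1) * md (z - z0))); first by rewrite ler_wpM2r// lerDl.
by rewrite mulrC -ltr_pdivlMr.
Qed.

End LocalEquicontinuity.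

(** * Use of the sharing hypothesis and of the connectedness of the domain *)

Section Equicontinuity.
Variable R : realType.
Local Notation C := (Cplane R).
Local Notation S := (sphere R).
Local Notation md := (@modulus R).
Implicit Types (f g h H psi : C -> C) (F : C -> S) (z w : C).

Lemma exists_punctured z0 (d : R) : 0 < d -> exists2 z, z != z0 & md (z - z0) < d.
Proof.
move=> d0; have zE : md (z0 + mkC (d / 2) 0 - z0) = d / 2.
  by rewrite addrAC subrr add0r md_mkC0 gtr0_norm// divr_gt0.
exists (z0 + mkC (d / 2) 0); last by rewrite zE; lra.
by rewrite -subr_eq0 -md_gt0 zE divr_gt0.
Qed.

Lemma holo_punctured f z : holo f z -> 
  (exists2 d : R, 0 < d & forall w, md (w - z) < d -> f w = 0) \/
  exists n k, [/\ holo k z, k z != 0, forall w, f w = (w - z) ^+ n * k w &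
    exists2 d : R, 0 < d & forall w, md (w - z) < d -> w != z -> f w != 0].
Proof.
move=> /holo_factor[|[n [k [hk kz fk]]]]; [by left|right; exists n, k; split => //].
have [d d0 H] := contat_neq (holo_contat hk) kz; exists d => // w /H kw wz.
by rewrite fk mulf_neq0// expf_neq0// subr_eq0.
Qed.

(** The set of points near which [Q] holds identically is open and closed in [D]. This form serves
    both zeros of psi and poles of a limit map. *)
Lemma identity_dichotomy (D Q : set C) : open D -> connected D ->
  (forall z0, D z0 -> (exists2 d : R, 0 < d & forall z, md (z - z0) < d -> Q z) \/
     (exists2 d : R, 0 < d & forall z, md (z - z0) < d -> z != z0 -> ~ Q z)) ->
  (forall z, D z -> Q z) \/
  (forall z0, D z0 ->
     exists2 d : R, 0 < d & forall z, md (z - z0) < d -> z != z0 -> ~ Q z).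
Proof.
move=> oD cD QD.
pose P z0 := exists2 d : R, 0 < d & forall z, md (z - z0) < d -> Q z.
have openP z0 : P z0 -> exists2 d : R, 0 < d & forall z, md (z - z0) < d -> P z.
  move=> [d d0 h]; exists (d / 2); first by rewrite divr_gt0.
  move=> z zd; exists (d / 2); first by rewrite divr_gt0.
  move=> w wd; apply: h; have := md_triangle w z z0; move: zd wd; clear; lra.
have openN z0 : D z0 -> ~ P z0 -> exists2 d : R, 0 < d & forall z, md (z - z0) < d -> ~ P z.
  move=> Dz0 NP; case: (QD z0 Dz0) => // -[d d0 h]; exists d => // z zd [d' d'0 h'].
  have dd : 0 < Num.min d' (d - md (z - z0)) by rewrite lt_min d'0 subr_gt0.
  have [zz0|zz0] := eqVneq z z0; last by apply: (h z zd zz0); apply: h'; rewrite subrr md0.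
  have [w wz] := exists_punctured z dd; rewrite lt_min => /andP[/h' Qw w2].
  by apply: (h w _ _ Qw); rewrite -?zz0//; move: w2; rewrite zz0 subrr md0 subr0.
have [[z1 Dz1 Pz1]|NP] := pselect (exists2 z, D z & P z); last first.
  by right=> z0 Dz0; case: (QD z0 Dz0) => // hP; exfalso; apply: NP; exists z0.
left; suff E : D `&` P = D.
  by move=> z; rewrite -E => -[_ [d d0]]; apply; rewrite subrr md0.
apply: cD.
- by exists z1.
- exists (D `&` P); last by rewrite setIA setIid.
  apply/open_md => z [Dz /openP[d d0 h]]; have [d' d'0 h'] := (open_md D).1 oD z Dz.
  by exists (Num.min d d'); [rewrite lt_min d0|move=> w; rewrite lt_min => /andP[/h ? /h']].
- exists (~` (D `&` ~` P)).
    rewrite closedC; apply/open_md => z [Dz NPz].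
    have [d d0 h] := openN z Dz NPz; have [d' d'0 h'] := (open_md D).1 oD z Dz.
    by exists (Num.min d d'); [rewrite lt_min d0|move=> w; rewrite lt_min => /andP[/h ? /h']].
  by apply/seteqP; split => z [Dz h]; split => //; [move=> []|apply: contrapT => NP; apply: h].
Qed.

(** In the finite case the zeros of [H - psi] are isolated or fill a disc. At a pole,
    [h - psi * (z - z0) ^+ n] is nonzero at [z0], hence nearby. *)
Lemma agree_dichotomy F psi z0 : holo psi z0 ->
  (exists H, mero_fin F z0 H) \/ (exists n h, mero_pole F z0 n h) ->
  (exists2 d : R, 0 < d & forall z, md (z - z0) < d -> F z = Some (psi z)) \/
  (exists2 d : R, 0 < d & forall z, md (z - z0) < d -> z != z0 -> F z <> Some (psi z)).
Proof.
move=> hpsi [[H [hH [d d0 FH]]]|[n [h [n0 hh h0 _ [d d0 Fh]]]]].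
  have [[d1 d10 H1]|[n [k [_ _ _ [d1 d10 H1]]]]] := holo_punctured (holoB hH hpsi).
    left; exists (Num.min d d1); first by rewrite lt_min d0.
    move=> z; rewrite lt_min => /andP[/FH -> /H1/eqP]; rewrite subr_eq0 => /eqP ->.
    by [].
  right; exists (Num.min d d1); first by rewrite lt_min d0.
  move=> z; rewrite lt_min => /andP[/FH -> /H1 h] /h; rewrite subr_eq0 => /eqP Hn [].
  by move/Hn.
have hg : holo (fun w => h w - psi w * (w - z0) ^+ n) z0.
  apply: holoB => //; apply: holoM => //; apply: holoX; apply: holoB;
    [exact: holo_id|exact: holo_cst].
have g0 : h z0 - psi z0 * (z0 - z0) ^+ n != 0.
  by rewrite subrr expr0n gtn_eqF// mulr0 subr0.
have [d1 d10 H1] := contat_neq (holo_contat hg) g0.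
right; exists (Num.min d d1); first by rewrite lt_min d0.
move=> z; rewrite lt_min => /andP[zd /H1 /eqP gz] zz; rewrite (Fh z zz zd) => -[E].
by apply: gz; rewrite -E divfK ?subrr// expf_neq0// subr_eq0.
Qed.

(** A single member [F0] decides the case and the radius, since its coincidence points with psi are
    those of every member. *)
Lemma equicontinuous_at D (A : set (C -> S)) m psi a0 aoo z0 :
  (a0 = 2%N /\ aoo = 3%N) \/ (a0 = 3%N /\ aoo = 2%N) ->
  domain D -> (forall F, A F -> meromorphic_on D F) ->
  holomorphic_on D psi -> (exists2 z, D z & psi z != 0) ->
  zeros_mult_le D (Some \o psi) m ->
  (forall F, A F -> poles_mult_ge D F (aoo * (m + 1))%N /\
                    zeros_mult_ge D F (a0 * (m + 1))%N) ->
  (forall F G, A F -> A G -> share_IM D F G (Some \o psi)) ->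
  D z0 -> forall e : R, 0 < e ->
  exists2 d : R, 0 < d & forall F, A F -> forall z, md (z - z0) < d -> sd (F z) (F z0) < e.
Proof.
move=> ords [_ oD cD] mA hpsi [z1 Dz1 psi1] psim mults sh Dz0 e e0.
have [[F0 AF0]|NA] := pselect (exists F, A F); last first.
  by exists 1 => // F AF; exfalso; apply: NA; exists F.
have hol z : D z -> holo psi z.
  move=> Dz; have [d d0 h] := (open_md D).1 oD z Dz; apply: holo_mk; exists d => // w /h Dw.
  by have [l hl] := derivable_hasd (hpsi w Dw); exists l.
have [d0 d00 hD] := (open_md D).1 oD z0 Dz0.
have [k [psi2 [hk kz pk [d1 d10 h1]]]] : exists n k, [/\ holo k z0, k z0 != 0,
    forall w, psi w = (w - z0) ^+ n * k w &
    exists2 d : R, 0 < d & forall w, md (w - z0) < d -> w != z0 -> psi w != 0].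
  have [|h|h] := @identity_dichotomy D [set z | psi z = 0] oD cD.
  - move=> z Dz; have [|[n [k [_ _ _ [d d0' H]]]]] := holo_punctured (hol z Dz); first by left.
    by right; exists d => // w wd wz /eqP; apply/negP; exact: H.
  - by move: psi1; rewrite (h z1 Dz1) eqxx.
  - have [[d dp H]|//] := holo_punctured (hol z0 Dz0); exfalso.
    have [d' d'0 H'] := h z0 Dz0.
    have mp : 0 < Num.min d d' by rewrite lt_min dp.
    have [w wz] := exists_punctured z0 mp; rewrite lt_min => /andP[/H p0 /H'].
    by move=> /(_ wz); apply.
have km : (k <= m)%N.
  case: k pk => // k pk; apply: (psim z0) => //; split => //.
  exists psi2; split => //; first exact/holoE.
  by apply: (nbhs_md z0 _).2; exists 1 => // w _ /=; rewrite pk.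
(* In the first case all members equal psi near [z0], and continuity of psi suffices. *)
have [[d dp H]|[d dp H]] := agree_dichotomy (hol z0 Dz0) ((meroE D F0).1 (mA F0 AF0) z0 Dz0).
  have [d' d'0 H'] := holo_contat (hol z0 Dz0) (e := e / 4) ltac:(by rewrite divr_gt0).
  exists (Num.min d0 (Num.min d d')); first by rewrite !lt_min d00 dp.
  have agree F z : A F -> md (z - z0) < Num.min d0 d -> F z = Some (psi z).
    move=> AF; rewrite lt_min => /andP[/hD Dz /H Fz].
    have : [set z | D z /\ F0 z = (Some \o psi) z] z by [].
    by rewrite (sh F0 F AF0 AF) => -[].
  move=> F AF z; rewrite !lt_min => /andP[zd0 /andP[zd zd']].
  have -> : F z = Some (psi z) by apply: agree; rewrite ?lt_min ?zd0.
  have -> : F z0 = Some (psi z0) by apply: agree; rewrite ?subrr ?md0 ?lt_min ?d00.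
  by apply: le_lt_trans (sd_fin_le _ _) _; have := H' z zd'; move: e0; clear; lra.
pose r := Num.min d0 (Num.min d1 d).
have rP z : md (z - z0) < r -> [/\ D z, md (z - z0) < d1 & md (z - z0) < d].
  by rewrite !lt_min => /andP[/hD ? /andP[]].
have mge a : (a <= a * (m + 1))%N by rewrite leq_pmulr// addn1.
apply: (@family_equicontinuous R A psi z0 r k psi2 a0 aoo) => //; split => //.
- by rewrite !lt_min d00 d10.
- by move=> F AF z /rP[Dz _ _]; apply: ((meroE D F).1 (mA F AF)).
- by move=> z /rP[Dz _ _]; exact: hol.
- by move=> z /rP[_ zd _]; exact: h1.
- move=> F AF z n /rP[Dz _ _] hz; have := (mults F AF).2 z n Dz hz => h.
  split; first exact: leq_trans (mge a0) h.
  (* Here [k <= m < m + 1 <= a0 * (m + 1) <= n]: the zero of F outweighs that of psi. *)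
  apply: leq_trans h; rewrite addn1; apply: leq_trans (_ : m.+1 <= _)%N => //.
  by rewrite leq_pmull//; case: ords => -[-> _].
- move=> F AF z n /rP[Dz _ _] hz; have := (mults F AF).1 z n Dz hz => h.
  exact: leq_trans (mge aoo) h.
- move=> F AF z /rP[Dz _ zd] zz Fz; apply: (H z zd zz).
  have : [set z | D z /\ F z = (Some \o psi) z] z by [].
  by rewrite (sh F F0 AF AF0) => -[].
Qed.

End Equicontinuity.

(** * Ultrafilter limits, locally uniform convergence and holomorphy of the limit *)

Section Compactness.
Variable R : realType.
Local Notation C := (Cplane R).
Local Notation S := (sphere R).
Local Notation md := (@modulus R).
Implicit Types (f g h H : C -> C) (F G : C -> S) (z w : C).

(** The limit is the supremum of the levels that [u] reaches on a set of [U], every level being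
    decided by the ultrafilter. Such limits exist at all points of the plane at once, before any
    subsequence is chosen. *)
Lemma ultra_limit (U : set_system nat) (u : nat -> R) (M : R) : UltraFilter U ->
  (forall n, `|u n| <= M) -> exists l, forall e, 0 < e -> U [set n | `|u n - l| < e].
Proof.
move=> UU uM; pose E := [set x | U [set n | x <= u n]].
have EM : E (- M).
  by apply: filterS filterT => n _ /=; have := uM n; rewrite ler_norml => /andP[].
have ubE : has_ubound E.
  exists M => x Ex; have [n /= xn] := filter_ex Ex.
  by apply: le_trans xn _; apply: le_trans (ler_norm _) _.
have supE : has_sup E by split => //; exists (- M).
exists (sup E) => e e0.
have [x Ex xe] := sup_adherent e0 supE.
have [h|h] := in_ultra_setVsetC [set n | sup E + e <= u n] UU.
  by have := ub_le_sup ubE h; rewrite gerDl leNgt e0.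
apply: filterS (filterI Ex h) => n [/= xn /negP]; rewrite -ltNge => nu.
by rewrite ltr_norml ltrBlDl nu ltrBrDl andbT (lt_le_trans xe).
Qed.

Lemma st_norm_le1 (p : S) : [/\ `|stx p| <= 1, `|sty p| <= 1 & `|stt p| <= 1].
Proof.
have := st_sphere p.
have := sqr_ge0 (stx p); have := sqr_ge0 (sty p); have := sqr_ge0 (stt p).
by move=> a b c d; split; rewrite -ler_sqr ?nnegrE// real_normK ?num_real// expr1n; lra.
Qed.

Lemma sqr_close (x y e : R) : `|x| <= 1 -> e <= 1 -> `|x - y| < e -> `|x ^+ 2 - y ^+ 2| <= 3 * e.
Proof.
move=> x1 e1 xy; rewrite subr_sqr normrM mulrC.
have -> : x + y = 2 * x - (x - y) by ring.
apply: ler_pM => //; last exact: ltW.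
by apply: le_trans (ler_normB _ _) _; rewrite normrM gtr0_norm//; lra.
Qed.

Lemma ultra_sphere_limit (U : set_system nat) (p : nat -> S) : UltraFilter U ->
  exists q, forall e, 0 < e -> U [set n | sd (p n) q < e].
Proof.
move=> UU.
have [x Hx] := @ultra_limit U (fun n => stx (p n)) 1 UU
  ltac:(by move=> n; have [] := st_norm_le1 (p n)).
have [y Hy] := @ultra_limit U (fun n => sty (p n)) 1 UU
  ltac:(by move=> n; have [] := st_norm_le1 (p n)).
have [t Ht] := @ultra_limit U (fun n => stt (p n)) 1 UU
  ltac:(by move=> n; have [] := st_norm_le1 (p n)).
have xyt : x ^+ 2 + y ^+ 2 + t ^+ 2 = 1.
  apply/eqP; rewrite -subr_eq0 -normr_eq0; apply/negP => /negP ne0.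
  have gt0 : 0 < `|x ^+ 2 + y ^+ 2 + t ^+ 2 - 1| by rewrite lt_def ne0 /=.
  set m := `|_| in gt0.
  (* Each squared coordinate is off by at most [3 * e], and [9 * e < m]. *)
  pose e := Num.min 1 (m / 10).
  have e0 : 0 < e by rewrite lt_min ltr01 divr_gt0.
  have e1 : e <= 1 by rewrite ge_min lexx.
  have e2 : e <= m / 10 by rewrite ge_min lexx orbT.
  have [n [[/= nx ny] nt]] := filter_ex (filterI (filterI (Hx e e0) (Hy e e0)) (Ht e e0)).
  have [bx bY bt] := st_norm_le1 (p n).
  have hx := sqr_close bx e1 nx; have hy := sqr_close bY e1 ny.
  have ht := sqr_close bt e1 nt; have hs := st_sphere (p n).
  have : m <= 9 * e; last by move: e2 gt0; clear; lra.
  move: hx hy ht hs; rewrite /m !ler_norml => /andP[? ?] /andP[? ?] /andP[? ?] ?.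
  by apply/andP; split; lra.
have [q [qx qy qt]] := st_surj xyt.
exists q => e e0; have e3 : 0 < e / 3 by rewrite divr_gt0.
apply: filterS (filterI (filterI (Hx _ e3) (Hy _ e3)) (Ht _ e3)) => n [[/=]].
by rewrite /sd qx qy qt; lra.
Qed.

Definition rational_point (k : nat) : C :=
  if unpickle k is Some (a, b) then mkC (ratr a : R) (ratr (b : rat)) else 0.

Lemma rational_point_dense z (d : R) : 0 < d -> exists k, md (rational_point k - z) < d.
Proof.
move=> d0; have near x : exists a, `|ratr a - x| < d / 2.
  have /rat_in_itvoo[a] : x < x + d / 2 by rewrite ltrDl divr_gt0.
  rewrite in_itv /= => /andP[a1 a2]; exists a; rewrite gtr0_norm ?subr_gt0//.
  by rewrite ltrBlDl.
have [a ha] := near (re z); have [b hb] := near (im z).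
exists (pickle (a, b)); rewrite /rational_point pickleK.
apply: le_lt_trans (md_le_reim _) _.
by rewrite !reimE [d]splitr ltrD.
Qed.

(** As [U] refines the filter at infinity, beyond any index some [n] serves finitely many points at
    once; recursion then handles the whole sequence [q] by a genuine subsequence. *)
Lemma diagonal_extraction (U : set_system nat) (f : nat -> C -> S) G (q : nat -> C) :
  UltraFilter U -> \oo `<=` U ->
  (forall z (e : R), 0 < e -> U [set n | sd (f n z) (G z) < e]) ->
  exists2 phi : nat -> nat, {homo phi : i j / (i < j)%N} &
    forall k n, (k <= n)%N -> sd (f (phi n) (q k)) (G (q k)) < n.+1%:R^-1.
Proof.
move=> UU ooU fG.
have many j (e : R) : 0 < e -> U [set n | forall k, (k < j)%N -> sd (f n (q k)) (G (q k)) < e].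
  move=> e0; elim: j => [|j IH]; first by apply: filterS filterT => n _ k.
  apply: filterS (filterI IH (fG (q j) e e0)) => n [/= h1 h2] k.
  by rewrite ltnS leq_eqVlt => /predU1P[->//|]; exact: h1.
have /choice[nxt nxtP] : forall Nj : nat * nat, exists n, (Nj.1 < n)%N /\
    forall k, (k <= Nj.2)%N -> sd (f n (q k)) (G (q k)) < Nj.2.+1%:R^-1.
  move=> [N j].
  have e0 : 0 < (j.+1%:R : R)^-1 by rewrite invr_gt0.
  have oo : U [set n | (N < n)%N] by apply: ooU; exact: nbhs_infty_gt.
  have [n [/= h1 h2]] := filter_ex (filterI oo (many j.+1 _ e0)).
  by exists n; split.
pose phi := fix phi n := if n is n'.+1 then nxt (phi n', n) else nxt (0, 0)%N.
exists phi.
  by apply: homo_ltn => [i j k|i]; [exact: ltn_trans|exact: (nxtP (phi i, i.+1)).1].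
by move=> k [|n] kn /=; [exact: (nxtP (0, 0)%N).2|exact: (nxtP (phi n, n.+1)).2].
Qed.

(** The limit inherits from [f] an oscillation below 3e/10. Going from [f (phi n) w] through [z0] to
    a rational point [q], across to [G q] and back through [z0] costs three terms e/10 and two terms
    3e/10, in all 9e/10. *)
Lemma pointwise_to_local_uniform (U : set_system nat) (f : nat -> C -> S) G phi z0 (e : R) :
  UltraFilter U -> (forall z (e : R), 0 < e -> U [set n | sd (f n z) (G z) < e]) ->
  (forall k n, (k <= n)%N ->
     sd (f (phi n) (rational_point k)) (G (rational_point k)) < n.+1%:R^-1) ->
  (forall e : R, 0 < e -> exists2 d : R, 0 < d &
     forall n z, md (z - z0) < d -> sd (f n z) (f n z0) < e) ->
  0 < e -> exists d N, 0 < d /\ forall n w, (N <= n)%N -> md (w - z0) < d ->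
    sd (f (phi n) w) (G w) < e /\ sd (G w) (G z0) < e.
Proof.
move=> UU fG hphi eqc e0; have e10 : 0 < e / 10 by rewrite divr_gt0.
have [d d0 hd] := eqc _ e10.
have Gd w : md (w - z0) < d -> sd (G w) (G z0) < 3 * (e / 10).
  move=> wd; have [n [/= h1 h2]] := filter_ex (filterI (fG w _ e10) (fG z0 _ e10)).
  have := sd_triangle (f n w) (G w) (G z0); have := sd_triangle (f n z0) (f n w) (G z0).
  by have := hd n w wd; rewrite (sdC (G w) (f n w)); move: h1 h2; clear; lra.
have [k hk] := rational_point_dense z0 d0.
have e10' : 0 <= (e / 10)^-1 by rewrite invr_ge0 ltW.
have := archi_boundP e10'.
set N := Num.bound _ => hN.
exists d, (maxn k N); split => // n w; rewrite geq_max => /andP[kn Nn] wd.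
have ne : n.+1%:R^-1 < e / 10.
  rewrite -[ltRHS]invrK ltf_pV2 ?posrE ?invr_gt0//.
  by apply: lt_le_trans hN _; rewrite ler_nat leqW.
have Gw := Gd w wd; split; last by move: Gw e0; clear; lra.
have := lt_trans (hphi k n kn) ne; set q := rational_point k in hk *.
have := sd_triangle (f (phi n) z0) (f (phi n) w) (G w).
have := sd_triangle (f (phi n) q) (f (phi n) z0) (G w).
have := sd_triangle (G q) (f (phi n) q) (G w).
have := sd_triangle (G z0) (G q) (G w).
have := Gd q hk; have := hd (phi n) q hk; have := hd (phi n) w wd.
by rewrite (sdC (G z0) (G w)) (sdC (f (phi n) z0) (f (phi n) q)); move: Gw e0; clear; lra.
Qed.

(** Near a finite value [c] the maps are finite and bounded by [2 * (1 + md c)] from some index on,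
    so the theorem on limits of bounded holomorphic functions applies to their finite parts. *)
Lemma limit_shol_finite (f : nat -> C -> S) G z0 c (d0 : R) : 0 < d0 ->
  (forall n z, md (z - z0) < d0 -> shol (f n) z) ->
  (forall z, md (z - z0) < d0 -> forall e : R, 0 < e ->
     exists N, forall n, (N <= n)%N -> sd (f n z) (G z) < e) ->
  (forall e : R, 0 < e -> exists d N, 0 < d /\ forall n w, (N <= n)%N -> md (w - z0) < d ->
     sd (f n w) (Some c) < e /\ sd (G w) (Some c) < e) ->
  shol G z0.
Proof.
move=> d00 hf cvg near_c.
have L0 : 0 < 1 + md c by rewrite ltr_pwDl.
have finite (p : S) : sd p (Some c) < (1 + md c)^-1 ->
    exists2 a, p = Some a & md a <= 2 * (1 + md c).
  move=> pc; have pc1 : sd p (Some c) * (1 + md c) <= 1.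
    by rewrite -ler_pdivlMr// div1r ltW.
  have [a pa ha] := sd_fin_close pc1; exists a => //.
  have : (1 + md c) ^+ 2 * sd p (Some c) <= 1 + md c.
    by rewrite expr2 -mulrA -[leRHS]mulr1 ler_wpM2l ?(ltW L0)// mulrC.
  by have := mdB a c; move: ha; clear; lra.
have [|d1 [N [d10 HN]]] := near_c (1 + md c)^-1; first by rewrite invr_gt0.
pose d := Num.min d0 d1; have dp : 0 < d by rewrite lt_min d00.
pose r := d / 8; have r0 : 0 < r by rewrite divr_gt0.
have ind z : sq z0 (2 * r) z -> md (z - z0) < d0 /\ md (z - z0) < d1.
  move/md_sq_le => h; apply/andP; rewrite -lt_min -/d; apply: le_lt_trans h _.
  by rewrite /r; move: dp; clear; lra.
have Gc z : md (z - z0) < d1 -> exists2 b, G z = Some b & md b <= 2 * (1 + md c).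
  by move=> zd; apply: finite; exact: (HN N z (leqnn N) zd).2.
have fc n z : md (z - z0) < d1 -> exists2 b, f (n + N)%N z = Some b & md b <= 2 * (1 + md c).
  by move=> zd; apply: finite; exact: (HN _ z (leq_addl n N) zd).1.
have dG z : sq z0 r z -> dif (fun w => finite_part (G w)) z.
  apply: (@limit_dif R (fun n w => finite_part (f (n + N)%N w)) _ z0 r (2 * (1 + md c))) => //.
  - move=> n w /ind[w0 w1]; apply: holo_dif; apply: finite_part_holo; first exact: hf.
    by have [b ->] := fc n w w1.
  - by move=> n w /ind[w0 w1]; have [b ->] := fc n w w1.
  - move=> w /ind[w0 w1] e e0; have [b Gb _] := Gc w w1.
    have b0 : 0 < 1 + md b by rewrite ltr_pwDl.
    pose eta := Num.min (1 + md b)^-1 (e / (1 + md b) ^+ 2).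
    have eta0 : 0 < eta by rewrite lt_min invr_gt0 b0 divr_gt0 ?exprn_gt0.
    have [N' HN'] := cvg w w0 eta eta0; exists N' => n Nn.
    have := HN' (n + N)%N (leq_trans Nn (leq_addr _ _)); rewrite Gb lt_min => /andP[s1 s2].
    have s3 : sd (f (n + N)%N w) (Some b) * (1 + md b) <= 1.
      by rewrite -ler_pdivlMr// div1r ltW.
    have [a ea ha] := sd_fin_close s3; rewrite ea /=; apply: le_lt_trans ha _.
    by rewrite mulrC -ltr_pdivlMr ?exprn_gt0.
exists (fun w => finite_part (G w)); split; first by exists r.
by exists d1 => //; left=> w /Gc[b ->].
Qed.

Lemma limit_shol (f : nat -> C -> S) G z0 (d0 : R) : 0 < d0 ->
  (forall n z, md (z - z0) < d0 -> shol (f n) z) ->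
  (forall z, md (z - z0) < d0 -> forall e : R, 0 < e ->
     exists N, forall n, (N <= n)%N -> sd (f n z) (G z) < e) ->
  (forall e : R, 0 < e -> exists d N, 0 < d /\ forall n w, (N <= n)%N -> md (w - z0) < d ->
     sd (f n w) (G z0) < e /\ sd (G w) (G z0) < e) ->
  shol G z0.
Proof.
move=> d00 hf cvg; case E : (G z0) => [c|]; last move=> near_c.
  by move=> near_c; exact: (limit_shol_finite d00 hf cvg near_c).
have -> : G = (fun w => sinv (sinv (G w))) by apply/funext => w; rewrite sinvK.
apply: shol_sinv; apply: (@limit_shol_finite (fun n w => sinv (f n w)) _ z0 0 d0) => //.
- by move=> n z zd; apply: shol_sinv; exact: hf.
- by move=> z zd e e0; have [N HN] := cvg z zd e e0; exists N => n /HN; rewrite sd_sinv.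
- move=> e e0; have [d [N [dp HN]]] := near_c e e0; exists d, N; split => // n w Nn wd.
  have -> : Some 0 = sinv None by [].
  by rewrite !sd_sinv; exact: HN.
Qed.

(** By [identity_dichotomy] applied to the value infinity, a limit that is not constantly infinity
    has isolated poles; factoring the reciprocal gives each a finite multiplicity. *)
Lemma shol_dichotomy (D : set C) G : open D -> connected D -> (forall z, D z -> shol G z) ->
  meromorphic_on D G \/ (forall z, D z -> G z = None).
Proof.
move=> oD cD hG.
have [|h|h] := @identity_dichotomy R D [set z | G z = None] oD cD; last 2 first.
- by right.
- left; apply/meroE => z Dz; have [d d0 Gd] := h z Dz.
  have [H [hH [d1 d10 [GH|GH]]]] := hG z Dz.
    by left; exists H; split => //; exists d1.
  have [[d2 d20 H2]|[n [k [hk kz Hk _]]]] := holo_punctured hH.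
    have mp : 0 < Num.min d (Num.min d1 d2) by rewrite !lt_min d0 d10.
    have [w wz] := exists_punctured z mp; rewrite !lt_min => /andP[w0 /andP[w1 w2]].
    by exfalso; apply: (Gd w w0 wz) => /=; rewrite (GH w w1) (H2 w w2) /= eqxx.
  have [d3 d30 H3] := contat_neq (holo_contat hk) kz.
  have Gk w : md (w - z) < Num.min d1 d3 -> w != z ->
      G w = Some ((k w)^-1 / (w - z) ^+ n).
    rewrite lt_min => /andP[/GH -> /H3 kw] wz /=.
    by rewrite Hk mulf_eq0 (negbTE kw) orbF expf_eq0 subr_eq0 (negbTE wz) andbF invfM mulrC.
  have mp : 0 < Num.min d1 d3 by rewrite lt_min d10.
  have hV := holoV hk kz.
  (* Exponent 0 means that [G z] is finite: the chart at infinity was used at a regular point. *)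
  case: n => [|n] in Hk Gk.
    left; exists (fun w => (k w)^-1); split => //; exists (Num.min d1 d3) => // w wd.
    have [wz|wz] := eqVneq w z; last by rewrite Gk// expr0 divr1.
    rewrite wz GH ?subrr ?md0//= Hk expr0 mul1r (negbTE kz).
    by [].
  right; exists n.+1, (fun w => (k w)^-1); split => //; first by rewrite invr_eq0.
    by rewrite GH ?subrr ?md0//= Hk subrr expr0n mul0r eqxx.
  by exists (Num.min d1 d3) => // w wz wd; exact: Gk.
move=> z Dz; have [H [hH [d d0 [GH|GH]]]] := hG z Dz.
  by right; exists d => // w /GH /= ->.
have [[d1 d10 H1]|[n [k [_ _ _ [d1 d10 H1]]]]] := holo_punctured hH; [left|right];
  (exists (Num.min d d1); first by rewrite lt_min d0).
  by move=> w; rewrite lt_min => /andP[/GH /= -> /H1 ->]; rewrite /= eqxx.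
by move=> w; rewrite lt_min => /andP[/GH /= -> /H1 h] /h /= /negbTE ->.
Qed.

(** The ultrafilter defines the limit everywhere, the subsequence is controlled at rational points,
    and equicontinuity spreads this control to a disc around each point of [D]; compactness makes it
    uniform. *)
Lemma equicontinuous_normal (D : set C) (A : set (C -> S)) : domain D ->
  (forall F, A F -> forall z, D z -> shol F z) ->
  (forall z0, D z0 -> forall e : R, 0 < e -> exists2 d : R, 0 < d &
     forall F, A F -> forall z, md (z - z0) < d -> sd (F z) (F z0) < e) ->
  normal_family D A.
Proof.
move=> [_ oD cD] hA eqc f Af.
have [U [UU ooU]] := @ultraFilterLemma nat \oo _.
have /choice[G fG] : forall z, exists q, forall e : R, 0 < e -> U [set n | sd (f n z) q < e].
  by move=> z; exact: ultra_sphere_limit.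
have [phi phi_mono hphi] := diagonal_extraction rational_point UU ooU fG.
have loc z0 e : D z0 -> 0 < e -> exists d N, 0 < d /\ forall n w, (N <= n)%N ->
    md (w - z0) < d -> sd (f (phi n) w) (G w) < e /\ sd (G w) (G z0) < e.
  move=> Dz0 e0; apply: (pointwise_to_local_uniform UU fG hphi) => // e' e'0.
  by have [d d0 h] := eqc z0 Dz0 e' e'0; exists d => // n z; exact: h.
exists phi => //; exists G.
  apply: shol_dichotomy => // z0 Dz0; have [d0 d00 hD] := (open_md D).1 oD z0 Dz0.
  apply: (@limit_shol (fun n => f (phi n)) G z0 d0) => //.
  - by move=> n z /hD; exact: hA.
  - move=> z /hD Dz e e0; have [d [N [dp HN]]] := loc z e Dz e0; exists N => n Nn.
    by apply: (HN n z Nn _).1; rewrite subrr md0.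
  - move=> e e0; have e2 : 0 < e / 2 by rewrite divr_gt0.
    have [d [N [dp HN]]] := loc z0 _ Dz0 e2; exists d, N; split => // n w Nn wd.
    have [h1 h2] := HN n w Nn wd; split; last by move: h2 e0; clear; lra.
    by have := sd_triangle (G w) (f (phi n) w) (G z0); move: h1 h2; clear; lra.
move=> K [KD cK] e e0; have [d d0 sph] := spherical_lt e0.
have /compact_near_coveringP/(_ nat \oo (fun n z => spherical_dist (f (phi n) z) (G z) < e)) := cK.
have cov : forall x, K x -> \forall x' \near x & i \near \oo,
    spherical_dist (f (phi i) x') (G x') < e.
  move=> z Kz; have [d1 [N [d10 HN]]] := loc z d (KD z Kz) d0.
  exists ([set w | md (w - z) < d1], [set n | (N <= n)%N]).
    by split => /=; [apply: (nbhs_md z _).2; exists d1|exact: nbhs_infty_ge].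
  by move=> [w n] [/= wd Nn]; apply: sph; apply: (HN n w Nn wd).1.
by move=> /(_ _ cov)[N _ HN]; exists N => n Nn z Kz; exact: (HN n Nn z Kz).
Qed.

End Compactness.

Theorem theorem1p1 (R : realType) (D : set (Cplane R))
  (F : set (Cplane R -> sphere R)) (m : nat) (psi : Cplane R -> Cplane R) :
  domain D ->
  (forall f, F f -> meromorphic_on D f) ->
  holomorphic_on D psi ->
  (exists2 z, D z & psi z != 0) ->
  zeros_mult_le D (Some \o psi) m ->
  (forall f, F f ->
     poles_mult_ge D f (3 * (m + 1))%N /\ zeros_mult_ge D f (2 * (m + 1))%N) \/
  (forall f, F f ->
     poles_mult_ge D f (2 * (m + 1))%N /\ zeros_mult_ge D f (3 * (m + 1))%N) ->
  (forall f g, F f -> F g -> share_IM D f g (Some \o psi)) ->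
  normal_family D F.
Proof.
move=> domD mF hpsi psi0 psim orders share; apply: equicontinuous_normal => //.
  by move=> f Ff z Dz; apply: mero_shol; exact: ((meroE D f).1 (mF f Ff)).
move=> z0 Dz0 e e0.
by case: orders => orders; [apply: (@equicontinuous_at _ D F m psi 2 3 z0)|
  apply: (@equicontinuous_at _ D F m psi 3 2 z0)]; auto.
Qed.
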